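(* Let $t\ge 2$ be an integer. Then $ex(n,H_{3t}^{M_t^3})= t_{3t-1}^{3}(n)$ for all sufficiently large $n$. Moreover, if $n$ is sufficiently large and $G$ is a $3$-graph on $[n]$ not containing $H_{3t}^{M_t^3}$ as a subgraph with $|G|=t_{3t-1}^{3}(n)$, then $G=T_{3t-1}^{3}(n)$ (up to isomorphism).
   Context: An $r$-graph is a vertex set with a family of $r$-element subsets (edges); $|G|$ is the number of edges. $M^r_t$ is the $r$-graph consisting of $t$ pairwise disjoint edges. For an $r$-graph $F$, $ex(n,F)$ is the maximum number of edges of an $r$-graph on $n$ vertices not containing $F$ as a subgraph. A pair of vertices is covered in a hypergraph if some edge contains both. For an $r$-graph $F$ ($r\ge3$) and $p\ge|V(F)|$, the extension $H_p^F$ is obtained as follows: label the vertices of $F$ as $v_1,\dots,v_{|V(F)|}$, add new vertices $v_{|V(F)|+1},\dots,v_p$, and for each pair $v_i,v_j$ ($1\le i<j\le p$) not covered in $F$ add a set $B_{ij}$ of $r-2$ new vertices and the edge $\{v_i,v_j\}\cup B_{ij}$, the sets $B_{ij}$ being pairwise disjoint and disjoint from $\{v_1,\dots,v_p\}$. $T^r_m(n)$ is the $r$-graph on $n$ vertices whose vertex set is partitioned into $m$ parts $V_1,\dots,V_m$ with sizes differing by at most one, with edge set all $r$-sets meeting each part in at most one vertex; $t^r_m(n)=|T^r_m(n)|$. *)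

(* Defs.v *)
From mathcomp Require Import all_boot.
From mathcomp Require Import zify.

Set Implicit Arguments.
Unset Strict Implicit.
Unset Printing Implicit Defensive.

(* An r-graph on the finite vertex type V is an edge set G : {set {set V}}
   satisfying [uniform r G]. *)
Section Hypergraphs.

Definition uniform (V : finType) (r : nat) (G : {set {set V}}) : bool :=
  [forall e in G, #|e| == r].

(* Not necessarily induced subgraph. *)
Definition contains (U V : finType) (F : {set {set U}}) (G : {set {set V}})
    : bool :=
  [exists f : {ffun U -> V}, injectiveb f && [forall e in F, f @: e \in G]].

Definition isomorphic (U V : finType) (F : {set {set U}}) (G : {set {set V}})
    : Prop :=
  exists2 f : U -> V, bijective f & G = [set f @: e | e : {set U} in F].

Definition ex_number (U : finType) (r n : nat) (F : {set {set U}}) : nat :=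
  \max_(G : {set {set 'I_n}} | uniform r G && ~~ contains F G) #|G|.

Definition covered (V : finType) (G : {set {set V}}) (P : {set V}) : bool :=
  [exists e in G, P \subset e].

End Hypergraphs.

Section Matching.
Variables r t : nat.

Definition matching : {set {set 'I_t * 'I_r}} :=
  [set [set x : 'I_t * 'I_r | x.1 == i] | i : 'I_t].

Lemma matching_uniform : uniform r matching.
Proof.
apply/forall_inP => _ /imsetP[i _ ->]; apply/eqP.
rewrite -[RHS](card_ord r) -(card_imset _ (f := fun k : 'I_r => (i, k))).
  apply: eq_card => -[j k]; rewrite !inE /=.
  apply/eqP/imsetP => [-> | [k' _ [-> _]] //].
  by exists k.
by move=> k l [].
Qed.

Lemma matching_disjoint (e f : {set 'I_t * 'I_r}) :
  e \in matching -> f \in matching -> e != f -> [disjoint e & f].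
Proof.
move=> /imsetP[i _ ->] /imsetP[j _ ->] neq.
rewrite disjoint_subset; apply/subsetP => x; rewrite !inE => /eqP xi.
by apply: contra neq => /eqP xj; rewrite -xi -xj.
Qed.

Lemma card_matching : 0 < r -> #|matching| = t.
Proof.
move=> r0; rewrite card_imset ?card_ord // => i j /setP/(_ (i, Ordinal r0)).
by rewrite !inE /= eqxx => /esym/eqP.
Qed.

End Matching.

Section Extension.
Variables (U : finType) (r p : nat) (F : {set {set U}}).

(* The vertices v_1, ..., v_p: those of F, then p - |V(F)| new ones; this is
   meant for #|U| <= p, the subtraction being truncated. *)
Definition core : finType := (U + 'I_(p - #|U|))%type.

Definition core_edges : {set {set core}} := [set inl @: e | e : {set U} in F].

Definition uncovered_pair (P : {set core}) : bool :=
  (#|P| == 2) && ~~ covered core_edges P.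

(* The vertices inr (P, k), k < r - 2, form the set B_ij for P = {v_i, v_j}. *)
Definition ext_vertex : finType :=
  (core + {P : {set core} | uncovered_pair P} * 'I_(r - 2))%type.

Definition pair_edge (P : {P : {set core} | uncovered_pair P})
    : {set ext_vertex} :=
  inl @: val P :|: [set inr (P, k) | k : 'I_(r - 2)].

Definition extension : {set {set ext_vertex}} :=
  [set inl @: e | e : {set core} in core_edges] :|:
  [set pair_edge P | P : {P : {set core} | uncovered_pair P}].

Lemma card_core : #|U| <= p -> #|core| = p.
Proof. by move=> leUp; rewrite card_sum card_ord subnKC. Qed.

Lemma extension_uniform : 2 <= r -> uniform r F -> uniform r extension.
Proof.
move=> r2 /forall_inP unifF; apply/forall_inP => e; rewrite inE.
case/orP => [/imsetP[_ /imsetP[e' e'F ->] ->] | /imsetP[P _ ->]].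
  by rewrite !card_imset ?unifF // => x y [].
have /andP[/eqP cP _] := valP P.
rewrite cardsU disjoint_setI0 ?cards0 ?subn0; last first.
  rewrite disjoint_subset; apply/subsetP => _ /imsetP[v _ ->].
  by rewrite inE; apply/imsetP => -[].
rewrite !card_imset; try by move=> x y [].
by rewrite cP card_ord subnKC.
Qed.

End Extension.

Section Turan.
Variables r m n : nat.

(* Meant for 0 < m and k < m. *)
Definition turan_part (k : nat) : {set 'I_n} := [set i : 'I_n | i %% m == k].

Definition turan : {set {set 'I_n}} :=
  [set e : {set 'I_n} |
    (#|e| == r) && [forall k : 'I_m, #|e :&: turan_part k| <= 1]].

Definition turan_number : nat := #|turan|.

Lemma turan_uniform : uniform r turan.
Proof. by apply/forall_inP => e; rewrite inE => /andP[]. Qed.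

End Turan.

Lemma card_turan_part (m n k : nat) :
  k < m -> #|turan_part m n k| = n %/ m + (k < n %% m).
Proof.
move=> km; rewrite -sum1_card big_mkcond /=.
rewrite (eq_bigr (fun i : 'I_n => (i %% m == k) : nat)); last first.
  by move=> i _; rewrite inE; case: eqP.
elim: n => [|n IHn]; first by rewrite big_ord0 div0n mod0n.
rewrite big_ord_recr /= IHn.
have m0 : 0 < m by lia.
have ltm := ltn_pmod n m0.
have [lt|ge] := ltnP (n %% m).+1 m.
  have -> : n.+1 = n %/ m * m + (n %% m).+1 by rewrite addnS -divn_eq.
  by rewrite divnMDl // modnMDl (divn_small lt) (modn_small lt); lia.
have -> : n.+1 = (n %/ m).+1 * m + 0.
  by rewrite addn0 mulSn addnC {1}(divn_eq n m); lia.
by rewrite divnMDl // modnMDl div0n mod0n; lia.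
Qed.

Lemma turan_part_balanced (m n k l : nat) :
  k < m -> l < m -> #|turan_part m n k| <= #|turan_part m n l| + 1.
Proof. by move=> km lm; rewrite !card_turan_part //; lia. Qed.

(* Main.v *)
(* Write m = 3t - 1, and call a pair of vertices fat if its codegree is at least
   |V(H)|.  Disjoint edges e_1, ..., e_t with all cross pairs fat extend greedily
   to a copy of H, and removing the edges that contain a non-fat pair costs only
   O(n^2) edges.

   Lagrangians.  A 3-graph without t disjoint edges has Lagrangian at most that of
   K_m, and falls short of it by a fixed gap unless it contains K_m: shift edges
   towards the heaviest vertex u and move weight between uncovered pairs, until u
   forms an edge with every pair of the support; the edges avoiding u then contain
   no t - 1 disjoint ones, and the bound follows by induction on t.

   Stability.  In a nearly extremal H-free G, move the uniform weighting so that a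
   combination of density and average link density does not decrease.  This ends at
   a copy of K_m to which almost every vertex is attached like one of the vertices of
   K_m; vertices attached in the same way form no fat pair, which gives m parts.

   Exactness.  If the minimum degree is that of the Turan graph, every vertex x has
   a type, namely the one part to which x has few fat pairs, and an edge with two
   vertices of the same type would yield H.  Hence G is m-partite, and among
   m-partite 3-graphs the balanced complete ones are the unique largest.  The
   minimum degree is obtained by deleting vertices. *)

Require Import Defs.
From mathcomp Require Import all_boot all_order all_fingroup all_algebra.
From mathcomp Require Import zify ring lra.

Set Implicit Arguments.
Unset Strict Implicit.
Unset Printing Implicit Defensive.

Import Order.TTheory GRing.Theory Num.Theory.

(** * Ordered triples and elementary symmetric sums *)

(** Nothing rests on compactness: over an arbitrary ordered field no optimal weighting is chosen.
    Weightings and 3-graphs are improved by finitely many moves, each of which shrinks the support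
    or the set of edges avoiding the heaviest vertex. The danger is a shift that creates a K_m and
    so leaves the class where the gap is claimed; such a shift is shown to gain at least the gap, so
    the 3-graph was below it beforehand.

    Maximising the edge density alone would forget the vertices off the final support. The average
    link density runs over all vertices of G and records how each of them sees that support. The
    large factor A keeps the density dominant, so the gap still forces a K_m, while the links lose
    only A + 1 times the original defect.

    The moves end when every pair of the support is covered by an edge all of whose pairs are fat.
    Then all pairs of the support are fat, and t disjoint edges inside it would already be the core
    of H; this is what links Lagrangians with H.

    Sums run over ordered triples, whence the factors 6 for edges and 2 for degrees. All constants
    are powers of 1/m with generous denominators. *)

Section TripleSums.
Local Open Scope ring_scope.
Variables (R : realFieldType) (V : finType).
Implicit Types (F : {set {set V}}) (w : V -> R) (S : {set V}).

Lemma triple_card3 (a b c : V) :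
  (#|[set a; b; c]| == 3)%N = [&& a != b, a != c & b != c].
Proof.
rewrite -setUA cardsU1 cards2 !inE negb_or.
by case: (a == b); case: (a == c); case: (b == c).
Qed.

Lemma uniform_triple F a b c :
  uniform 3 F -> [set a; b; c] \in F -> [&& a != b, a != c & b != c].
Proof. by move=> /forall_inP uF /uF; rewrite triple_card3. Qed.

Lemma tripleCA (a b c : V) : [set a; b; c] = [set b; a; c].
Proof. by rewrite (setUC [set a]). Qed.

Lemma tripleAC (a b c : V) : [set a; b; c] = [set a; c; b].
Proof. by rewrite setUAC. Qed.

Lemma triple_rot (a b c : V) : [set a; b; c] = [set b; c; a].
Proof. by rewrite tripleCA tripleAC. Qed.

Lemma card3_triple (e : {set V}) :
  #|e| = 3 -> exists a b c, [/\ e = [set a; b; c], a != b, a != c & b != c].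
Proof.
move=> e3; have : (0 < #|e|)%N by rewrite e3.
case/card_gt0P=> a ae.
have c2 : #|e :\ a| = 2 by move: e3; rewrite (cardsD1 a) ae => -[].
have /cards2P[b [c [bc eE]]] : #|e :\ a| == 2 by rewrite c2.
exists a, b, c; have eE' : e = [set a; b; c] by rewrite -(setD1K ae) eE setUA.
by have := triple_card3 a b c; rewrite -eE' e3 eqxx => /esym/and3P[].
Qed.

Lemma triple_eq (e : {set V}) (a b c : V) : #|e| = 3 ->
  ([set a; b; c] == e) = [&& a \in e, b \in e :\ a & c \in e :\ a :\ b].
Proof.
move=> e3; apply/eqP/and3P => [eE | [ae be ce]].
  have /and3P[ab ac bc] : [&& a != b, a != c & b != c].
    by rewrite -triple_card3 eE e3.
  rewrite -eE !inE !eqxx (eq_sym b a) (eq_sym c a) (eq_sym c b) ab ac bc.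
  by rewrite !orbT.
move: be ce; rewrite !inE => /andP[ba be] /and3P[cb ca ce].
apply/eqP; rewrite eqEcard subUset subUset !sub1set ae be ce /= e3.
have := triple_card3 a b c; rewrite (eq_sym a b) (eq_sym a c) (eq_sym b c).
by rewrite ba ca cb => /eqP ->.
Qed.

Lemma sum_triple_eq (e : {set V}) : #|e| = 3 ->
  (\sum_a \sum_b \sum_c ([set a; b; c] == e) = 6)%N.
Proof.
move=> e3.
transitivity (\sum_(a in e) \sum_(b in e :\ a) \sum_(c in e :\ a :\ b) 1)%N.
  rewrite [RHS]big_mkcond; apply: eq_bigr => a _.
  case: ifP => ae; last first.
    by rewrite big1 // => b _; rewrite big1 // => c _; rewrite triple_eq // ae.
  rewrite [RHS]big_mkcond; apply: eq_bigr => b _.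
  case: ifP => be; last first.
    by rewrite big1 // => c _; rewrite triple_eq // be andbF.
  rewrite [RHS]big_mkcond; apply: eq_bigr => c _.
  by rewrite triple_eq // ae be; case: (c \in _).
rewrite (eq_bigr (fun=> 2)); first by rewrite sum_nat_const e3.
move=> a ae; have c2 : #|e :\ a| = 2 by move: e3; rewrite (cardsD1 a) ae => -[].
rewrite (eq_bigr (fun=> 1)); first by rewrite sum_nat_const c2.
move=> b be; rewrite sum1_card.
by move: c2; rewrite (cardsD1 b) be => -[].
Qed.

(** An edge arises from its six orderings, and a triple with a repetition is no edge of a 3-uniform
    [F]. *)
Lemma sum_triples F (g : {set V} -> R) : uniform 3 F ->
  \sum_a \sum_b \sum_c ([set a; b; c] \in F)%:R * g [set a; b; c]
  = 6 * \sum_(e in F) g e.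
Proof.
move=> /forall_inP uF.
transitivity (\sum_(e in F) \sum_a \sum_b \sum_c
                ([set a; b; c] == e)%:R * g e); last first.
  rewrite mulr_sumr; apply: eq_bigr => e eF.
  rewrite -(sum_triple_eq (eqP (uF _ eF))) natr_sum mulr_suml.
  apply: eq_bigr => a _; rewrite natr_sum mulr_suml; apply: eq_bigr => b _.
  by rewrite natr_sum mulr_suml.
rewrite [RHS]exchange_big /=; apply: eq_bigr => a _.
rewrite [RHS]exchange_big /=; apply: eq_bigr => b _.
rewrite [RHS]exchange_big /=; apply: eq_bigr => c _.
have [abcF|abcF] := boolP ([set a; b; c] \in F).
  rewrite (bigD1 _ abcF) /= eqxx big1 ?addr0 // => e /andP[_ ne].
  by rewrite eq_sym (negPf ne) mul0r.
rewrite mul0r big1 // => e eF; case: eqP => [E|_]; last by rewrite mul0r.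
by rewrite E eF in abcF.
Qed.

End TripleSums.

(** * Elementary symmetric sums of a weighting and their stability at the uniform one *)

Section ElementarySymmetric.
Local Open Scope ring_scope.
Variables (R : realFieldType) (V : finType).
Implicit Types (w : V -> R) (S : {set V}).

(** This is m(m-1)(m-2)/m^3, the value of [E3] at the uniform weighting of m points, and at the same
    time the ordered link density (m-1)(m-2)/m^2 of each of these points. *)
Definition turan_density (m : nat) : R := (m%:R - 1) * (m%:R - 2) / m%:R ^+ 2.

Definition E2 S w : R := \sum_(a in S) \sum_(b in S | b != a) w a * w b.

Definition E3 S w : R :=
  \sum_(a in S) \sum_(b in S | b != a)
    \sum_(c in S | (c != a) && (c != b)) w a * w b * w c.

Lemma sum_neq S w a : a \in S ->
  \sum_(b in S | b != a) w b = \sum_(b in S) w b - w a.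
Proof. by move=> aS; rewrite [in RHS](bigD1 a) //= [RHS]addrC addKr. Qed.

Lemma sum_neq2 S w a b : a \in S -> b \in S -> b != a ->
  \sum_(c in S | (c != a) && (c != b)) w c = \sum_(c in S) w c - w a - w b.
Proof.
move=> aS bS ba; rewrite -(sum_neq w aS) [in RHS](bigD1 b) ?bS //=.
rewrite [RHS]addrC addKr; apply: eq_bigl => c.
by rewrite andbA.
Qed.

Lemma E2_power_sums S w :
  E2 S w = (\sum_(v in S) w v) ^+ 2 - \sum_(v in S) w v ^+ 2.
Proof.
rewrite /E2 expr2 mulr_suml -sumrB; apply: eq_bigr => a aS.
by rewrite -mulr_sumr sum_neq // mulrBr expr2.
Qed.

Lemma E3_power_sums S w :
  E3 S w = (\sum_(v in S) w v) ^+ 3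
           - 3 * (\sum_(v in S) w v) * (\sum_(v in S) w v ^+ 2)
           + 2 * \sum_(v in S) w v ^+ 3.
Proof.
set W := \sum_(v in S) w v; set W2 := \sum_(v in S) w v ^+ 2.
transitivity (\sum_(a in S) (w a * (W ^+ 2 - W2) - 2 * W * w a ^+ 2
                             + 2 * w a ^+ 3)).
  apply: eq_bigr => a aS.
  transitivity (\sum_(b in S | b != a) w a * w b * (W - w a - w b)).
    apply: eq_bigr => b /andP[bS ba].
    by rewrite -mulr_sumr sum_neq2.
  transitivity (\sum_(b in S | b != a)
     ((w a * (W - w a)) * w b - w a * (w b ^+ 2))).
    by apply: eq_bigr => b _; ring.
  rewrite sumrB -!mulr_sumr sum_neq // (sum_neq (fun v => w v ^+ 2)) //.
  rewrite -/W -/W2; ring.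
rewrite big_split sumrB /= -!mulr_suml -!mulr_sumr -/W -/W2; ring.
Qed.

(** With Q and C the second and third power sums of the deviations from 1/m, [E3] equals the density
    minus 3Q plus 6Q/m plus 2C. Every deviation is at most 1 - 1/m, so C <= (1 - 1/m)Q, and -1 + 4/m
    <= -1/5 for m >= 5. *)
Lemma E3_stab S w m : #|S| = m -> (5 <= m)%N -> (forall v, v \in S -> 0 <= w v) ->
  \sum_(v in S) w v = 1 ->
  E3 S w <= turan_density m - 5%:R^-1 * \sum_(v in S) (w v - m%:R^-1) ^+ 2.
Proof.
move=> Sm m5 w0 w1; set Q := \sum_(v in S) (w v - m%:R^-1) ^+ 2.
have m5R : 5%:R <= m%:R :> R by rewrite ler_nat.
have mn0 : m%:R != 0 :> R by rewrite pnatr_eq0; lia.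
have i5 : m%:R^-1 <= 5%:R^-1 :> R by rewrite lef_pV2 ?posrE //; lra.
have i0 : 0 < m%:R^-1 :> R by rewrite invr_gt0; lra.
have sum_c (c : R) : \sum_(v in S) c = c * m%:R by rewrite sumr_const Sm mulr_natr.
have w2 : \sum_(v in S) w v ^+ 2 = Q + m%:R^-1.
  transitivity (\sum_(v in S) ((w v - m%:R^-1) ^+ 2 + 2 * m%:R^-1 * w v - m%:R^-2)).
    by apply: eq_bigr => v _; field.
  by rewrite sumrB big_split /= -mulr_sumr w1 sum_c -/Q; field.
set C := \sum_(v in S) (w v - m%:R^-1) ^+ 3.
have w3 : \sum_(v in S) w v ^+ 3 = C + 3 * m%:R^-1 * Q + m%:R^-2.
  transitivity (\sum_(v in S) ((w v - m%:R^-1) ^+ 3 + 3 * m%:R^-1 * (w v - m%:R^-1) ^+ 2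
      + 3 * m%:R^-2 * w v - 2 * m%:R ^- 3)).
    by apply: eq_bigr => v _; field.
  by rewrite sumrB !big_split /= -!mulr_sumr w1 sum_c -/Q -/C; field.
have wle1 v : v \in S -> w v <= 1.
  move=> vS; rewrite -w1 (bigD1 v) //= lerDl sumr_ge0 // => u /andP[uS _].
  exact: w0.
have CQ : C <= (1 - m%:R^-1) * Q.
  rewrite mulr_sumr; apply: ler_sum => v vS.
  rewrite exprS ler_wpM2r ?sqr_ge0 // lerB //; exact: wle1.
have Q0 : 0 <= Q by apply: sumr_ge0 => v _; apply: sqr_ge0.
rewrite E3_power_sums w1 w2 w3.
have -> : turan_density m = 1 - 3 * m%:R^-1 + 2 * m%:R^-2 by rewrite /turan_density; field.
have Qi : Q * m%:R^-1 <= Q * 5%:R^-1 by rewrite ler_wpM2l.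
by rewrite !expr1n; nra.
Qed.

Lemma E3_le_density S w m : #|S| = m -> (5 <= m)%N ->
  (forall v, v \in S -> 0 <= w v) -> \sum_(v in S) w v = 1 ->
  E3 S w <= turan_density m.
Proof.
move=> Sm m5 w0 w1; apply: le_trans (E3_stab Sm m5 w0 w1) _.
rewrite gerBl mulr_ge0 ?invr_ge0 // sumr_ge0 // => v _; exact: sqr_ge0.
Qed.

Lemma ler_E3 S w w' : (forall v, v \in S -> 0 <= w v <= w' v) -> E3 S w <= E3 S w'.
Proof.
move=> ww; apply: ler_sum => a /ww /andP[a0 aa].
apply: ler_sum => b /andP[/ww /andP[b0 bb] _].
apply: ler_sum => c /andP[/ww /andP[c0 cc] _].
apply: ler_pM => //; first exact: mulr_ge0.
exact: ler_pM.
Qed.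

Lemma E3_stab_le1 S w m (k : R) : #|S| = m -> (5 <= m)%N ->
  (forall v, v \in S -> 0 <= w v) -> \sum_(v in S) w v <= 1 ->
  turan_density m - k <= E3 S w ->
  forall v, v \in S -> (w v - m%:R^-1) ^+ 2 <= 5 * k.
Proof.
move=> Sm m5 w0 w1 kE v vS.
(* The missing weight goes to a vertex other than [v]: this keeps the deviation at [v] and does not
   decrease [E3]. *)
have [u uS uv] : exists2 u, u \in S & u != v.
  have : (0 < #|S :\ v|)%N by move: Sm; rewrite (cardsD1 v) vS; lia.
  by case/card_gt0P => u; rewrite !inE => /andP[uv uS]; exists u.
pose w' x := if x == u then w u + (1 - \sum_(x in S) w x) else w x.
have le' x : x \in S -> 0 <= w x <= w' x.
  move=> xS; rewrite w0 //= /w'; case: eqP => [->|//]; lra.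
have w'1 : \sum_(x in S) w' x = 1.
  rewrite (bigD1 u) //= /w' eqxx (eq_bigr w); last first.
    by move=> x /andP[_ /negPf ->].
  by rewrite sum_neq //; lra.
have w'0 x : x \in S -> 0 <= w' x by move=> /le' /andP[]; apply: le_trans.
have := E3_stab Sm m5 w'0 w'1; have := ler_E3 le'.
have w'v : w' v = w v by rewrite /w' eq_sym (negPf uv).
rewrite (bigD1 v) //= w'v.
have : 0 <= \sum_(i in S | i != v) (w' i - m%:R^-1) ^+ 2.
  by apply: sumr_ge0 => x _; apply: sqr_ge0.
lra.
Qed.

Lemma E3_le_density_le1 S w m : #|S| = m -> (5 <= m)%N ->
  (forall v, v \in S -> 0 <= w v) -> \sum_(v in S) w v <= 1 ->
  E3 S w <= turan_density m.
Proof.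
move=> Sm m5 w0 w1.
have [u uS] : exists u, u \in S by apply/card_gt0P; rewrite Sm; lia.
pose w' x := if x == u then w u + (1 - \sum_(x in S) w x) else w x.
have le' x : x \in S -> 0 <= w x <= w' x.
  move=> xS; rewrite w0 //= /w'; case: eqP => [->|//]; lra.
have w'0 x : x \in S -> 0 <= w' x by move=> /le' /andP[]; apply: le_trans.
apply: le_trans (ler_E3 le') (E3_le_density Sm m5 w'0 _).
rewrite (bigD1 u) //= /w' eqxx (eq_bigr w); last first.
  by move=> x /andP[_ /negPf ->].
by rewrite sum_neq //; lra.
Qed.

End ElementarySymmetric.

(** * Lagrangians of 3-graphs without large matchings *)

Section Lagrangian.
Local Open Scope ring_scope.
Variables (R : realFieldType) (V : finType).
Implicit Types (F : {set {set V}}) (w : V -> R) (S : {set V}).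

(* [B = 0] gives the Lagrangian polynomial (times 6); for [B = 1/n] the term in [B]
   is the average over all vertices of the weighted size of the link. *)
Definition weighted_triples F (A B : R) w : R :=
  \sum_a \sum_b \sum_c ([set a; b; c] \in F)%:R * ((A * w a + B) * w b * w c).

Definition lagrangian F w : R :=
  \sum_a \sum_b \sum_c ([set a; b; c] \in F)%:R * (w a * w b * w c).

Definition supp w : {set V} := [set v | w v != 0].

Definition clique S : {set {set V}} := [set e : {set V} | (e \subset S) && (#|e| == 3)].

Lemma weighted_triples10 F w : weighted_triples F 1 0 w = lagrangian F w.
Proof.
by do 3!(apply: eq_bigr => ? _); rewrite mul1r addr0.
Qed.

Lemma weighted_triplesD F A B w :
  weighted_triples F A B w = A * lagrangian F w
  + B * \sum_a \sum_b \sum_c ([set a; b; c] \in F)%:R * (w b * w c).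
Proof.
rewrite !mulr_sumr -big_split; apply: eq_bigr => a _.
rewrite !mulr_sumr -big_split; apply: eq_bigr => b _.
rewrite !mulr_sumr -big_split; apply: eq_bigr => c _ /=; ring.
Qed.

Definition merge a b w v := if v == a then w a + w b else if v == b then 0 else w v.

Lemma sum_merge a b w : a != b -> \sum_v merge a b w v = \sum_v w v.
Proof.
move=> ab; rewrite (bigD1 a) // (bigD1 b) ?(eq_sym b) //=.
rewrite [RHS](bigD1 a) // [in RHS](bigD1 b) ?(eq_sym b) //=.
rewrite /merge !eqxx eq_sym (negPf ab) add0r addrA; congr +%R.
by apply: eq_bigr => v /andP[/negPf -> /negPf ->].
Qed.

Lemma merge_ge0 a b w : (forall v, 0 <= w v) -> forall v, 0 <= merge a b w v.
Proof.
by move=> w0 v; rewrite /merge; case: ifP => _; [apply: addr_ge0|case: ifP].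
Qed.

Lemma supp_merge a b w : a != b -> w a != 0 -> w b != 0 ->
  supp (merge a b w) \proper supp w.
Proof.
move=> ab wa wb; apply/properP; split.
  apply/subsetP => v; rewrite !inE /merge; case: (v =P a) => [-> //|_].
  by case: (v =P b) => //; rewrite eqxx.
by exists b; rewrite !inE // /merge (eq_sym b) (negPf ab) !eqxx.
Qed.

(* Both weight transfers between an uncovered pair average back to [w], because
   every term is affine in the two weights. *)
Lemma weighted_triples_merge F A B w a b : uniform 3 F -> a != b ->
  ~~ covered F [set a; b] ->
  (w a + w b) * weighted_triples F A B w
  = w a * weighted_triples F A B (merge a b w)
    + w b * weighted_triples F A B (merge b a w).
Proof.
move=> uF ab ncov; rewrite !mulr_sumr -big_split; apply: eq_bigr => x _ /=.
rewrite !mulr_sumr -big_split; apply: eq_bigr => y _ /=.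
rewrite !mulr_sumr -big_split; apply: eq_bigr => z _ /=.
have [eF|_] := boolP (_ \in F); last by rewrite !mul0r !mulr0 addr0.
have /and3P[xy xz yz] := uniform_triple uF eF.
have nab : ~~ [&& a \in [set x; y; z] & b \in [set x; y; z]].
  apply: contra ncov => abe; apply/exists_inP; exists [set x; y; z] => //.
  by rewrite subUset !sub1set.
have ba : b != a by rewrite eq_sym.
rewrite /merge.
case: (eqVneq x a) => [xa|xa]; case: (eqVneq x b) => [xb|xb];
 case: (eqVneq y a) => [ya|ya]; case: (eqVneq y b) => [yb|yb];
 case: (eqVneq z a) => [za|za]; case: (eqVneq z b) => [zb|zb]; subst => //=;
 rewrite ?eqxx // in xy xz yz ab ba *; try ring; 
 by move: nab; rewrite !inE !eqxx ?orbT.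
Qed.

(** The value at [w] is a weighted mean of the values at the two merged weightings, so one of them
    is at least as good; either merge empties a vertex of the support. *)
Lemma weighted_triples_move F A B w a b : uniform 3 F -> (forall v, 0 <= w v) ->
  a != b -> a \in supp w -> b \in supp w -> ~~ covered F [set a; b] ->
  exists w', [/\ forall v, 0 <= w' v, \sum_v w' v = \sum_v w v,
    supp w' \proper supp w & weighted_triples F A B w <= weighted_triples F A B w'].
Proof.
move=> uF w0; rewrite !inE => ab wa wb ncov.
have E := weighted_triples_merge A B w uF ab ncov.
have pa : 0 < w a by rewrite lt0r wa w0.
have pb : 0 < w b by rewrite lt0r wb w0.
have [le1|le1] := leP (weighted_triples F A B w) (weighted_triples F A B (merge a b w)).
  exists (merge a b w); split => //; [exact: merge_ge0|exact: sum_merge|].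
  exact: supp_merge.
exists (merge b a w); split => //; first exact: merge_ge0.
- by rewrite sum_merge // eq_sym.
- by rewrite supp_merge // eq_sym.
rewrite -(ler_pM2l pb).
have : w a * weighted_triples F A B (merge a b w) <= w a * weighted_triples F A B w.
  by rewrite ler_pM2l // ltW.
move: E; lra.
Qed.

(** Induction on the size of the support takes the place of choosing an optimal weighting of minimal
    support. *)
Lemma weighted_triples_sym F A B w : uniform 3 F -> (forall v, 0 <= w v) ->
  exists w', [/\ forall v, 0 <= w' v, \sum_v w' v = \sum_v w v,
    {in supp w' &, forall a b, a != b -> covered F [set a; b]}
    & weighted_triples F A B w <= weighted_triples F A B w'].
Proof.
move=> uF; have [n le_n] := ubnP #|supp w|.
elim: n w le_n => // n IHn w le_n w0.
have [/forall_inP cov|] := boolP [forall a in supp w, forall b in supp w,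
    (a != b) ==> covered F [set a; b]].
  exists w; split => // a b aw bw ab.
  by have /forall_inP/(_ b bw)/implyP/(_ ab) := cov a aw.
case/forall_inPn => a aw /forall_inPn[b bw]; rewrite negb_imply => /andP[ab ncov].
have [w1 [w10 w1s w1p w1le]] := weighted_triples_move A B uF w0 ab aw bw ncov.
have [|w2 [w20 w2s w2p w2le]] := IHn w1 _ w10.
  by apply: leq_trans (proper_card w1p) _.
by exists w2; split; rewrite ?w2s //; apply: le_trans w2le.
Qed.

Lemma lagrangian_edges F w : uniform 3 F ->
  lagrangian F w = 6 * \sum_(e in F) \prod_(v in e) w v.
Proof.
move=> uF; rewrite -(sum_triples (fun e => \prod_(v in e) w v) uF).
apply: eq_bigr => a _; apply: eq_bigr => b _; apply: eq_bigr => c _.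
have [eF|_] := boolP (_ \in F); last by rewrite !mul0r.
have /and3P[ab ac bc] := uniform_triple uF eF; congr (_ * _).
rewrite -setUA big_setU1 /= ?big_setU1 /= ?big_set1 ?mulrA //.
  by rewrite inE.
by rewrite !inE negb_or ab ac.
Qed.

Lemma lagrangian_sub_clique F w S : uniform 3 F -> (forall v, 0 <= w v) ->
  F \subset clique S -> lagrangian F w <= E3 S w.
Proof.
move=> uF w0 /subsetP FS; rewrite /E3 [leRHS]big_mkcond; apply: ler_sum => a _ /=.
have p0 x y z : 0 <= w x * w y * w z by rewrite !mulr_ge0.
case: ifP => aS; last first.
  rewrite big1 // => b _; rewrite big1 // => c _.
  case: (boolP (_ \in F)) => [/FS|]; last by rewrite mul0r.
  by rewrite inE !subUset sub1set aS.
rewrite [leRHS]big_mkcond; apply: ler_sum => b _ /=.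
case: ifP => [/andP[bS ba]|bS]; last first.
  rewrite big1 // => c _.
  case: (boolP (_ \in F)) => [abcF|]; last by rewrite mul0r.
  have := FS _ abcF; rewrite inE !subUset !sub1set => /andP[/andP[/andP[_ bS'] _] _].
  have /and3P[ab _ _] := uniform_triple uF abcF.
  by rewrite bS' eq_sym ab in bS.
rewrite [leRHS]big_mkcond; apply: ler_sum => c _ /=.
case: (boolP (_ \in F)) => [abcF|]; last by rewrite mul0r; case: ifP.
have := FS _ abcF; rewrite inE !subUset !sub1set => /andP[/andP[_ ->] _].
have /and3P[ab ac bc] := uniform_triple uF abcF.
by rewrite (eq_sym c a) (eq_sym c b) ac bc mul1r.
Qed.

Lemma lagrangian_supp F w : 
  lagrangian F w = lagrangian [set e in F | e \subset supp w] w.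
Proof.
do 3!(apply: eq_bigr => ? _); rewrite inE !subUset !sub1set !inE.
case: eqP => [->|_]; first by rewrite !(mul0r, mulr0).
case: eqP => [->|_]; first by rewrite !(mul0r, mulr0).
case: eqP => [->|_]; first by rewrite !(mul0r, mulr0).
by rewrite andbT.
Qed.

Lemma uniform_sub r F F' : F' \subset F -> uniform r F -> uniform r F'.
Proof.
move=> /subsetP FF /forall_inP uF; apply/forall_inP => e /FF; exact: uF.
Qed.

(** Adding [e] keeps [F] inside the clique, so [E3] bounds the enlarged sum as well. *)
Lemma lagrangian_loss F w S e : uniform 3 F -> (forall v, 0 <= w v) ->
  F \subset clique S -> e \in clique S -> e \notin F ->
  lagrangian F w + 6 * \prod_(v in e) w v <= E3 S w.
Proof.
move=> uF w0 FS eS eF.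
have uF' : uniform 3 (e |: F).
  apply/forall_inP => f; rewrite !inE => /orP[/eqP ->|]; last first.
    by move: uF => /forall_inP; apply.
  by move: eS; rewrite inE => /andP[].
have FS' : e |: F \subset clique S by rewrite subUset sub1set eS.
apply: le_trans (lagrangian_sub_clique uF' w0 FS').
by rewrite !lagrangian_edges // big_setU1 //= mulrDr addrC.
Qed.

End Lagrangian.

(** * Disjoint edges and complete 3-graphs *)

Section Matchings.
Variables (V : finType).
Implicit Types (F : {set {set V}}) (S A : {set V}).

Definition has_matching F t := exists s : seq {set V},
  [/\ size s = t, all (mem F) s & pairwise (fun e f : {set V} => [disjoint e & f]) s].

Lemma pairwise_in (T : eqType) (r : rel T) (s : seq T) (x y : T) :
  symmetric r -> pairwise r s -> x \in s -> y \in s -> x != y -> r x y.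
Proof.
move=> rs; elim: s => // z s IHs /= /andP[/allP rz rss]; rewrite !inE.
case: eqP => [-> _|_ /= xs]; case: eqP => [->|_ /= ys] //.
- by move=> _ /negP; rewrite eqxx.
- by move=> _; apply: rz.
- by move=> _ _; rewrite rs; apply: rz.
- exact: IHs.
Qed.

Lemma subset_of_card A k : k <= #|A| -> exists2 B : {set V}, B \subset A & #|B| = k.
Proof.
move=> kA; exists [set x in take k (enum A)].
  by apply/subsetP => x; rewrite inE => /mem_take; rewrite mem_enum.
rewrite cardsE (card_uniqP _) ?take_uniq ?enum_uniq // size_take -cardE.
by case: ltngtP kA.
Qed.

Lemma superset_of_card A k : #|A| <= k -> k <= #|V| ->
  exists2 B : {set V}, A \subset B & #|B| = k.
Proof.
move=> Ak kV; have [|C CA cC] := @subset_of_card (~: A) (k - #|A|).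
  by have := cardsC A; lia.
exists (A :|: C); first exact: subsetUl.
rewrite cardsU (_ : A :&: C = set0) ?cards0 ?cC; first lia.
by apply/setP => x; rewrite !inE; case xA: (x \in A) => //=;
  apply: contraTF (xA) => /(subsetP CA); rewrite inE.
Qed.

Lemma disjoint_triples A k : 3 * k <= #|A| -> exists s : seq {set V},
  [/\ size s = k, all (mem (clique A)) s & pairwise (fun e f : {set V} =>
    [disjoint e & f]) s].
Proof.
elim: k A => [|k IHk] A kA; first by exists [::].
have [|e eA e3] := @subset_of_card A 3; first lia.
have [|s [sk sA sp]] := IHk (A :\: e).
  by have := cardsID e A; rewrite (setIidPr eA) e3; lia.
exists (e :: s); split => /=; first by rewrite sk.
  rewrite inE eA e3 eqxx /=; apply: sub_all sA => f /=; rewrite !inE subsetD.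
  by case/andP => /andP[-> _] ->.
rewrite sp andbT; apply: sub_all sA => f /=; rewrite !inE subsetD disjoint_sym.
by case/andP => /andP[].
Qed.

(** An edge leaving [S] meets it in at most two vertices, so 3(t-1) vertices of [S] remain for t-1
    further edges. Hence a 3-graph without t disjoint edges that contains a K_m lies inside it. *)
Lemma clique_matching F S e t : 0 < t -> #|S| = 3 * t - 1 -> uniform 3 F ->
  clique S \subset F -> e \in F -> ~~ (e \subset S) -> has_matching F t.
Proof.
move=> t0 cS /forall_inP uF /subsetP SF eF eS.
have e3 := eqP (uF _ eF).
have lt3 : #|e :&: S| < 3.
  rewrite -e3; apply: proper_card; apply/properP; split; first exact: subsetIl.
  by case/subsetPn: eS => x xe xS; exists x; rewrite // inE (negPf xS) andbF.
have [|s [sk sA sp]] := @disjoint_triples (S :\: e) t.-1.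
  by have := cardsID e S; rewrite setIC cS; lia.
exists (e :: s); split => /=; first by rewrite sk prednK.
  rewrite eF /=; apply: sub_all sA => f /=; rewrite inE subsetD.
  by case/andP => /andP[fS _] f3; apply: SF; rewrite inE fS.
rewrite sp andbT; apply: sub_all sA => f /=; rewrite !inE subsetD disjoint_sym.
by case/andP => /andP[].
Qed.

Lemma card_cover_triples (s : seq {set V}) : all (fun e : {set V} => #|e| == 3) s ->
  #|[set x | has (fun e : {set V} => x \in e) s]| <= 3 * size s.
Proof.
elim: s => [_|e s IHs /= /andP[/eqP e3 /IHs le_s]].
  by rewrite (_ : [set _ | _] = set0) ?cards0 //; apply/setP => x; rewrite !inE.
apply: leq_trans (_ : #|e :|: [set x | has (fun e : {set V} => x \in e) s]| <= _).
  by apply: subset_leq_card; apply/subsetP => x; rewrite !inE.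
by rewrite mulnS -e3; apply: leq_trans (leq_card_setU _ _) _; rewrite leq_add2l e3.
Qed.

End Matchings.

(** * Compression of a 3-graph, replacing [v] by [u] *)

Section Shift.
Variables (V : finType) (u v : V).
Implicit Types (F : {set {set V}}) (S e : {set V}).

Definition swap e : {set V} := tperm u v @: e.

Definition shift_edge F e :=
  if [&& v \in e, u \notin e & swap e \notin F] then swap e else e.

Definition shift F : {set {set V}} := shift_edge F @: F.

Lemma mem_swap e x : (x \in swap e) = (tperm u v x \in e).
Proof.
apply/imsetP/idP => [[y ye ->]|xe]; first by rewrite tpermK.
by exists (tperm u v x); rewrite ?tpermK.
Qed.

Lemma swapK : involutive swap.
Proof. by move=> e; apply/setP => x; rewrite !mem_swap tpermK. Qed.

Lemma card_swap e : #|swap e| = #|e|.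
Proof. by rewrite card_imset //; apply: perm_inj. Qed.

Lemma shift_edge_inj F : {in F &, injective (shift_edge F)}.
Proof.
move=> e f eF fF; rewrite /shift_edge.
case: ifP => [/and3P[ve ue se]|_]; case: ifP => [/and3P[vf uf sf]|_] //.
- exact: (can_inj swapK).
- by move=> E; rewrite E fF in se.
- by move=> E; rewrite -E eF in sf.
Qed.

Lemma shift_uniform F : uniform 3 F -> uniform 3 (shift F).
Proof.
move=> /forall_inP uF; apply/forall_inP => _ /imsetP[e eF ->].
by rewrite /shift_edge; case: ifP => _; rewrite ?card_swap uF.
Qed.

Lemma shift_new F e : e \in shift F -> e \notin F ->
  [/\ swap e \in F, u \in e & v \notin e].
Proof.
case/imsetP => f fF ->; rewrite /shift_edge.
case: ifP => [/and3P[vf uf sf] _|_]; last by rewrite fF.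
by rewrite swapK !mem_swap tpermL tpermR.
Qed.

Lemma shift_old F e : e \in shift F -> e \in F -> v \in e -> u \notin e ->
  swap e \in F.
Proof.
case/imsetP => f fF ->; rewrite /shift_edge.
case: ifP => [/and3P[vf uf sf] sF|/negbT]; first by rewrite sF in sf.
by move=> H _ vf uf; rewrite vf uf /= negbK in H.
Qed.

(** If some edge of the matching is new, it contains [u], so all others avoid [u] and are old.
    Swapping [u] and [v] in the whole matching turns the new edge into an old one, and an old edge
    through [v] that survived the shift has its swap in [F]. *)
Lemma shift_matching F t : has_matching (shift F) t -> has_matching F t.
Proof.
case=> s [st /allP sF sp].
have [sF'|] := boolP (all (mem F) s); first by exists s.
case/allPn => e es /= eF; have [seF ue ve] := shift_new (sF e es) eF.
exists (map swap s); split; first by rewrite size_map.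
  apply/allP => _ /mapP[f fs ->] /=.
  have [-> //|nef] := eqVneq f e.
  have uf : u \notin f.
    have : [disjoint f & e].
      by apply: (pairwise_in _ sp fs es nef) => x y; rewrite disjoint_sym.
    by rewrite disjoint_sym disjoint_subset => /subsetP/(_ u ue).
  have fF : f \in F.
    apply: contraNT uf => fF; by case: (shift_new (sF f fs) fF).
  have [vf|vf] := boolP (v \in f); first exact: shift_old (sF f fs) _ _ _.
  suff -> : swap f = f by [].
  apply/setP => x; rewrite mem_swap; case: tpermP => // ->.
    by rewrite (negPf vf) (negPf uf).
  by rewrite (negPf vf) (negPf uf).
rewrite pairwise_map; apply: sub_pairwise sp => e1 e2 /=.
rewrite -!setI_eq0 -imsetI; last by move=> x y _ _; apply: perm_inj.
by move=> /eqP ->; rewrite imset0.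
Qed.

Lemma shift_measure F e : e \in F -> v \in e -> u \notin e -> swap e \notin F ->
  #|[set f in shift F | u \notin f]| < #|[set f in F | u \notin f]|.
Proof.
move=> eF ve ue se; apply: proper_card; apply/properP; split.
  apply/subsetP => f; rewrite !inE => /andP[fF uf]; rewrite uf andbT.
  by apply: contraNT uf => fF'; case: (shift_new fF fF').
exists e; first by rewrite !inE eF ue.
rewrite !inE ue andbT.
by apply: contra se => eF'; apply: shift_old eF' _ _ _.
Qed.

(** A new edge [e] of the clique contains [u] and avoids [v]. If [v] were in [S], the swap of [e]
    would be an edge of the clique through [v] that survived the shift, which requires [e] to be in
    [F] already. *)
Lemma shift_clique F S : clique S \subset shift F -> ~~ (clique S \subset F) ->
  u \in S /\ v \notin S.
Proof.
move=> /subsetP SF /subsetPn[e eS eF].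
have [seF ue ve] := shift_new (SF e eS) eF.
have uS : u \in S by move: eS; rewrite inE => /andP[/subsetP/(_ u ue)].
split => //; apply/negP => vS.
have sS : swap e \in clique S.
  move: eS; rewrite !inE card_swap => /andP[/subsetP eS ->]; rewrite andbT.
  apply/subsetP => x; rewrite mem_swap; case: tpermP => [-> //|-> //|_ _].
  exact: eS.
have := shift_old (SF _ sS) seF; rewrite !mem_swap tpermL tpermR ue ve swapK.
by rewrite (negPf eF) => /(_ isT isT).
Qed.

Section Weights.
Local Open Scope ring_scope.
Variables (R : realFieldType) (w : V -> R).
Hypothesis w0 : forall x, 0 <= w x.
Hypothesis wuv : w v <= w u.

Lemma prod_swap e : v \in e -> u \notin e ->
  \prod_(x in swap e) w x - \prod_(x in e) w x
  = (w u - w v) * \prod_(x in e :\ v) w x.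
Proof.
move=> ve ue; rewrite big_imset /=; last by move=> x y _ _; apply: perm_inj.
rewrite (big_setD1 v ve) /= tpermR [X in _ - X](big_setD1 v ve) /= mulrBl.
congr (_ * _ - _); apply: eq_bigr => x; rewrite !inE => /andP[xv xe].
by rewrite tpermD // eq_sym //; apply: contraNneq ue => <-.
Qed.

Lemma prod_shift_edge F e : \prod_(x in e) w x <= \prod_(x in shift_edge F e) w x.
Proof.
rewrite /shift_edge; case: ifP => // /and3P[ve ue _].
by rewrite -subr_ge0 prod_swap // mulr_ge0 ?subr_ge0 ?prodr_ge0.
Qed.

Lemma lagrangian_shift F : uniform 3 F -> lagrangian F w <= lagrangian (shift F) w.
Proof.
move=> uF; rewrite !lagrangian_edges //; last exact: shift_uniform.
rewrite ler_pM2l // big_imset /=; last exact: shift_edge_inj.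
by apply: ler_sum => e _; apply: prod_shift_edge.
Qed.

(** The new edge takes the place of its swap and gains exactly this product, while no other edge
    loses weight. *)
Lemma lagrangian_shift_loss F e : uniform 3 F -> e \in shift F -> e \notin F ->
  lagrangian F w + 6 * ((w u - w v) * \prod_(x in e :\ u) w x)
  <= lagrangian (shift F) w.
Proof.
move=> uF eF' eF; rewrite !lagrangian_edges //; last exact: shift_uniform.
have [seF ue ve] := shift_new eF' eF.
rewrite -mulrDr ler_pM2l // big_imset /=; last exact: shift_edge_inj.
rewrite (big_setD1 (swap e)) //= [leRHS](big_setD1 (swap e)) //=.
have -> : shift_edge F (swap e) = e.
  by rewrite /shift_edge !mem_swap tpermL tpermR swapK ue ve eF.
have vs : v \in swap e by rewrite mem_swap tpermR.
have us : u \notin swap e by rewrite mem_swap tpermL.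
have := prod_swap vs us; rewrite swapK.
have -> : \prod_(x in swap e :\ v) w x = \prod_(x in e :\ u) w x.
  have -> : e :\ u = swap e :\ v.
    apply/setP => x; rewrite !inE mem_swap; case: tpermP => [->|->|].
    - by rewrite eqxx (negPf ve) andbF.
    - by rewrite eqxx (negPf ve) andbF.
    - by move=> /eqP -> /eqP ->.
  by [].
move=> H; rewrite addrAC lerD //; first by rewrite -H; lra.
by apply: ler_sum => f _; apply: prod_shift_edge.
Qed.

End Weights.

End Shift.

(** * The gap below the Turan density in the absence of a K_m *)

Section Gap.
Local Open Scope ring_scope.
Variables (R : realFieldType).

(* Near the uniform weighting of K_m a missing edge costs more than the first term;
   the second one is the deficit of a star over an extremal 3-graph. *)
Definition gap (m : nat) : R :=
  Num.min (80 * m%:R ^+ 4)^-1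
          (turan_density R m - 4 / (3 - turan_density R (m - 3)) ^+ 2).

Lemma turan_density_gt m : (5 <= m)%N ->
  4 / (3 - turan_density R (m - 3)) ^+ 2 < turan_density R m.
Proof.
(* After the substitution m = x + 5 the cross-multiplied difference is a polynomial in x with
   positive coefficients. *)
move=> m5; have [k -> {m m5}] : exists k, m = (k + 5)%N by exists (m - 5)%N; lia.
rewrite /turan_density (_ : (k + 5 - 3 = k + 2)%N); last lia.
rewrite !natrD; set x : R := k%:R; have x0 : 0 <= x by apply: ler0n.
have -> : 3 - (x + 2 - 1) * (x + 2 - 2) / (x + 2) ^+ 2
          = (2 * (x + 2) - 1) * (x + 4) / (x + 2) ^+ 2.
  by field; apply: lt0r_neq0; lra.
have p2 : 0 < x + 2 by lra.
have p4 : 0 < x + 4 by lra.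
have p5 : 0 < x + 5 by lra.
have p1 : 0 < 2 * (x + 2) - 1 by lra.
have -> : 4 / ((2 * (x + 2) - 1) * (x + 4) / (x + 2) ^+ 2) ^+ 2
          = 4 * (x + 2) ^+ 4 / ((2 * (x + 2) - 1) * (x + 4)) ^+ 2.
  by field; rewrite -/x !lt0r_neq0.
rewrite ltr_pdivrMr ?exprn_gt0 ?mulr_gt0 // mulrAC ltr_pdivlMr ?exprn_gt0 //.
have -> : (x + 5 - 1) * (x + 5 - 2) * ((2 * (x + 2) - 1) * (x + 4)) ^+ 2
  = 4 * (x + 2) ^+ 4 * (x + 5) ^+ 2 + 
    (9 * x ^+ 4 + 87 * x ^+ 3 + 276 * x ^+ 2 + 336 * x + 128) by ring.
have := exprn_ge0 4 x0; have := exprn_ge0 3 x0; have := exprn_ge0 2 x0; lra.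
Qed.

Lemma gap_gt0 m : (5 <= m)%N -> 0 < gap m.
Proof.
move=> m5; rewrite lt_min subr_gt0 turan_density_gt // andbT invr_gt0.
by rewrite mulr_gt0 // exprn_gt0 // ltr0n; lia.
Qed.

Lemma turan_density_ge0 m : 0 <= turan_density R m.
Proof.
case: m => [|[|m]]; rewrite /turan_density ?subrr ?mul0r //.
  by rewrite expr0n invr0 mulr0.
rewrite divr_ge0 ?sqr_ge0 // mulr_ge0 // -addn2 natrD.
  by rewrite -addrA -{1}(add0r 0) lerD //; lra.
by rewrite addrK.
Qed.

Lemma turan_density_lt1 m : (0 < m)%N -> turan_density R m < 1.
Proof.
move=> m0; have mp : 1 <= m%:R :> R by rewrite ler1n.
rewrite /turan_density ltr_pdivrMr ?exprn_gt0 //; last lra.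
by rewrite mul1r expr2; nra.
Qed.

(* AM-GM: 4/c^2 - (3y^2 - c y^3) = c (y - 2/c)^2 (y + 1/c) with c = 3 - d. *)
Lemma star_bound (x y d : R) : 0 <= y -> d < 3 -> x + y = 1 ->
  3 * x * y ^+ 2 + d * y ^+ 3 <= 4 / (3 - d) ^+ 2.
Proof.
move=> y0 d3 xy; have -> : x = 1 - y by lra.
have [c [cp cE]] : exists c, 0 < c /\ d = 3 - c by exists (3 - d); split; lra.
rewrite cE opprB addrCA subrr addr0 -subr_ge0.
have -> : 4 / c ^+ 2 - (3 * (1 - y) * y ^+ 2 + (3 - c) * y ^+ 3)
    = c * (y - 2 / c) ^+ 2 * (y + c^-1) by field; apply: lt0r_neq0.
have ic : 0 < c^-1 by rewrite invr_gt0.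
by apply: mulr_ge0; [apply: mulr_ge0; [apply: ltW|apply: sqr_ge0]|lra].
Qed.

Variable V : finType.
Implicit Types (F : {set {set V}}) (w : V -> R) (S : {set V}).

(** The 80 in [gap] comes from here: stability bounds the squared deviation by 5/(80 m^4), which is
    the square of 1/(4 m^2). *)
Lemma near_extremal S w m : #|S| = m -> (5 <= m)%N -> (forall v, 0 <= w v) ->
  \sum_(v in S) w v <= 1 -> turan_density R m - gap m <= E3 S w ->
  forall v, v \in S -> m%:R^-1 - m%:R^-1 ^+ 2 / 4 <= w v.
Proof.
move=> Sm m5 w0 w1 wE v vS.
have := E3_stab_le1 Sm m5 (fun v _ => w0 v) w1 wE vS.
have g : gap m <= (80 * m%:R ^+ 4)^-1 by rewrite ge_min lexx.
have mp : 0 < m%:R :> R by rewrite ltr0n; lia.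
have : 5 * (80 * m%:R ^+ 4)^-1 = (m%:R^-1 ^+ 2 / 4) ^+ 2 :> R.
  by field; rewrite lt0r_neq0.
have : 0 <= m%:R^-1 ^+ 2 / 4 :> R by rewrite divr_ge0 ?sqr_ge0.
move: (m%:R^-1) (m%:R^-1 ^+ 2 / 4) => i q q0 E H; clear Sm.
rewrite leNgt; apply/negP => lt_w.
have : 0 < (i - q - w v) * (i + q - w v) by rewrite mulr_gt0; lra.
move: E H g; nra.
Qed.

(** The homogeneous form applies directly to a weighting from which the vertex [u] has been removed,
    with total weight 1 - [w u]. *)
Definition lagrangian_bound t := forall F w, uniform 3 F -> ~ has_matching F t ->
  (forall v, 0 <= w v) ->
  lagrangian F w <= turan_density R (3 * t - 1) * (\sum_v w v) ^+ 3.

Lemma sum_subset_le1 S w : (forall v, 0 <= w v) -> \sum_v w v = 1 ->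
  \sum_(v in S) w v <= 1.
Proof.
move=> w0 w1; rewrite -w1 [leRHS](bigID (mem S)) /= lerDl; exact: sumr_ge0.
Qed.

(** Enlarge the support to a set [S] of m vertices. Within the gap all weights on [S] would be at
    least 19/(20m), and then the term of an edge of the clique missing from [F] costs more than
    1/(80 m^4). *)
Lemma small_supp t F w : (2 <= t)%N -> (3 * t - 1 <= #|V|)%N ->
  (#|supp w| <= 3 * t - 1)%N -> uniform 3 F ->
  (forall S, #|S| = 3 * t - 1 -> ~~ (clique S \subset F))%N ->
  (forall v, 0 <= w v) -> \sum_v w v = 1 ->
  lagrangian F w <= turan_density R (3 * t - 1) - gap (3 * t - 1).
Proof.
move=> t2 V3t sw uF nK w0 w1.
have [S sS cS] := superset_of_card sw V3t.
have /subsetPn[e eS eF] := nK S cS.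
have m5 : (5 <= 3 * t - 1)%N by lia.
rewrite lagrangian_supp; set F' := [set e in F | _].
have uF' : uniform 3 F' by apply: uniform_sub uF; apply/subsetP => f;
  rewrite inE => /andP[].
have FS : F' \subset clique S.
  apply/subsetP => f; rewrite !inE => /andP[fF fs].
  by rewrite (subset_trans fs sS) /=; move/forall_inP: uF; apply.
have eF' : e \notin F' by rewrite inE (negPf eF).
have L := lagrangian_loss uF' w0 FS eS eF'.
rewrite leNgt; apply/negP => lt_F.
have p0 : 0 <= \prod_(v in e) w v by apply: prodr_ge0.
have wS1 := sum_subset_le1 S w0 w1.
have near : turan_density R (3 * t - 1) - gap (3 * t - 1) <= E3 S w by lra.
have := near_extremal cS m5 w0 wS1 near.
have E3le := E3_le_density_le1 cS m5 (fun v _ => w0 v) wS1.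
have g : gap (3 * t - 1) <= (80 * (3 * t - 1)%:R ^+ 4)^-1 by rewrite ge_min lexx.
move: m5 E3le near lt_F g; move: (3 * t - 1)%N => m m5 E3le near lt_F g wm.
have m5R : 5 <= m%:R :> R by rewrite ler_nat.
have : (m%:R^-1 - m%:R^-1 ^+ 2 / 4) ^+ 3 <= \prod_(v in e) w v.
  move: eS; rewrite inE => /andP[/subsetP eS /eqP e3].
  rewrite -[X in _ ^+ X]e3 -prodr_const; apply: ler_prod => v ve.
  rewrite wm ?eS // andbT subr_ge0 expr2 -mulrA ler_piMr ?invr_ge0 //.
  rewrite -invfM invf_le1; lra.
have E80 : (80 * m%:R ^+ 4)^-1 = m%:R^-1 ^+ 4 / 80 :> R.
  by rewrite invfM exprVn mulrC.
rewrite E80 in g.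
have i0 : 0 < m%:R^-1 :> R by rewrite invr_gt0 (lt_le_trans _ m5R).
have i5 : m%:R^-1 <= 5%:R^-1 :> R.
  by rewrite lef_pV2 ?posrE // (lt_le_trans _ m5R).
move: i0 i5 g.
move: (m%:R^-1) => i i0 i5 g pi.
have h1 : i * (19 / 20) <= i - i ^+ 2 / 4 by nra.
have h3 : (i * (19 / 20)) ^+ 3 <= (i - i ^+ 2 / 4) ^+ 3.
  by apply: lerXn2r => //; rewrite nnegrE; nra.
have i3 : 0 < i ^+ 3 by rewrite exprn_gt0.
have : i ^+ 4 <= i ^+ 3 by rewrite exprSr ler_piMr ?ltW //; lra.
rewrite exprMn in h3; move: h3; lra.
Qed.

(** The shifted 3-graph has no t disjoint edges, so it lies inside the clique and is bounded by
    [E3]. If [F] were within the gap, [w u] would be close to 1/m and [w v] small, as [v] lies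
    outside [S]; the new edge then gains more than the gap. *)
Lemma shift_to_clique t F w S u v : (2 <= t)%N -> #|S| = (3 * t - 1)%N -> u != v ->
  uniform 3 F -> ~ has_matching F t -> ~~ (clique S \subset F) ->
  clique S \subset shift u v F ->
  (forall v, 0 <= w v) -> \sum_v w v = 1 -> w v <= w u ->
  lagrangian F w <= turan_density R (3 * t - 1) - gap (3 * t - 1).
Proof.
move=> t2; have m5 : (5 <= 3 * t - 1)%N by lia.
move=> cS uv uF nM nK K' w0 w1 wuv.
have [uS vS] := shift_clique K' nK.
have /subsetPn[e eS eF] := nK.
have L := lagrangian_shift_loss w0 wuv uF (subsetP K' e eS) eF.
have uF' := shift_uniform u v uF.
have F'S : shift u v F \subset clique S.
  apply/subsetP => f fF; have f3 : #|f| == 3 by move/forall_inP: uF'; apply.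
  rewrite inE f3 andbT; apply/negPn/negP => fS.
  by apply: nM; apply: shift_matching; apply: clique_matching uF' K' fF fS => //; lia.
have E := lagrangian_sub_clique uF' w0 F'S.
rewrite leNgt; apply/negP => lt_F.
have P0 : 0 <= (w u - w v) * \prod_(x in e :\ u) w x.
  by rewrite mulr_ge0 ?subr_ge0 // prodr_ge0.
have wS1 := sum_subset_le1 S w0 w1.
have near : turan_density R (3 * t - 1) - gap (3 * t - 1) <= E3 S w by lra.
have wm := near_extremal cS m5 w0 wS1 near.
have E3le := E3_le_density_le1 cS m5 (fun v _ => w0 v) wS1.
have g : gap (3 * t - 1) <= (80 * (3 * t - 1)%:R ^+ 4)^-1 by rewrite ge_min lexx.
have [_ ue _] := shift_new (subsetP K' e eS) eF.
have e2 : #|e :\ u| = 2.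
  by move: eS; rewrite inE (cardsD1 u) ue => /andP[_ /eqP[]].
have eS' : {subset e :\ u <= S}.
  by move=> x; move: eS; rewrite !inE => /andP[/subsetP eS _] /andP[_ /eS].
move: m5 cS E3le near lt_F g wm.
move: (3 * t - 1)%N => m m5 cS E3le near lt_F g wm.
have m5R : 5 <= m%:R :> R by rewrite ler_nat.
have mi : m%:R * m%:R^-1 = 1 :> R by rewrite mulfV // pnatr_eq0; case: (m) m5.
(* The m vertices of [S] weigh at least 1/m - 1/(4 m^2) each, which leaves at most 1/(4m)
   outside. *)
have tail : w v <= m%:R^-1 / 4.
  have : w v + \sum_(x in S) w x <= 1.
    rewrite -w1 [leRHS](bigD1 v) //= lerD2l big_mkcond [leRHS]big_mkcond.
    apply: ler_sum => x _; case: ifP => xS; last by case: ifP.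
    by rewrite (_ : x != v) //; apply: contraNneq vS => <-.
  have : m%:R * (m%:R^-1 - m%:R^-1 ^+ 2 / 4) <= \sum_(x in S) w x.
    rewrite (_ : m%:R * _ = \sum_(x in S) (m%:R^-1 - m%:R^-1 ^+ 2 / 4)).
      exact: ler_sum.
    by rewrite sumr_const cS mulr_natl.
  rewrite mulrBr mi mulrA expr2 mulrA mi mul1r; lra.
have wu := wm u uS.
have : (m%:R^-1 - m%:R^-1 ^+ 2 / 4) ^+ 2 <= \prod_(x in e :\ u) w x.
  rewrite -[X in _ ^+ X]e2 -prodr_const; apply: ler_prod => x xe.
  rewrite wm ?eS' // andbT subr_ge0 expr2 -mulrA ler_piMr ?invr_ge0 //.
  by rewrite -invfM invf_le1; lra.
have E80 : (80 * m%:R ^+ 4)^-1 = m%:R^-1 ^+ 4 / 80 :> R.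
  by rewrite invfM exprVn mulrC.
rewrite E80 in g.
have i0 : 0 < m%:R^-1 :> R by rewrite invr_gt0 (lt_le_trans _ m5R).
have i5 : m%:R^-1 <= 5%:R^-1 :> R.
  by rewrite lef_pV2 ?posrE // (lt_le_trans _ m5R).
move: i0 i5 g tail wu.
move: (m%:R^-1) => i i0 i5 g tail wu pi.
have h1 : i * (19 / 20) <= i - i ^+ 2 / 4 by nra.
have h2 : (i * (19 / 20)) ^+ 2 <= (i - i ^+ 2 / 4) ^+ 2.
  by apply: lerXn2r => //; rewrite nnegrE; nra.
have h3 : i * (7 / 10) <= w u - w v by lra.
have i3 : 0 < i ^+ 3 by rewrite exprn_gt0.
have h4 : (i * (7 / 10)) * (i * (19 / 20)) ^+ 2
          <= (w u - w v) * \prod_(x in e :\ u) w x.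
  by apply: ler_pM => //; [lra|apply: sqr_ge0|apply: le_trans h2 pi].
move: h4 i3 near E E3le L lt_F g i0 i5; clear -R.
move: (\prod_(x in e :\ u) w x) (E3 S w) (lagrangian _ _) (lagrangian _ _) => P E1 L1 L2.
move: (gap m) (turan_density R m) ((w u - w v) * P) =>
  G T W h4 i3 near E E3le L lt_F g i0 i5.
have h5 : (i * (7 / 10)) * (i * (19 / 20)) ^+ 2 = (i ^+ 3) * (2527 / 4000) by field.
have h6 : i ^+ 4 <= i ^+ 3.
  by clear -i0 i5 i3; rewrite exprSr ler_piMr ?ltW //; lra.
lra.
Qed.

(** Any t-1 disjoint edges avoiding [u] cover 3t-3 vertices, so at least two other vertices of the
    support remain and form a t-th edge with [u]. Hence the edges avoiding [u] satisfy the bound for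
    t-1. With x = [w u], y = 1 - x and d the density for m-3, the total is at most 3xy^2 + dy^3, the
    left side of [star_bound]. *)
Lemma star_supp t F w u : (2 <= t)%N -> lagrangian_bound t.-1 ->
  (3 * t <= #|supp w|)%N -> uniform 3 F -> ~ has_matching F t ->
  (forall v, 0 <= w v) -> \sum_v w v = 1 -> u \in supp w ->
  (forall a b, a \in supp w -> b \in supp w -> a != u -> b != u -> a != b ->
     [set u; a; b] \in F) ->
  lagrangian F w <= turan_density R (3 * t - 1) - gap (3 * t - 1).
Proof.
move=> t2 IHt sw uF nM w0 w1 us star.
pose F0 := [set e in F | (e \subset supp w) && (u \notin e)].
have uF0 : uniform 3 F0.
  by apply: uniform_sub uF; apply/subsetP => e; rewrite inE => /andP[].
pose w' v := if v == u then 0 else w v.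
have w'0 v : 0 <= w' v by rewrite /w'; case: ifP.
have nM0 : ~ has_matching F0 t.-1.
  case=> s [st /allP sF sp]; apply: nM.
  pose A := [set x | has (fun e : {set V} => x \in e) s].
  have cA : (#|A| <= 3 * t.-1)%N.
    rewrite -st; apply: card_cover_triples; apply/allP => e /sF /= eF.
    by move/forall_inP: uF0; apply.
  have [|B BA B2] := @subset_of_card V (supp w :\ u :\: A) 2.
    have := cardsID A (supp w :\ u); have := cardsD1 u (supp w); rewrite us.
    have := subset_leq_card (subsetIr (supp w :\ u) A).
    by move: sw cA t2; clear; lia.
  have /cards2P[a [b [ab BE]]] : #|B| == 2 by rewrite B2.
  have: a \in B by rewrite BE !inE eqxx.
  have: b \in B by rewrite BE !inE eqxx orbT.
  move=> /(subsetP BA); rewrite in_setD in_setD1 => /and3P[bA bu bs].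
  move=> /(subsetP BA); rewrite in_setD in_setD1 => /and3P[aA au as_].
  exists ([set u; a; b] :: s); split => /=; first by rewrite st prednK //; clear -t2; lia.
    rewrite star //=; apply/allP => e /sF /=; rewrite inE; by case/andP.
  rewrite sp andbT; apply/allP => e es /=.
  have eA x : x \in e -> x \in A by move=> xe; rewrite inE; apply/hasP; exists e.
  rewrite disjoint_subset; apply/subsetP => x; rewrite !inE => /orP[/orP[]|] /eqP ->.
  - by move: (sF e es); rewrite /= inE => /and3P[].
  - by apply: contra aA; apply: eA.
  - by apply: contra bA; apply: eA.
have L0 := IHt F0 w' uF0 nM0 w'0.
have w's : \sum_v w' v = 1 - w u.
  rewrite -w1 [RHS]addrC (bigD1 u) //= {1}/w' eqxx add0r [X in _ = _ + X](bigD1 u) //=.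
  by rewrite addKr; apply: eq_bigr => v /negPf vu; rewrite /w' vu.
pose T a b c : R := ([set a; b; c] \in F0)%:R * (w' a * w' b * w' c).
pose D a : R := (a == u)%:R.
(* An edge contains [u] in at most one of its three positions; the link of [u] is bounded by all
   ordered pairs, repetitions included. *)
have le_term a b c : ([set a; b; c] \in F)%:R * (w a * w b * w c) <=
   T a b c + w u * (D a * w' b * w' c + w' a * D b * w' c + w' a * w' b * D c).
  have D0 x : 0 <= D x by apply: ler0n.
  have [eF|_] := boolP (_ \in F); last first.
    by rewrite mul0r addr_ge0 ?mulr_ge0 // ?ler0n // !addr_ge0 // !mulr_ge0.
  have /and3P[ab ac bc] := uniform_triple uF eF; rewrite mul1r.
  have [a0|a0] := eqVneq (w a) 0.
    by rewrite a0 !mul0r addr_ge0 ?mulr_ge0 // ?ler0n // !addr_ge0 // !mulr_ge0.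
  have [b0|b0] := eqVneq (w b) 0.
    by rewrite b0 mulr0 !mul0r addr_ge0 ?mulr_ge0 // ?ler0n // !addr_ge0 // !mulr_ge0.
  have [c0|c0] := eqVneq (w c) 0.
    by rewrite c0 mulr0 addr_ge0 ?mulr_ge0 // ?ler0n // !addr_ge0 // !mulr_ge0.
  have w'u : w' u = 0 by rewrite /w' eqxx.
  have w'n x : x != u -> w' x = w x by rewrite /w' => /negPf ->.
  have Du : D u = 1 by rewrite /D eqxx.
  have Dn x : x != u -> D x = 0 by rewrite /D => /negPf ->.
  rewrite /T inE eF !subUset !sub1set !inE a0 b0 c0 /= !negb_or.
  rewrite -!(eq_sym _ u).
  have [au|au] := eqVneq a u.
    have [bu cu] : b != u /\ c != u by rewrite -au eq_sym ab eq_sym ac.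
    rewrite au w'u Du (Dn b) // (Dn c) // !w'n // !(mulr0, mul0r, mul1r, addr0, add0r).
    by rewrite mulrA.
  have [bu|bu] := eqVneq b u.
    have cu : c != u by rewrite -bu eq_sym bc.
    rewrite bu w'u Du (Dn a) // (Dn c) // !w'n // !(mulr0, mul0r, mulr1, addr0, add0r).
    by rewrite mulrCA mulrA.
  have [cu|cu] := eqVneq c u.
    rewrite cu w'u Du (Dn a) // (Dn b) // !w'n // !(mulr0, mul0r, mulr1, addr0, add0r).
    by rewrite mulrC.
  by rewrite !w'n // !Dn // !(mulr0, mul0r, addr0) mul1r.
have T_sum : \sum_a \sum_b \sum_c T a b c = lagrangian F0 w' by [].
have sD (g : R) : \sum_a D a * g = g.
  rewrite -mulr_suml (bigD1 u) //= /D eqxx big1 ?addr0 ?mul1r // => v /negPf ->.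
  by [].
have D_sum : \sum_a \sum_b \sum_c
    (D a * w' b * w' c + w' a * D b * w' c + w' a * w' b * D c)
    = 3 * (1 - w u) ^+ 2.
  have DE : \sum_a D a = 1 by rewrite -[RHS](sD 1); apply: eq_bigr => a _; rewrite mulr1.
  have s3 (f g h : V -> R) : \sum_a \sum_b \sum_c f a * g b * h c
      = (\sum_a f a) * (\sum_b g b) * (\sum_c h c).
    rewrite !mulr_suml; apply: eq_bigr => a _.
    rewrite -mulrA mulr_suml mulr_sumr; apply: eq_bigr => b _.
    by rewrite mulrA mulr_sumr.
  transitivity (\sum_a \sum_b \sum_c D a * w' b * w' c
    + \sum_a \sum_b \sum_c w' a * D b * w' c
    + \sum_a \sum_b \sum_c w' a * w' b * D c).
    rewrite -!big_split; apply: eq_bigr => a _; rewrite -!big_split.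
    by apply: eq_bigr => b _; rewrite -!big_split.
  rewrite !s3 DE w's; ring.
have le_F : lagrangian F w <= lagrangian F0 w' + w u * (3 * (1 - w u) ^+ 2).
  rewrite -D_sum -T_sum mulr_sumr -big_split; apply: ler_sum => a _ /=.
  rewrite mulr_sumr -big_split; apply: ler_sum => b _ /=.
  rewrite mulr_sumr -big_split; apply: ler_sum => c _ /=; exact: le_term.
have wu1 : w u <= 1.
  by rewrite -w1 (bigD1 u) //= lerDl sumr_ge0.
rewrite w's (_ : 3 * t.-1 - 1 = 3 * t - 1 - 3)%N in L0; last by clear -t2; lia.
have d3 : turan_density R (3 * t - 1 - 3) < 3.
  by apply: lt_trans (turan_density_lt1 _) _; [clear -t2; lia|rewrite ltr1n].
have y0 : 0 <= 1 - w u by lra.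
have := @star_bound (w u) (1 - w u) _ y0 d3 _.
have : gap (3 * t - 1) <= turan_density R (3 * t - 1)
    - 4 / (3 - turan_density R (3 * t - 1 - 3)) ^+ 2 by rewrite ge_min lexx orbT.
move: L0 le_F; clear.
move: (turan_density R _) (turan_density R _) (gap _) (lagrangian F0 _) (w u) => d d' g l x.
move=> H1 H2 H3 /(_ _)-H4.
have := H4 ltac:(lra); lra.
Qed.

(** The outer induction is on the support and is general in [F], because the inner one, on the
    number of edges avoiding [u], changes [F] by shifts. When neither a shift nor a weight transfer
    makes progress, the hypothesis of [star_supp] holds. *)
Theorem lagrangian_gap t F w : (2 <= t)%N -> (3 * t - 1 <= #|V|)%N ->
  lagrangian_bound t.-1 -> uniform 3 F -> ~ has_matching F t ->
  (forall S, #|S| = (3 * t - 1)%N -> ~~ (clique S \subset F)) ->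
  (forall v, 0 <= w v) -> \sum_v w v = 1 ->
  lagrangian F w <= turan_density R (3 * t - 1) - gap (3 * t - 1).
Proof.
move=> t2 Vt IHt; have [n le_n] := ubnP #|supp w|.
elim: n w le_n F => // n IHn w le_n F uF nM nK w0 w1.
have [small|big] := leqP #|supp w| (3 * t - 1); first exact: small_supp.
have {}big : (3 * t <= #|supp w|)%N by lia.
have [v0 v0s] : exists v, v \in supp w by apply/card_gt0P; lia.
(* The heaviest vertex depends on [w] only, so it stays fixed during the shifts, and every shift
   towards it is free. *)
pose u := [arg max_(i > v0) w i]%O.
have umax v : w v <= w u by rewrite /u; case: arg_maxP => //= i _; apply.
have us : u \in supp w.
  rewrite inE gt_eqF //; apply: lt_le_trans (umax v0).
  by move: v0s; rewrite inE lt0r => ->; rewrite w0.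
have [k le_k] := ubnP #|[set f in F | u \notin f]|.
elim: k F le_k uF nM nK => // k IHk F le_k uF nM nK.
have [/forallP stable|] := boolP [forall v, [forall e in F,
    (v \in e) ==> (u \notin e) ==> (swap u v e \in F)]]; last first.
  case/forallPn => v /forall_inPn[e eF]; rewrite !negb_imply => /and3P[ve ue se].
  have uv : u != v by apply: contraNneq ue => ->.
  have [/forall_inP nK'|] := boolP [forall S in [set S : {set V} | #|S| == (3 * t - 1)%N],
      ~~ (clique S \subset shift u v F)]; last first.
    case/forall_inPn => S; rewrite inE negbK => /eqP cS K'.
    exact: shift_to_clique cS uv uF nM (nK S cS) K' w0 w1 (umax v).
  apply: le_trans (lagrangian_shift w0 (umax v) uF) _; apply: IHk.
  - by apply: leq_trans (shift_measure eF ve ue se) _.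
  - exact: shift_uniform.
  - by move=> /shift_matching.
  - by move=> S cS; apply: nK'; rewrite inE cS.
have [/forall_inP cov|] := boolP [forall a in supp w, forall b in supp w,
    (a != b) ==> covered F [set a; b]]; last first.
  case/forall_inPn => a aw /forall_inPn[b bw]; rewrite negb_imply => /andP[ab ncov].
  have [w2 [w20 w2s w2p w2le]] := weighted_triples_move 1 0 uF w0 ab aw bw ncov.
  rewrite -weighted_triples10; apply: le_trans w2le _; rewrite weighted_triples10.
  apply: IHn => //; last by rewrite w2s.
  by apply: leq_trans (proper_card w2p) _.
apply: (star_supp t2 IHt big uF nM w0 w1 us) => a b as_ bs au bu ab.
have /forall_inP/(_ b bs)/implyP/(_ ab)/exists_inP[e eF] := cov a as_.
rewrite subUset !sub1set => /andP[ae be].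
have e3 : #|e| = 3 by move/forall_inP: uF => /(_ e eF)/eqP.
have [ue|ue] := boolP (u \in e).
  suff -> : [set u; a; b] = e by [].
  by apply/eqP; rewrite triple_eq // ue !inE ae be au bu eq_sym ab.
have [c ce] : exists c, [set a; b; c] = e.
  have : (0 < #|e :\ a :\ b|)%N.
    have := cardsD1 a e; have := cardsD1 b (e :\ a).
    by rewrite ae !inE be eq_sym ab e3; clear; lia.
  case/card_gt0P => c; rewrite !inE => /and3P[cb ca ce]; exists c.
  by apply/eqP; rewrite triple_eq // !inE ae be ce ca cb eq_sym ab.
have cE : c \in e by rewrite -ce !inE eqxx orbT.
(* The pair is covered by an edge {a, b, c} avoiding [u]; stability under replacing [c] by [u] turns
   it into {u, a, b}. *)
have /forall_inP/(_ e eF)/implyP/(_ cE)/implyP/(_ ue) := stable c.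
have uab : [set u; a; b] = swap u c e; last by rewrite -uab.
apply/eqP; rewrite triple_eq ?card_swap // !inE !mem_swap tpermL cE /=.
have /and3P[_ ac bc] : [&& a != b, a != c & b != c] by rewrite -triple_card3 ce e3.
have [ua ub] : u != a /\ u != b by rewrite eq_sym au eq_sym bu.
have [ca cb] : c != a /\ c != b by rewrite eq_sym ac eq_sym bc.
by rewrite !tpermD // ae be au bu eq_sym ab.
Qed.

Lemma lagrangianZ F (c : R) w : lagrangian F (fun v => c * w v) = c ^+ 3 * lagrangian F w.
Proof.
by rewrite /lagrangian; do 3!(rewrite mulr_sumr; apply: eq_bigr => ? _); ring.
Qed.

(** If [F] contains a K_m it lies inside it, and [E3] bounds it; otherwise the gap theorem applies,
    fed with the bound for t-1. *)
Theorem lagrangian_matching t : (0 < t)%N -> (3 * t - 1 <= #|V|)%N ->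
  lagrangian_bound t.
Proof.
elim: t => // -[|t] IHt _ Vt F w uF nM w0.
  have -> : F = set0.
    apply/eqP; rewrite -subset0; apply/subsetP => e eF; case: nM.
    by exists [:: e]; rewrite /= eF.
  rewrite /turan_density (_ : 3 * 1 - 1 = 2)%N // subrr mulr0 !mul0r.
  by rewrite /lagrangian; do 3!(rewrite big1 // => ? _); rewrite inE mul0r.
set s := \sum_v w v; have s0 : 0 <= s by apply: sumr_ge0.
have [sz|sn] := eqVneq s 0.
  have wz v : w v = 0.
    apply/eqP; rewrite eq_le w0 andbT -sz /s (bigD1 v) //= lerDl; exact: sumr_ge0.
  by rewrite sz expr0n mulr0 /lagrangian; do 3!(rewrite big1 // => ? _);
    rewrite wz !mul0r mulr0.
pose w' v := s^-1 * w v.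
have w'0 v : 0 <= w' v by rewrite mulr_ge0 ?invr_ge0.
have w'1 : \sum_v w' v = 1 by rewrite -mulr_sumr mulVf.
suff H : lagrangian F w' <= turan_density R (3 * t.+2 - 1).
  have -> : lagrangian F w = s ^+ 3 * lagrangian F w'.
    by rewrite /w' lagrangianZ mulrA -exprMn mulfV // expr1n mul1r.
  by rewrite mulrC ler_wpM2r // exprn_ge0.
have [/exists_inP[S]|] := boolP [exists S in [set S : {set V} | #|S| == (3 * t.+2 - 1)%N],
      clique S \subset F].
  rewrite inE => /eqP cS SF.
  apply: le_trans (lagrangian_sub_clique (S := S) uF w'0 _) _.
    apply/subsetP => f fF; have f3 : #|f| == 3 by move/forall_inP: uF; apply.
    rewrite inE f3 andbT; apply/negPn/negP => fS.
    by apply: nM; apply: clique_matching uF SF fF fS.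
  apply: E3_le_density_le1 => //; first by clear; lia.
  exact: sum_subset_le1.
move/exists_inPn => nK.
have g := lagrangian_gap _ Vt (IHt _ _) uF nM _ w'0 w'1.
apply: le_trans (g _ _ _ _) _ => //; first by clear -Vt; lia.
  by move=> S cS; apply: nK; rewrite inE cS.
by rewrite gerBl ltW // gap_gt0 //; clear; lia.
Qed.

End Gap.

(** * Fat pairs and copies of the extension *)

(** Greedy choice: fewer than #|B| + #|Q| elements are forbidden at each step. *)
Lemma avoiding_sdr (Q V : finType) (A : Q -> {set V}) (B : {set V}) :
  (forall q, #|B| + #|Q| <= #|A q|) ->
  exists2 g : Q -> V, injective g & forall q, g q \in A q :\: B.
Proof.
move=> big.
suff H r : uniq r -> exists2 g : Q -> V, {in r &, injective g} &
    {in r, forall q, g q \in A q :\: B}.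
  have [g gi gA] := H _ (enum_uniq Q).
  by exists g => [x y|q]; [apply: gi; rewrite mem_enum | apply: gA; rewrite mem_enum].
elim: r => [_|q r IHr /= /andP[qr ur]].
  have [q|noq] := pickP (pred_of_simpl (@predT Q)); last first.
    have g : Q -> V by move=> q; have := noq q.
    by exists g => q; have := noq q.
  move=> _; have /card_gt0P[v _] : 0 < #|A q|.
    by apply: leq_trans (big q); have := max_card (pred1 q); rewrite card1; lia.
  by exists (fun=> v).
have [g gi gA] := IHr ur.
have /card_gt0P[v] : 0 < #|A q :\: (B :|: [set x in map g r])|.
  have := cardsID (B :|: [set x in map g r]) (A q).
  have := subset_leq_card (subsetIr (A q) (B :|: [set x in map g r])).
  have := (leq_card_setU B [set x in map g r]).1.
  have : #|[set x in map g r]| <= size r by rewrite cardsE -(size_map g); apply: card_size.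
  have : size (q :: r) <= #|Q|.
    by rewrite cardE; apply: uniq_leq_size => [|x _]; rewrite ?mem_enum //= qr.
  by move: (big q) => /=; lia.
rewrite !inE negb_or => /andP[/andP[vB vr] vA].
exists (fun x => if x == q then v else g x).
  move=> x y; rewrite !inE; case: eqP => [-> _|_ /= xr]; case: eqP => [-> _|_ /= yr] //.
  - by move=> E; rewrite E map_f in vr.
  - by move=> E; rewrite -E map_f in vr.
  - exact: gi.
move=> x; rewrite inE; case: eqP => [-> _|_ /= xr]; first by rewrite !inE vB vA.
exact: gA.
Qed.

Section Embedding.
Variables (V : finType) (G : {set {set V}}).
Hypothesis uG : uniform 3 G.

Definition fat N x y := N <= #|[set z | [set x; y; z] \in G]|.

Lemma fat_neq N x y : 0 < N -> fat N x y -> x != y.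
Proof.
move=> N0 /(leq_trans N0)/card_gt0P[z]; rewrite inE.
by case/(uniform_triple uG)/and3P.
Qed.

Lemma fatC N x y : fat N x y = fat N y x.
Proof.
by rewrite /fat; congr (_ <= #|pred_of_set _|); apply/setP => z; rewrite !inE tripleCA.
Qed.

Definition cross_fat N := fun e f : {set V} => [forall x in e, forall y in f, fat N x y].

Lemma cross_fatP N (e f : {set V}) :
  reflect {in e & f, forall x y, fat N x y} (cross_fat N e f).
Proof.
apply: (iffP forall_inP) => [H x y xe yf | H x xe].
  by have /forall_inP := H x xe; apply.
by apply/forall_inP => y yf; apply: H.
Qed.

(** The i-th edge of the matching is sent onto the i-th set of [s]. An uncovered pair of the core
    joins two different edges, so its image is fat. As r - 2 = 1, each pair needs one new vertex,
    and N is large enough to choose these distinct and off the core. *)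
Lemma embed_extension t N (s : seq {set V}) : 0 < t ->
  #|ext_vertex 3 (3 * t) (matching 3 t)| <= N -> size s = t -> all (mem G) s ->
  pairwise (cross_fat N) s -> contains (extension 3 (3 * t) (matching 3 t)) G.
Proof.
move=> t0 leN st /allP sG sp.
set C := core ('I_t * 'I_3)%type (3 * t).
pose Q : finType := ({P : {set C} | uncovered_pair (matching 3 t) P} * 'I_(3 - 2))%type.
have leN' : #|C| + #|Q| <= N by rewrite -card_sum.
have e3 i : i < t -> #|nth set0 s i| = 3.
  move=> it; move/forall_inP: uG => uG'; apply/eqP/uG'/sG.
  by rewrite mem_nth ?st.
have N0 : 0 < N.
  apply: leq_trans leN'; rewrite addn_gt0; apply/orP; left; apply/card_gt0P.
  by exists (inl (Ordinal t0, ord0)).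
have [x0 _] : exists x, x \in nth set0 s 0 by apply/card_gt0P; rewrite e3.
pose phi (c : C) : V :=
  if c is inl q then nth x0 (enum (nth set0 s q.1)) q.2 else x0.
have phi_in q : phi (inl q) \in nth set0 s q.1.
  by rewrite -mem_enum mem_nth // -cardE e3.
(* The matching already has 3t vertices, so the core has no added ones. *)
have C_inl (c : C) : exists q, c = inl q.
  case: c => [q|j]; first by exists q.
  by exfalso; case: j => j; rewrite card_prod !card_ord mulnC subnn.
have phi_fat (q q' : 'I_t * 'I_3) : q.1 != q'.1 -> fat N (phi (inl q)) (phi (inl q')).
  move=> nq; have := elimT (pairwiseP set0) sp.
  have [lt_q|lt_q|/val_inj E] := ltngtP q.1 q'.1; last by rewrite E eqxx in nq.
    move/(_ q.1 q'.1); rewrite !inE st !ltn_ord => /(_ isT isT lt_q)/cross_fatP.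
    by apply; apply: phi_in.
  move/(_ q'.1 q.1); rewrite !inE st !ltn_ord => /(_ isT isT lt_q)/cross_fatP H.
  by rewrite fatC; apply: H; apply: phi_in.
have phi_inj : injective phi.
  move=> c c'; have [[i k] ->] := C_inl c; have [[j l] ->] := C_inl c'.
  have [<-{j} /= /eqP|ij E] := eqVneq i j.
    rewrite nth_uniq ?enum_uniq -?cardE ?e3 // => /eqP kl.
    by congr (inl (_, _)); apply: val_inj.
  have := @phi_fat (i, k) (j, l) ij; rewrite E => /(fat_neq N0).
  by rewrite eqxx.
pose A (q : Q) : {set V} := [set z | z |: phi @: val q.1 \in G].
have [|g g_inj gA] := @avoiding_sdr Q V A (phi @: [set: C]).
  move=> -[[P uP] k]; rewrite card_imset // cardsT; apply: leq_trans leN' _.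
  have /andP[/cards2P[c [c' [cc PE]]] ncov] := uP.
  have [q cE] := C_inl c; have [q' cE'] := C_inl c'.
  have nq : q.1 != q'.1.
    apply: contra ncov => /eqP qq; apply/exists_inP.
    exists (inl @: [set x : 'I_t * 'I_3 | x.1 == q.1]).
      by apply/imsetP; exists [set x : 'I_t * 'I_3 | x.1 == q.1] => //; apply: imset_f.
    by rewrite PE cE cE' subUset !sub1set !mem_imset ?inE ?qq ?eqxx // => ? ? [].
  apply: leq_trans (phi_fat q q' nq) _; apply: subset_leq_card; apply/subsetP => z.
  by rewrite !inE /= PE imsetU !imset_set1 cE cE' setUC.
pose f (x : ext_vertex 3 (3 * t) (matching 3 t)) : V :=
  match x with inl c => phi c | inr q => g q end.
apply/existsP; exists (finfun f); apply/andP; split.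
  apply/injectiveP => x y; rewrite !ffunE.
  case: x => [c|q]; case: y => [c'|q'] /=.
  - by move/phi_inj => ->.
  - by move=> E; have := gA q'; rewrite -E inE imset_f.
  - by move=> E; have := gA q; rewrite E inE imset_f.
  - by move/g_inj => ->.
have fl (X : {set C}) : finfun f @: (inl @: X) = phi @: X.
  by rewrite -imset_comp; apply: eq_imset => c; rewrite /= ffunE.
apply/forall_inP => e; rewrite inE => /orP[|] /imsetP.
  case=> _ /imsetP[M MM ->] ->; rewrite fl -imset_comp.
  have M3 : #|M| = 3.
    by have /forall_inP/(_ M MM)/eqP := matching_uniform 3 t.
  case/imsetP: MM M3 => i _ -> M3.
  rewrite [X in X \in G](_ : _ = nth set0 s i).
    by apply: sG; rewrite mem_nth // st.
  apply/eqP; rewrite eqEcard e3 // card_imset ?M3 ?andbT; last first.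
    by move=> q q' /phi_inj[].
  apply/subsetP => _ /imsetP[q + ->]; rewrite inE => /eqP <-.
  exact: phi_in.
case=> P _ ->; pose k0 : 'I_(3 - 2) := Ordinal (isT : 0 < 3 - 2).
have := gA (P, k0); rewrite !inE => /andP[_].
rewrite /pair_edge imsetU fl setUC; congr (_ :|: _ \in G); apply/setP => z.
rewrite inE; apply/eqP/imsetP => [->|[_ /imsetP[k _ ->] ->]].
  by exists (inr (P, k0)); rewrite ?ffunE //; apply: imset_f.
by rewrite ffunE /=; congr (g (_, _)); apply: val_inj; case: k => -[].
Qed.

End Embedding.

Notation extension_order t := #|ext_vertex 3 (3 * t) (matching 3 t)|.

Section FatPairs.
Variables (V : finType) (G : {set {set V}}) (t : nat).
Hypothesis t2 : 2 <= t.
Hypothesis uG : uniform 3 G.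
Hypothesis Gfree : ~~ contains (extension 3 (3 * t) (matching 3 t)) G.
Implicit Types (A S X e : {set V}) (x y z : V).

Local Notation N := (extension_order t).
Local Notation fatp := (fat G N).

Definition fat_edges : {set {set V}} :=
  [set e in G | [forall x in e, forall y in e, (x != y) ==> fatp x y]].

Lemma fat_edgesW e : e \in fat_edges -> e \in G.
Proof. by rewrite inE => /andP[]. Qed.

Lemma fat_edges_uniform : uniform 3 fat_edges.
Proof. by apply: uniform_sub uG; apply/subsetP => e /fat_edgesW. Qed.

Lemma fat_edgeP e x y : e \in fat_edges -> x \in e -> y \in e -> x != y -> fatp x y.
Proof.
rewrite inE => /andP[_ /forall_inP H] xe ye xy.
by have /forall_inP/(_ y ye)/implyP := H x xe; apply.
Qed.

Lemma covered_fat x y : x != y -> covered fat_edges [set x; y] -> fatp x y.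
Proof.
move=> xy /exists_inP[e eF]; rewrite subUset !sub1set => /andP[xe ye].
exact: fat_edgeP eF xe ye xy.
Qed.

Lemma extension_order_gt0 : 0 < N.
Proof.
apply/card_gt0P; have t0 : 0 < t by lia.
by exists (inl (inl (Ordinal t0, ord0))).
Qed.

(* The remaining edges of the matching are taken inside the complete set [A]. *)
Lemma fat_core_free (s : seq {set V}) A :
  all (mem G) s -> pairwise (cross_fat G N) s ->
  clique A \subset G -> {in A &, forall x y, x != y -> fatp x y} ->
  all (fun e => cross_fat G N e A) s -> 3 * (t - size s) <= #|A| -> size s <= t ->
  False.
Proof.
move=> sG sp /subsetP AG Afat sA cA st.
have [r [rs /allP rA rp]] := disjoint_triples cA.
apply: (negP Gfree); have t0 : 0 < t by lia.
apply: (@embed_extension _ _ uG t N (s ++ r) t0) => //.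
- by rewrite size_cat rs; lia.
- by rewrite all_cat sG; apply/allP => e /rA /AG.
rewrite pairwise_cat sp /=; apply/andP; split.
  apply/allrelP => e f es fr; apply/cross_fatP => x y xe yf.
  have /cross_fatP := allP sA e es; apply => //.
  by have := rA f fr; rewrite /= inE => /andP[/subsetP/(_ y yf)].
have rA' : {in r, forall e, e \subset A}.
  by move=> e /rA /=; rewrite inE => /andP[].
apply: (sub_in_pairwise (P := mem r)) rp; last by apply/allP.
move=> e f er fr ef; apply/cross_fatP => x y xe yf.
apply: Afat; [exact: subsetP (rA' e er) x xe|exact: subsetP (rA' f fr) y yf|].
by apply: contraTneq yf => <-; move: ef; rewrite disjoint_subset => /subsetP/(_ x xe).
Qed.

(** Meant for the support of a weighting on which no transfer is possible: there every pair is
    covered by a fat edge. *)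
Lemma fat_clique_no_matching X : {in X &, forall x y, x != y -> fatp x y} ->
  ~ has_matching [set e in fat_edges | e \subset X] t.
Proof.
move=> Xfat [s [st /allP sF sp]].
have sX e x : e \in s -> x \in e -> x \in X.
  by move=> /sF /=; rewrite inE => /andP[_ /subsetP]; apply.
apply: (@fat_core_free s set0); rewrite ?st ?subnn ?cards0 //.
- by apply/allP => e /sF /=; rewrite inE => /andP[/fat_edgesW].
- apply: (sub_in_pairwise (P := mem s)) sp; last by apply/allP.
  move=> e f es fs ef; apply/cross_fatP => x y xe yf.
  apply: Xfat; [exact: sX xe|exact: sX yf|].
  by apply: contraTneq yf => <-; move: ef; rewrite disjoint_subset => /subsetP/(_ x xe).
- apply/subsetP => e; rewrite inE subset0 => /andP[/eqP ->].
  by rewrite cards0.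
- by move=> x y; rewrite inE.
- by apply/allP => e _; apply/cross_fatP => x y _; rewrite inE.
Qed.

Section Clique.
Variable S : {set V}.
Hypothesis cS : #|S| = 3 * t - 1.
Hypothesis SG : clique S \subset fat_edges.

Lemma clique_fat : {in S &, forall x y, x != y -> fatp x y}.
Proof.
move=> x y xS yS xy.
have : 0 < #|S :\ x :\ y|.
  have := cardsD1 x S; have := cardsD1 y (S :\ x).
  by rewrite xS !inE eq_sym xy yS cS; move: t2; clear; lia.
case/card_gt0P => z; rewrite !inE => /and3P[zy zx zS].
have E : [set x; y; z] \in fat_edges.
  apply: (subsetP SG); rewrite inE !subUset !sub1set xS yS zS triple_card3 xy.
  by rewrite eq_sym zx eq_sym zy.
by apply: (fat_edgeP E) => //; rewrite !inE eqxx ?orbT.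
Qed.

Lemma clique_sub A : A \subset S -> clique A \subset G.
Proof.
move=> AS; apply/subsetP => e; rewrite inE => /andP[eA e3].
by apply/fat_edgesW/(subsetP SG); rewrite inE e3 (subset_trans eA AS).
Qed.

(** If [z] were fat to all of [S], the edge {z, a, b} and t-1 disjoint triples of the 3t-3 remaining
    vertices of [S] would form the core of H. *)
Lemma link_not_fat z a b : a \in S -> b \in S -> [set z; a; b] \in G ->
  exists2 s, s \in S & ~~ fatp z s.
Proof.
move=> aS bS zabG.
have [/exists_inP[s sS zs]|/exists_inPn zfat] := boolP [exists s in S, ~~ fatp z s].
  by exists s.
exfalso.
have {}zfat s : s \in S -> fatp z s by move=> /zfat; rewrite negbK.
have /and3P[_ _ ab] := uniform_triple uG zabG.
apply: (@fat_core_free [:: [set z; a; b]] (S :\ a :\ b)) => //=.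
- by rewrite zabG.
- by apply: clique_sub; apply/subsetP => x; rewrite !inE => /and3P[].
- by move=> x y; rewrite !inE => /and3P[_ _ xS] /and3P[_ _ yS]; apply: clique_fat.
- rewrite andbT; apply/cross_fatP => x y; rewrite !inE -orbA => xe /and3P[yb ya yS].
  by case/or3P: xe => /eqP ->; [apply: zfat|apply: clique_fat; rewrite // eq_sym..].
- have := cardsD1 a S; have := cardsD1 b (S :\ a).
  by rewrite aS !inE eq_sym ab bS cS; move: t2; clear; lia.
- by move: t2; clear; lia.
Qed.

(** In other words, [z] can replace [s] in the complete 3-graph on [S]. *)
Definition attached s z :=
  [forall a in S :\ s, forall b in S :\ s, (a != b) ==> ([set z; a; b] \in fat_edges)].

Lemma attachedP s z : reflect (forall a b, a \in S -> b \in S -> a != s -> b != s ->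
  a != b ->
  [set z; a; b] \in fat_edges) (attached s z).
Proof.
apply: (iffP forall_inP) => [H a b aS bS as_ bs ab | H a].
  have aS' : a \in S :\ s by rewrite in_setD1 as_.
  have bS' : b \in S :\ s by rewrite in_setD1 bs.
  by have /forall_inP/(_ b bS')/implyP := H a aS'; apply.
rewrite in_setD1 => /andP[as_ aS]; apply/forall_inP => b.
by rewrite in_setD1 => /andP[bs bS]; apply/implyP => ab; apply: H.
Qed.

Lemma pick_other (B : {set V}) : #|B| <= 4 -> exists2 b, b \in S & b \notin B.
Proof.
move=> B4; have /card_gt0P[b] : 0 < #|S :\: B|.
  have := cardsID B S; have := subset_leq_card (subsetIr S B); rewrite cS.
  by move: t2 B4; clear; lia.
by rewrite inE => /andP[bB bS]; exists b.
Qed.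

Lemma card_set4 (a b c d : V) : #|[set a; b; c; d]| <= 4.
Proof.
have := (leq_card_setU [set a; b; c] [set d]).1.
have := (leq_card_setU [set a; b] [set c]).1.
by rewrite !cards1 cards2; case: eqP => _; clear; lia.
Qed.

Lemma attached_fat s z y : s \in S -> attached s z -> y \in S -> y != s -> fatp z y.
Proof.
move=> sS /attachedP zs yS ys.
have [b bS] := pick_other (card_set4 s y s y).
rewrite !inE !negb_or -!andbA => /and4P[bs yb _ _].
have E := zs y b yS bS ys bs; rewrite eq_sym in E.
apply: (fat_edgeP (E yb)); rewrite ?[_ \in [set _; _; _]]inE ?inE ?eqxx ?orbT //.
by have /and3P[] := uniform_triple fat_edges_uniform (E yb).
Qed.

(** Otherwise {x, a, b} and {y, c, d} with a, b, c, d in [S] other than [s], together with t-2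
    disjoint triples of the remaining 3t-6 vertices of [S], form the core of H. *)
Lemma attached_not_fat s x y : s \in S -> attached s x -> attached s y -> ~~ fatp x y.
Proof.
move=> sS xs ys; apply/negP => xy.
have [a aS] := pick_other (card_set4 s s s s).
rewrite !inE !negb_or -!andbA => /and4P[as_ _ _ _].
have [b bS] := pick_other (card_set4 s a a a).
rewrite !inE !negb_or -!andbA => /and4P[bs ba _ _].
have [c cS'] := pick_other (card_set4 s a b b).
rewrite !inE !negb_or -!andbA => /and4P[cs ca cb _].
have [d dS] := pick_other (card_set4 s a b c).
rewrite !inE !negb_or -!andbA => /and4P[ds da db dc].
have fx u : u \in S -> u != s -> fatp x u := attached_fat sS xs.
have fy u : u \in S -> u != s -> fatp y u := attached_fat sS ys.
have xab : [set x; a; b] \in fat_edges by move/attachedP: xs; apply; rewrite // eq_sym.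
have ycd : [set y; c; d] \in fat_edges by move/attachedP: ys; apply; rewrite // eq_sym.
apply: (@fat_core_free [:: [set x; a; b]; [set y; c; d]] (S :\: [set s; a; b; c;
  d])) => //=.
- by rewrite !fat_edgesW.
- rewrite !andbT; apply/cross_fatP => u v; rewrite !inE -!orbA => ue vf.
  case/or3P: ue => /eqP ->; case/or3P: vf => /eqP -> //;
    try by [apply: fx | rewrite fatC; apply: fy | apply: clique_fat; rewrite // eq_sym].
- by apply: clique_sub; apply: subsetDl.
- by move=> u v; rewrite !inE => /andP[_ uS] /andP[_ vS]; apply: clique_fat.
- rewrite andbT; apply/andP; split; apply/cross_fatP => u v;
    rewrite !inE !negb_or -!orbA -!andbA => ue /andP[vs /and5P[va vb vc vd vS]];
    case/or3P: ue => /eqP ->;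
    by [apply: fx | apply: fy | apply: clique_fat; rewrite // eq_sym].
- have := cardsID [set s; a; b; c; d] S.
  have := subset_leq_card (subsetIr S [set s; a; b; c; d]).
  have := (leq_card_setU [set s; a; b; c] [set d]).1; have := card_set4 s a b c.
  by rewrite cards1 cS; move: t2; clear; lia.
Qed.

End Clique.

End FatPairs.

(** * Localisation on a complete 3-graph *)

Section LinkWeight.
Local Open Scope ring_scope.
Variables (R : realFieldType) (V : finType).
Implicit Types (S : {set V}) (w : V -> R).

(** Replacing the weights on [S] by 1/m costs at most 2mx + m^2 x^2, and the pairs leaving [S] weigh
    at most 2mx; together this is at most 5 m^2 x. The flag [u] marks a link that misses a pair,
    worth 1/m^2. *)
Lemma link_weight_le (L : {set V * V}) S (m : nat) (u : bool) w (x : R) (p : V -> V ->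
  bool) :
  #|S| = m -> (5 <= m)%N -> (#|L| + u <= (m - 1) * (m - 2))%N ->
  (forall b c, b \in S -> c \in S -> p b c -> (b, c) \in L) ->
  0 <= x <= 1 -> (forall v, 0 <= w v) -> \sum_v w v = 1 ->
  {in S, forall s, `|w s - m%:R^-1| <= x} ->
  \sum_b \sum_c (p b c)%:R * (w b * w c)
  <= turan_density R m + 5 * m%:R ^+ 2 * x - u%:R / m%:R ^+ 2.
Proof.
move=> cS m5 cL pL /andP[x0 x1] w0 w1 wS.
pose i : R := m%:R^-1; rewrite -/i in wS.
have m0 : 0 < m%:R :> R by rewrite ltr0n (leq_trans _ m5).
have i0 : 0 < i by rewrite invr_gt0.
have wle s : s \in S -> w s <= i + x by move/wS; rewrite ler_norml => /andP[]; clear; lra.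
have tail : \sum_(v | v \notin S) w v <= m%:R * x.
  have : m%:R * (i - x) <= \sum_(v in S) w v.
    rewrite (_ : _ * _ = \sum_(v in S) (i - x)); last first.
      by rewrite sumr_const cS mulr_natl.
    by apply: ler_sum => s /wS; rewrite ler_norml => /andP[]; clear; lra.
  move: w1; rewrite (bigID (mem S)) /= mulrBr mulfV ?gt_eqF //; clear; lra.
pose o v : R := (v \notin S)%:R.
have osum : \sum_v o v * w v <= m%:R * x.
  apply: le_trans tail; rewrite [leRHS]big_mkcond; apply: ler_sum => v _ /=.
  by rewrite /o; case: ifP => _; rewrite ?mul1r ?mul0r.
pose K b c : R := ((b, c) \in L)%:R.
apply: le_trans (_ : _ <= \sum_b \sum_c (K b c * (i + x) ^+ 2
    + o b * w b * w c + w b * (o c * w c))) _.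
  apply: ler_sum => b _; apply: ler_sum => c _; rewrite /K /o.
  have p0 : 0 <= w b * w c by apply: mulr_ge0.
  have q0 : 0 <= (i + x) ^+ 2 by apply: sqr_ge0.
  have k0 : 0 <= ((b, c) \in L)%:R * (i + x) ^+ 2 by rewrite mulr_ge0 ?ler0n.
  have ob0 : 0 <= (b \notin S)%:R * w b * w c by rewrite -mulrA mulr_ge0 ?ler0n.
  have oc0 : 0 <= w b * ((c \notin S)%:R * w c) by rewrite mulrCA mulr_ge0 ?ler0n.
  case pbc: (p b c); last by rewrite mul0r !addr_ge0.
  rewrite mul1r.
  have [bS|bS] := boolP (b \in S); last first.
    by rewrite /= mul1r addrAC lerDr addr_ge0.
  have [cS'|cS'] := boolP (c \in S); last first.
    by rewrite /= mul1r lerDr addr_ge0 // mul0r mul0r.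
  rewrite pL // mul1r !mul0r mulr0 !addr0 expr2.
  by apply: ler_pM => //; apply: wle.
have -> : \sum_b \sum_c (K b c * (i + x) ^+ 2 + o b * w b * w c + w b * (o c * w c))
   = #|L|%:R * (i + x) ^+ 2 + 2 * \sum_v o v * w v.
  have -> : #|L|%:R = \sum_b \sum_c K b c.
    rewrite -sum1_card natr_sum pair_bigA big_mkcond /=; apply: eq_bigr => -[b c] _.
    by rewrite /K /=; case: ifP.
  transitivity (\sum_b \sum_c K b c * (i + x) ^+ 2 + \sum_b \sum_c o b * w b * w c
     + \sum_b \sum_c w b * (o c * w c)).
    rewrite -!big_split; apply: eq_bigr => b _ /=.
    by rewrite -!big_split.
  rewrite mulr_suml; under [X in X + _ + _]eq_bigr do rewrite -mulr_suml.
  under [X in _ + X + _]eq_bigr do rewrite -mulr_sumr w1 mulr1.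
  under [X in _ + _ + X]eq_bigr do rewrite -mulr_sumr.
  rewrite -[X in _ + _ + X]mulr_suml w1; clear; ring.
have {}cL : #|L|%:R + u%:R <= (m%:R - 1) * (m%:R - 2) :> R.
  have -> : (m%:R - 1) * (m%:R - 2) = ((m - 1) * (m - 2))%N%:R :> R.
    by rewrite natrM !natrB ?(leq_trans _ m5).
  by rewrite -natrD ler_nat.
rewrite /turan_density.
have im : i * m%:R = 1 by rewrite mulVf ?gt_eqF.
have m5R : 5 <= m%:R :> R by rewrite ler_nat.
rewrite -exprVn -/i; clear -cL osum i0 im m5R x0 x1.
move: osum; move: (\sum_v _) => T.
have := ler0n R #|L|; have := ler0n R (u : nat).
move: cL im m5R; move: (m%:R : R) (#|L|%:R : R) (u%:R : R) => M l d.
move=> le_l iM M5 d0 l0 leT.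
have h1 : l * (2 * i * x + x ^+ 2) <= M ^+ 2 * (2 * i * x + x ^+ 2).
  apply: ler_wpM2r; first by rewrite addr_ge0 ?sqr_ge0 ?mulr_ge0 // ltW.
  by rewrite expr2; nra.
have h2 : M ^+ 2 * (2 * i * x + x ^+ 2) = 2 * M * x * (i * M) + M ^+ 2 * (x * x) by ring.
rewrite iM mulr1 in h2.
have h3 : M ^+ 2 * (x * x) <= M ^+ 2 * x by rewrite ler_wpM2l ?sqr_ge0 // ler_piMr.
have h4 : M * x <= M ^+ 2 * x by rewrite expr2 -mulrA ler_peMl ?mulr_ge0 //; lra.
have h5 : (l + d) * i ^+ 2 <= (M - 1) * (M - 2) * i ^+ 2.
  by apply: ler_wpM2r => //; apply: sqr_ge0.
have h6 : l * (i + x) ^+ 2 = l * i ^+ 2 + l * (2 * i * x + x ^+ 2) by ring.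
rewrite h6; clear -h1 h2 h3 h4 h5 leT; lra.
Qed.

End LinkWeight.

Section LinkCount.
Local Open Scope ring_scope.
Variables (R : realFieldType) (V : finType) (G : {set {set V}}) (t : nat).
Hypothesis t2 : (2 <= t)%N.
Hypothesis uG : uniform 3 G.
Hypothesis Gfree : ~~ contains (extension 3 (3 * t) (matching 3 t)) G.
Implicit Types (S : {set V}) (w : V -> R).

Local Notation N := (extension_order t).
Local Notation fatp := (fat G N).
Local Notation Gf := (fat_edges G t).
Local Notation m := (3 * t - 1)%N.
Local Notation n := #|V|.

Definition triple_count (F : {set {set V}}) : R := lagrangian F (fun=> 1).

Lemma triple_count_edges F : uniform 3 F -> triple_count F = 6 * #|F|%:R.
Proof.
move=> uF; rewrite /triple_count lagrangian_edges //; congr (_ * _).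
rewrite -sum1_card natr_sum; apply: eq_bigr => e _; exact: big1.
Qed.

Lemma lagrangian_const F (c : R) : lagrangian F (fun=> c) = c ^+ 3 * triple_count F.
Proof. by rewrite -lagrangianZ; do 3!(apply: eq_bigr => ? _); rewrite mulr1. Qed.

Lemma sparse_pairs_count :
  (\sum_(a : V) \sum_(b : V) \sum_(c : V) (([set a; b;
    c] \in G) && ~~ fatp a b) <= N * n ^ 2)%N.
Proof.
apply: leq_trans (_ : \sum_(a : V) \sum_(b : V) N <= _)%N; last first.
  rewrite (eq_bigr (fun=> (n * N)%N)) => [|a _]; last by rewrite sum_nat_const.
  by rewrite sum_nat_const mulnA mulnC.
apply: leq_sum => a _; apply: leq_sum => b _.
have [_|] := boolP (fatp a b).
  by rewrite big1 // => c _; rewrite andbF.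
rewrite /fat -ltnNge => /ltnW; apply: leq_trans; rewrite -sum1_card [leqRHS]big_mkcond /=.
by apply: leq_sum => c _; rewrite inE andbT; case: ifP.
Qed.

(** A lost ordered triple has a non-fat pair in one of three positions, and such a pair has fewer
    than N extensions to an edge. *)
Lemma fat_edges_count : triple_count G <= triple_count Gf + 3 * N%:R * n%:R ^+ 2.
Proof.
pose T (p : V -> V -> V -> bool) : R := \sum_a \sum_b \sum_c (p a b c)%:R.
pose p1 a b c := ([set a; b; c] \in G) && ~~ fatp a b.
pose p2 a b c := ([set a; b; c] \in G) && ~~ fatp a c.
pose p3 a b c := ([set a; b; c] \in G) && ~~ fatp b c.
have T1 : T p1 <= N%:R * n%:R ^+ 2.
  rewrite -natrX -natrM.
  apply: le_trans (_ : _ <= (\sum_a \sum_b \sum_c p1 a b c)%N%:R) _; last first.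
    by rewrite ler_nat sparse_pairs_count.
  rewrite natr_sum; apply: ler_sum => a _; rewrite natr_sum; apply: ler_sum => b _.
  by rewrite natr_sum.
have T2 : T p2 = T p1.
  apply: eq_bigr => a _; rewrite exchange_big; apply: eq_bigr => b _.
  by apply: eq_bigr => c _; rewrite /p2 /p1 tripleAC.
have T3 : T p3 = T p1.
  rewrite /T exchange_big; apply: eq_bigr => b _.
  rewrite exchange_big; apply: eq_bigr => c _.
  by apply: eq_bigr => a _; rewrite /p3 /p1 triple_rot.
apply: le_trans (_ : _ <= triple_count Gf + (T p1 + T p2 + T p3)) _; last first.
  by rewrite lerD2l T2 T3; lra.
rewrite /triple_count /lagrangian /T -!big_split; apply: ler_sum => a _ /=.
rewrite -!big_split; apply: ler_sum => b _ /=.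
rewrite -!big_split; apply: ler_sum => c _ /=.
rewrite !mulr1 -!natrD ler_nat /p1 /p2 /p3.
have [abcG /=|] := boolP (_ \in G); last by [].
have [ab|] := boolP (fatp a b); last by lia.
have [ac|] := boolP (fatp a c); last by lia.
have [bc|] := boolP (fatp b c); last by lia.
rewrite inE abcG (_ : [forall x in _, _]) //.
apply/forall_inP => x xe; apply/forall_inP => y ye; apply/implyP.
move: xe ye; rewrite !inE -!orbA.
by case/or3P => /eqP ->; case/or3P => /eqP -> //; rewrite ?eqxx // fatC.
Qed.

Section Link.
Variable S : {set V}.
Hypothesis cS : #|S| = m.
Hypothesis SG : clique S \subset Gf.

Definition link z := [set p : V * V | [&& p.1 \in S, p.2 \in S & [set z; p.1; p.2] \in Gf]].

Lemma in_link z a b :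
  ((a, b) \in link z) = [&& a \in S, b \in S & [set z; a; b] \in Gf].
Proof. by rewrite in_set. Qed.

Definition unattached := [set z | [forall s in S, ~~ attached G t S s z]].

Lemma card_offdiag (A : {set V}) :
  #|[set p : V * V | [&& p.1 \in A, p.2 \in A & p.1 != p.2]]| = (#|A| * #|A|.-1)%N.
Proof.
rewrite -sum1_card (eq_bigl (fun p => (p.1 \in A) && ((p.2 \in A) && (p.1 != p.2))));
  last first.
  by move=> p; rewrite inE.
rewrite -(pair_big_dep (mem A) (fun a b => (b \in A) && (a != b)) (fun _ _ => 1%N)) /=.
rewrite (eq_bigr (fun=> #|A|.-1)) ?sum_nat_const // => a aA.
rewrite (cardsD1 a) aA /= -sum1_card; apply: eq_bigl => b.
by rewrite !inE andbC eq_sym.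
Qed.

(** By [link_not_fat] some [s] in [S] is not fat to [z], so the fat edges at [z] avoid [s]. If all
    ordered pairs off [s] occur, then [z] is attached to [s]; an unattached vertex therefore misses
    at least one. *)
Lemma card_link z : (#|link z| + (z \in unattached) <= (m - 1) * (m - 2))%N.
Proof.
have [l0|[[a b]]] := set_0Vmem (link z).
  rewrite l0 cards0 add0n; apply: leq_trans (leq_b1 _) _.
  by rewrite muln_gt0 !subn_gt0; move: t2; clear; lia.
rewrite in_link => /and3P[p1 p2 pG].
have [s sS zs] := link_not_fat t2 uG Gfree cS SG p1 p2 (fat_edgesW pG).
have cSs : #|S :\ s| = (m - 1)%N by have := cardsD1 s S; rewrite sS cS; lia.
have sub : link z \subset [set p : V * V | [&& p.1 \in S :\ s,
  p.2 \in S :\ s & p.1 != p.2]].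
  apply/subsetP => -[x y]; rewrite in_link => /and3P[q1 q2 qG].
  have /and3P[zq1 zq2 q12] := uniform_triple (fat_edges_uniform t uG) qG.
  rewrite inE q12 andbT !in_setD1 q1 q2 !andbT; apply/andP; split.
    by apply: contraNneq zs => <-; apply: (fat_edgeP qG); rewrite // !inE eqxx ?orbT.
  by apply: contraNneq zs => <-; apply: (fat_edgeP qG); rewrite // !inE eqxx ?orbT.
have cP := card_offdiag (S :\ s); rewrite cSs in cP.
have -> : (m - 2 = (m - 1).-1)%N by clear; lia.
rewrite -cP; case zu: (z \in unattached); last by rewrite addn0 subset_leq_card.
rewrite addn1; apply: proper_card; rewrite properE sub /=.
move: zu; rewrite inE => /forall_inP/(_ s sS); apply: contra => /subsetP sub'.
apply/attachedP => x y xS yS xs ys xy.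
have := sub' (x, y); rewrite in_link in_set /= !in_setD1 xS yS xs ys xy /=.
by move/(_ isT).
Qed.

End Link.

End LinkCount.

Section Localisation.
Local Open Scope ring_scope.
Variables (R : realFieldType) (V : finType).
Implicit Types (S : {set V}) (w : V -> R).

Lemma sqr_le_norm (a b : R) : 0 <= b -> a ^+ 2 <= b ^+ 2 -> `|a| <= b.
Proof.
by move=> b0 ab; rewrite -(@ler_pXn2r _ 2) ?nnegrE // real_normK ?num_real.
Qed.

(* The weighting is moved so as not to decrease
   A * (edge density) + (average link density); its final support carries a
   complete 3-graph on which most links are as large as possible. *)
Lemma localisation (G : {set {set V}}) t (A x eps : R) (n := #|V|) (m := (3 * t - 1)%N) :
  (2 <= t)%N -> uniform 3 G ->
  ~~ contains (extension 3 (3 * t) (matching 3 t)) G -> (m <= n)%N ->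
  turan_density R m - eps <= lagrangian (fat_edges G t) (fun=> n%:R^-1) ->
  0 < A -> 2 <= A * gap R m -> 10 <= A * x ^+ 2 -> 0 <= x <= 1 -> 0 <= eps ->
  (A + 1) * eps <= 1 ->
  exists S, [/\ #|S| = m, clique S \subset fat_edges G t &
    #|unattached G t S|%:R <= m%:R ^+ 2 * (5 * m%:R ^+ 2 * x + (A + 1) * eps) * n%:R].
Proof.
move=> t2 uG Gfree mn dens A0 Agap Ax x01 eps0 Aeps.
have m5 : (5 <= m)%N by rewrite /m; clear -t2; lia.
have n0 : 0 < n%:R :> R by rewrite ltr0n; clear -m5 mn; lia.
have in0 : 0 <= n%:R^-1 :> R by rewrite invr_ge0 ltW.
have nn : n%:R * n%:R^-1 = 1 :> R by rewrite mulfV ?gt_eqF.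
have uGf := fat_edges_uniform t uG.
have [w [w0 w1 wcov wle]] := weighted_triples_sym A (n%:R^-1 : R) uGf (fun _ => in0).
have ws : \sum_(v : V) n%:R^-1 = 1 :> R.
  by rewrite sumr_const -(mulr_natl n%:R^-1).
rewrite ws in w1.
rewrite !weighted_triplesD in wle.
pose q z w : R := \sum_b \sum_c ([set z; b; c] \in fat_edges G t)%:R * (w b * w c).
pose D w : R := \sum_z q z w.
(* At the uniform weighting the average link density equals the edge density, so the starting value
   is A + 1 times the latter. *)
have D0 : n%:R^-1 * D (fun=> n%:R^-1) = lagrangian (fat_edges G t) (fun=> n%:R^-1).
  rewrite /D /q /lagrangian mulr_sumr; apply: eq_bigr => z _.
  rewrite mulr_sumr; apply: eq_bigr => b _; rewrite mulr_sumr; apply: eq_bigr => c _.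
  by rewrite mulrCA !mulrA.
rewrite -/(D w) -/(D (fun=> n%:R^-1)) D0 in wle.
have q1 z : q z w <= 1.
  apply: le_trans (_ : _ <= \sum_b \sum_c w b * w c) _.
    apply: ler_sum => b _; apply: ler_sum => c _.
    by case: (_ \in _); rewrite ?mul1r // mul0r mulr_ge0.
  by rewrite (eq_bigr w) ?w1 // => b _; rewrite -mulr_sumr w1 mulr1.
have sum1 : \sum_(z : V) (1 : R) = n%:R by rewrite sumr_const.
have D1 : n%:R^-1 * D w <= 1.
  rewrite mulrC ler_pdivrMr // mul1r -sum1; exact: ler_sum.
pose F := [set e in fat_edges G t | e \subset supp w].
have uF : uniform 3 F by apply: uniform_sub uGf; apply/subsetP => e; rewrite inE => /andP[].
have nM : ~ has_matching F t.
  apply: (fat_clique_no_matching t2 uG Gfree) => a b aw bw ab.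
  apply: (covered_fat ab); exact: wcov.
set P := lagrangian (fat_edges G t) w in wle.
have PF : P = lagrangian F w by apply: lagrangian_supp.
set P0 := lagrangian _ (fun=> _) in dens wle.
have AP : A * (turan_density R m - eps) + (turan_density R m - eps) <= A * P + n%:R^-1 * D w.
  apply: le_trans wle; apply: lerD => //; by rewrite ler_pM2l.
have T0 := turan_density_ge0 R m.
have [/exists_inP[S]|] := boolP [exists S in [set S : {set V} | #|S| == m],
  clique S \subset F];
  last first.
  move/exists_inPn => nK.
  have IHt : lagrangian_bound R V t.-1.
    by apply: lagrangian_matching; rewrite /m in mn; clear -t2 mn; lia.
  (* Without a K_m the term in A loses at least 2, whereas the link term is at most 1 and the
     initial defect at most 1. *)
  have Pgap : P <= turan_density R m - gap R m.
    rewrite PF; apply: lagrangian_gap => // S cS; apply: nK; by rewrite inE cS.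
  have : A * P <= A * (turan_density R m - gap R m) by rewrite ler_pM2l.
  have Tp : 0 < turan_density R m.
    apply: le_lt_trans (turan_density_gt R m5).
    by rewrite divr_ge0 // sqr_ge0.
  move=> H; exfalso; move: AP Agap Aeps D1 Tp H; clear; lra.
rewrite inE => /eqP cS SF.
have SG : clique S \subset fat_edges G t.
  by apply: subset_trans SF _; apply/subsetP => e; rewrite inE => /andP[].
have FS : F \subset clique S.
  apply/subsetP => f fF; have f3 : #|f| == 3 by move/forall_inP: uF; apply.
  rewrite inE f3 andbT; apply/negPn/negP => fS.
  by apply: nM; apply: (clique_matching _ cS uF SF fF fS); clear -t2; lia.
have S1 := sum_subset_le1 S w0 w1.
have PE : P <= E3 S w by rewrite PF; apply: lagrangian_sub_clique.
have E3le := E3_le_density_le1 cS m5 (fun v _ => w0 v) S1.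
(* This 2/A and the factor 5 of [E3_stab_le1] are the source of the condition 10 <= A x^2. *)
have near : turan_density R m - 2 / A <= E3 S w.
  apply: le_trans PE; rewrite -(ler_pM2l A0) mulrBr (mulrC A (2 / A)) divfK ?gt_eqF //.
  move: AP Aeps D1 T0; clear; lra.
have wS : {in S, forall s, `|w s - m%:R^-1| <= x}.
  move=> s sS; have /andP[x0 _] := x01; apply: sqr_le_norm => //.
  apply: le_trans (E3_stab_le1 cS m5 (fun v _ => w0 v) S1 near sS) _.
  rewrite mulrA ler_pdivrMr // mulrC; move: Ax; clear; lra.
exists S; split => //.
have qz z : q z w <= turan_density R m + 5 * m%:R ^+ 2 * x - (z \in unattached G t S)%:R / m%:R ^+ 2.
  apply: (link_weight_le cS m5 (card_link t2 uG Gfree cS SG z)) => // b c bS cS' zbc.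
  by rewrite in_link bS cS'.
have Dle : n%:R^-1 * D w <= turan_density R m + 5 * m%:R ^+ 2 * x
     - #|unattached G t S|%:R / m%:R ^+ 2 / n%:R.
  rewrite mulrC ler_pdivrMr //.
  apply: le_trans (ler_sum _ (fun z _ => qz z)) _.
  rewrite sumrB sumr_const -mulr_suml.
  have -> : \sum_z (z \in unattached G t S)%:R = #|unattached G t S|%:R :> R.
    by rewrite -sum1_card natr_sum [RHS]big_mkcond; apply: eq_bigr => z _; case: ifP.
  by rewrite [leRHS]mulrBl divfK ?gt_eqF // mulr_natr.
have m0 : 0 < m%:R ^+ 2 :> R by rewrite exprn_gt0 // ltr0n (leq_trans _ m5).
(* The density term cannot exceed its extremal value, so the links as a whole lose at most (A + 1)
   eps, and every unattached vertex loses 1/m^2. *)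
have APle : A * P <= A * turan_density R m by rewrite ler_pM2l // (le_trans PE).
rewrite -ler_pdivrMr // [leRHS]mulrC -ler_pdivrMr // mulrAC.
move: AP APle Dle; clear; lra.
Qed.

End Localisation.

(** * Colour classes of a nearly extremal 3-graph *)

Section Coloured.
Local Open Scope ring_scope.
Variables (R : realFieldType) (V K : finType) (c : V -> K) (S : {set K}).

Definition part k : {set V} := [set x | c x == k].

Definition rainbow x y z :=
  [&& c x \in S, c y \in S, c z \in S, c y != c x, c z != c x & c z != c y].

Lemma sum_fibers (f : K -> R) (P : pred K) :
  \sum_(x | P (c x)) f (c x) = \sum_(k | P k) #|part k|%:R * f k.
Proof.
rewrite (partition_big c P) //=; apply: eq_bigr => k Pk.
rewrite (eq_bigr (fun=> f k)) => [|x /andP[_ /eqP ->] //].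
rewrite sumr_const -[LHS]mulr_natl; congr (_%:R * _).
by apply: eq_card => x; rewrite !inE unfold_in; case: eqP => [->|]; rewrite ?Pk ?andbF.
Qed.

Lemma rainbow_count :
  \sum_x \sum_y \sum_z (rainbow x y z)%:R = E3 S (fun k => #|part k|%:R : R).
Proof.
rewrite /E3.
transitivity (\sum_(x | c x \in S) \sum_(k in S | k != c x)
    \sum_(j in S | (j != c x) && (j != k)) #|part k|%:R * #|part j|%:R : R).
  rewrite [RHS]big_mkcond; apply: eq_bigr => x _ /=.
  case: ifP => xS; last first.
    by rewrite big1 // => y _; rewrite big1 // => z _; rewrite /rainbow xS.
  transitivity (\sum_(y | (c y \in S) && (c y != c x))
    \sum_(j in S | (j != c x) && (j != c y)) #|part j|%:R : R).
    rewrite [RHS]big_mkcond; apply: eq_bigr => y _ /=.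
    case: ifP => yS; last first.
      rewrite big1 // => z _; rewrite /rainbow xS /=.
      by case: (c y \in S) yS; case: (c y != c x); rewrite //= ?andbF.
    rewrite -[RHS](eq_bigr _ (fun j _ => mulr1 _)).
    rewrite -(sum_fibers (fun=> 1) (fun j => (j \in S) && ((j != c x) && (j != c y)))).
    rewrite [RHS]big_mkcond; apply: eq_bigr => z _ /=.
    case/andP: yS => yS yx; rewrite /rainbow xS yS yx /=.
    by case: ifP.
  rewrite (sum_fibers (fun k => \sum_(j in S | (j != c x) && (j != k)) #|part j|%:R)
    (fun k => (k \in S) && (k != c x))).
  by apply: eq_bigr => k _; rewrite mulr_sumr.
rewrite (sum_fibers (fun i => \sum_(k in S | k != i)
    \sum_(j in S | (j != i) && (j != k)) #|part k|%:R * #|part j|%:R) (mem S)) /=.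
apply: eq_bigr => i _; rewrite mulr_sumr; apply: eq_bigr => k _.
by rewrite mulr_sumr; apply: eq_bigr => j _; rewrite mulrA.
Qed.

Lemma E3Z (w : K -> R) (a : R) : E3 S (fun k => a * w k) = a ^+ 3 * E3 S w.
Proof.
rewrite /E3 mulr_sumr; apply: eq_bigr => ? _; rewrite mulr_sumr.
by apply: eq_bigr => ? _; rewrite mulr_sumr; apply: eq_bigr => ? _; ring.
Qed.

Lemma sum_parts_le : \sum_(k in S) #|part k|%:R <= #|V|%:R :> R.
Proof.
rewrite -(eq_bigr _ (fun j _ => mulr1 _)) -(sum_fibers (fun=> 1) (mem S)).
by rewrite sumr_const ler_nat max_card.
Qed.

(** A triple of [F] with all colours in [S] is rainbow, so the triples of [F] and the missing
    rainbow ones together number at most [E3] of the part sizes, up to triples with an uncoloured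
    vertex. Being within [k] of the maximum bounds both the missing triples and, by stability, the
    imbalance of the parts. *)
Lemma coloured_density (F : {set {set V}}) m (k x : R) (n := #|V|) :
  #|S| = m -> (5 <= m)%N -> (0 < n)%N -> uniform 3 F ->
  (forall e x y, e \in F -> x \in e -> y \in e -> x != y -> c x = c y -> c x \notin S) ->
  (turan_density R m - k) * n%:R ^+ 3 <=
     triple_count R F - 3 * #|[set x | c x \notin S]|%:R * n%:R ^+ 2 ->
  0 <= x -> 5 * k <= x ^+ 2 ->
  {in S, forall i, `|#|part i|%:R / n%:R - m%:R^-1| <= x} /\
  \sum_x \sum_y \sum_z (rainbow x y z && ([set x; y; z] \notin F))%:R
    <= k * n%:R ^+ 3.
Proof.
move=> cS m5 n0 uF Fc dens x0 kx.
have np : 0 < n%:R :> R by rewrite ltr0n.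
have n3 : 0 < n%:R ^+ 3 :> R by rewrite exprn_gt0.
pose T : R := \sum_x \sum_y \sum_z (rainbow x y z && ([set x; y; z] \in F))%:R.
pose M : R := \sum_x \sum_y \sum_z (rainbow x y z && ([set x; y; z] \notin F))%:R.
pose o x : R := (c x \notin S)%:R.
have osum : \sum_x o x = #|[set x | c x \notin S]|%:R.
  by rewrite -sum1_card natr_sum [RHS]big_mkcond; apply: eq_bigr => v _; rewrite inE /o;
    case: ifP.
have TM : T + M = E3 S (fun k => #|part k|%:R).
  rewrite -rainbow_count -big_split; apply: eq_bigr => y _ /=.
  rewrite -big_split; apply: eq_bigr => z _ /=; rewrite -big_split;
    apply: eq_bigr => v _ /=.
  by case: rainbow; case: (_ \in F); rewrite ?addr0 ?add0r.
have FT : triple_count R F <= T + 3 * #|[set x | c x \notin S]|%:R * n%:R ^+ 2.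
  have -> : 3 * #|[set x | c x \notin S]|%:R * n%:R ^+ 2 =
      \sum_x \sum_y \sum_z (o x + o y + o z).
    have s1 (a : R) : \sum_(v : V) a = a * n%:R by rewrite sumr_const -[LHS]mulr_natr.
    under eq_bigr => a _ do under eq_bigr => b _ do rewrite big_split /= s1 osum.
    under eq_bigr => a _ do rewrite big_split /= s1 -mulr_suml big_split /= s1 osum.
    rewrite big_split /= s1 -mulr_suml big_split /= s1 -mulr_suml osum; ring.
  rewrite -big_split; apply: ler_sum => y _ /=; rewrite -big_split;
    apply: ler_sum => z _ /=.
  rewrite -big_split; apply: ler_sum => v _ /=; rewrite !mulr1.
  rewrite -!natrD ler_nat; case eF: (_ \in F) => //.
  have /and3P[yz yv zv] := uniform_triple uF eF; rewrite andbT /rainbow.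
  have [yS|yS] := boolP (c y \in S); last by clear; lia.
  have [zS|zS] := boolP (c z \in S); last by clear; lia.
  have [vS|vS] := boolP (c v \in S); last by clear; lia.
  have ok a b : a \in [set y; z; v] -> b \in [set y; z;
    v] -> a != b -> c a \in S -> c b != c a.
    move=> ae be ab aS; rewrite eq_sym; apply: contraTneq aS => cE.
    exact: Fc eF ae be ab cE.
  by rewrite !ok // !inE eqxx ?orbT.
have E3n : E3 S (fun k => #|part k|%:R) = n%:R ^+ 3 * E3 S (fun k =>
  #|part k|%:R / n%:R : R).
  rewrite -E3Z; apply: eq_bigr => a _; apply: eq_bigr => b _; apply: eq_bigr => d _.
  by rewrite !(mulrC n%:R) !divfK ?gt_eqF.
have p0 i : 0 <= #|part i|%:R / n%:R :> R by rewrite divr_ge0.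
have p1 : \sum_(i in S) #|part i|%:R / n%:R <= 1 :> R.
  by rewrite -mulr_suml ler_pdivrMr // mul1r sum_parts_le.
have E3le := E3_le_density_le1 cS m5 (fun v _ => p0 v) p1.
have M0 : 0 <= M by do 3!(apply: sumr_ge0 => ? _).
set E := E3 S (fun k => #|part k|%:R / n%:R) in E3n E3le.
split.
  move=> i iS; apply: sqr_le_norm => //; apply: le_trans kx.
  apply: (E3_stab_le1 cS m5 (fun v _ => p0 v) p1) => //.
  rewrite -(ler_pM2r n3) -/E; move: dens FT TM E3n M0; clear; lra.
rewrite -/M; have : E * n%:R ^+ 3 <= turan_density R m * n%:R ^+ 3 by rewrite ler_pM2r.
move: dens FT TM E3n; clear; lra.
Qed.

End Coloured.

(** * Types of vertices *)

Lemma card_family_prod (K V : finType) (F : K -> {set V}) :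
  #|family (fun k => mem (F k))| = \prod_k #|F k|.
Proof.
rewrite card_family foldrE big_map big_enum.
by apply: eq_bigr => k _; apply: eq_card.
Qed.

(** * Transversals found by averaging over all choices *)

Section Selection.
Variables (K V : finType) (F : K -> {set V}) (P : V -> V -> V -> bool).
Variables (k l j : K).
Hypotheses (kl : k != l) (kj : k != j) (lj : l != j).

Definition choices : {set {ffun K -> V}} := [set f in family (fun k => mem (F k))].

Lemma card_choices : #|choices| = \prod_k #|F k|.
Proof. by rewrite -card_family_prod cardsE. Qed.

(** For a uniformly random choice the values at [k], [l], [j] are uniform on the product of three
    sets; this is the resulting probability with denominators cleared. *)
Lemma card_restricted_choices :
  #|[set f in choices | P (f k) (f l) (f j)]| * (#|F k| * #|F l| * #|F j|)
  <= (\sum_(x in F k) \sum_(y in F l) \sum_(z in F j) P x y z) * #|choices|.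
Proof.
pose Fx x y z i := if i == k then [set x] else if i == l then [set y] else
  if i == j then [set z] else F i.
have Fx_card x y z :
    #|family (fun i => mem (Fx x y z i))| * (#|F k| * #|F l| * #|F j|) = #|choices|.
  rewrite card_family_prod card_choices.
  rewrite (bigD1 k) // (bigD1 l) ?(eq_sym l) //= (bigD1 j) ?(eq_sym j) ?kj ?lj //=.
  rewrite [RHS](bigD1 k) // [in RHS](bigD1 l) ?(eq_sym l) //=.
  rewrite [in RHS](bigD1 j) ?(eq_sym j) ?kj ?lj //=.
  rewrite /Fx !eqxx (eq_sym l k) (negPf kl) (eq_sym j k) (negPf kj).
  rewrite (eq_sym j l) (negPf lj) !cards1 !mul1n.
  rewrite [RHS]mulnCA.
  rewrite (eq_bigr (fun i => #|F i|)).
    by rewrite mulnC !mulnA (mulnC #|F l|).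
  by move=> i /andP[/andP[/negPf -> /negPf ->] /negPf ->].
rewrite -sum1_card.
have sub : \sum_(f in [set f in choices | P (f k) (f l) (f j)]) 1 <=
  \sum_(x in F k) \sum_(y in F l) \sum_(z in F j)
    P x y z * #|family (fun i => mem (Fx x y z i))|.
  apply: leq_trans (_ : _ <= \sum_(f in [set f in choices | P (f k) (f l) (f j)])
    \sum_(x in F k) \sum_(y in F l) \sum_(z in F j)
      P x y z * (f \in family (fun i => mem (Fx x y z i)))) _.
    apply: leq_sum => f; rewrite !inE => /andP[/familyP fF Pf].
    rewrite (bigD1 (f k)) ?fF //= (bigD1 (f l)) ?fF //= (bigD1 (f j)) ?fF //= Pf.
    suff -> : f \in family (fun i => mem (Fx (f k) (f l) (f j) i)) by [].
    apply/familyP => i; rewrite /Fx; case: eqP => [->|_]; first by rewrite inE.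
    case: eqP => [->|_]; first by rewrite inE.
    case: eqP => [->|_]; first by rewrite inE.
    exact: fF.
  rewrite exchange_big; apply: leq_sum => x _ /=.
  rewrite exchange_big; apply: leq_sum => y _ /=.
  rewrite exchange_big; apply: leq_sum => z _ /=.
  rewrite -big_distrr leq_mul2l; apply/orP; right => /=.
  rewrite -sum1_card big_mkcond [leqRHS]big_mkcond; apply: leq_sum => f _ /=.
  by case: (f \in family _); case: (f \in [set _ in _ | _]).
apply: leq_trans (leq_mul sub (leqnn _)) _.
rewrite !big_distrl; apply: leq_sum => x _ /=.
rewrite !big_distrl; apply: leq_sum => y _ /=.
rewrite !big_distrl; apply: leq_sum => z _ /=.
by rewrite -mulnA Fx_card.
Qed.

End Selection.

Section TransversalChoice.
Local Open Scope ring_scope.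
Variables (R : realFieldType) (V K : finType) (c : V -> K) (S : {set K}).

(** Union bound: a random transversal is bad at a given triple of parts with probability at most
    k/g^3, and there are at most m^3 triples of parts. *)
Lemma transversal_choice (F : {set {set V}}) (A : K -> {set V}) (k g : R)
  (n := #|V|) (m := #|S|) : (0 < n)%N -> 0 < g -> m%:R ^+ 3 * k < g ^+ 3 ->
  (forall i, i \in S -> A i \subset part c i) ->
  (forall i, i \in S -> g * n%:R <= #|A i|%:R) ->
  \sum_x \sum_y \sum_z (rainbow c S x y z && ([set x; y; z] \notin F))%:R
    <= k * n%:R ^+ 3 ->
  exists f : K -> V, (forall i, i \in S -> f i \in A i) /\
   (forall i j l, i \in S -> j \in S -> l \in S -> i != j -> i != l -> j != l ->
     [set f i; f j; f l] \in F).
Proof.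
move=> n0 g0 kg Apart Abig miss.
have np : 0 < n%:R :> R by rewrite ltr0n.
have /card_gt0P[x0 _] := n0.
(* The singletons make the choice total on [K] without affecting any probability. *)
pose B i := if i \in S then A i else [set x0].
pose Om := choices B.
pose P x y z := [set x; y; z] \notin F.
pose bad i j l := [set f in Om | P (f i) (f j) (f l)].
pose D (i j l : K) := [&& i != j, i != l & j != l].
have Om0 : 0 < #|Om|%:R :> R.
  rewrite ltr0n card_choices; apply: prodn_gt0 => i; rewrite /B.
  case: ifP => [/Abig|_]; last by rewrite cards1.
  by rewrite -(ltr0n R); apply: lt_le_trans; rewrite mulr_gt0.
have bad_le i j l : i \in S -> j \in S -> l \in S -> D i j l ->
    #|bad i j l|%:R * g ^+ 3 <= k * #|Om|%:R.
  move=> iS jS lS /and3P[ij il jl].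
  have BE h : h \in S -> B h = A h by rewrite /B => ->.
  have := card_restricted_choices B P ij il jl; rewrite !BE // -/Om -/(bad i j l).
  rewrite -(ler_nat R) !natrM => H.
  have H1 : #|bad i j l|%:R * (g * n%:R) ^+ 3
       <= #|bad i j l|%:R * (#|A i|%:R * #|A j|%:R * #|A l|%:R) :> R.
    have gn0 : 0 <= g * n%:R by rewrite mulr_ge0 ?ltW.
    rewrite ler_wpM2l ?ler0n // !exprSr expr0 mul1r.
    by apply: ler_pM; [exact: mulr_ge0| |apply: ler_pM; rewrite ?Abig|apply: Abig].
  have H2 : (\sum_(x in A i) \sum_(y in A j) \sum_(z in A l) P x y z)%N%:R
        <= k * n%:R ^+ 3 :> R.
    apply: le_trans miss; rewrite natr_sum big_mkcond; apply: ler_sum => x _ /=.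
    case: ifP => xA; last by do 2!(apply: sumr_ge0 => ? _).
    rewrite natr_sum big_mkcond; apply: ler_sum => y _ /=.
    case: ifP => yA; last by apply: sumr_ge0.
    rewrite natr_sum big_mkcond; apply: ler_sum => z _ /=.
    case: ifP => zA //; rewrite ler_nat /rainbow.
    have cA h v : h \in S -> v \in A h -> c v = h.
      by move=> hS /(subsetP (Apart h hS)); rewrite inE => /eqP.
    rewrite (cA _ _ iS xA) (cA _ _ jS yA) (cA _ _ lS zA) iS jS lS.
    by rewrite !(eq_sym _ i) (eq_sym l) ij il jl.
  have : #|bad i j l|%:R * g ^+ 3 * n%:R ^+ 3 <= k * #|Om|%:R * n%:R ^+ 3.
    rewrite -mulrA -exprMn; apply: le_trans H1 _; apply: le_trans H _.
    by rewrite mulrAC ler_wpM2r // ler0n.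
  by rewrite ler_pM2r // exprn_gt0.
have [/exists_inP[f fO /forall_inP ok]|] := boolP [exists f in Om,
   [forall i in S, [forall j in S, [forall l in S, D i j l ==> ~~ P (f i) (f j) (f l)]]]].
  exists f; split.
    by move=> i iS; move: fO; rewrite !inE => /familyP/(_ i); rewrite /B iS.
  move=> i j l iS jS lS ij il jl.
  have /forall_inP/(_ j jS)/forall_inP/(_ l lS)/implyP := ok i iS.
  by rewrite /D /P negbK ij il jl; apply.
move/exists_inPn => allbad; exfalso.
have : #|Om|%:R * g ^+ 3 <= \sum_(i in S) \sum_(j in S) \sum_(l in S) k * #|Om|%:R.
  apply: le_trans (_ : _ <= \sum_(i in S) \sum_(j in S) \sum_(l in S)
      (D i j l)%:R * #|bad i j l|%:R * g ^+ 3) _; last first.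
    apply: ler_sum => i iS; apply: ler_sum => j jS; apply: ler_sum => l lS.
    case: (boolP (D i j l)) => [d|_]; first by rewrite mul1r bad_le.
    rewrite !mul0r mulr_ge0 ?ler0n //.
    have n3 : 0 < n%:R ^+ 3 :> R by rewrite exprn_gt0.
    rewrite -(pmulr_lge0 _ n3); apply: le_trans miss.
    by do 3!(apply: sumr_ge0 => ? _).
  apply: le_trans (_ : (\sum_(f in Om) \sum_(i in S) \sum_(j in S) \sum_(l in S)
       (D i j l && (f \in bad i j l)))%N%:R * g ^+ 3 <= _).
    rewrite ler_wpM2r ?exprn_ge0 ?(ltW g0) // ler_nat -sum1_card; apply: leq_sum => f fO.
    have /forall_inPn[i iS /forall_inPn[j jS /forall_inPn[l lS]]] := allbad f fO.
    rewrite negb_imply negbK => /andP[d p].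
    by rewrite (bigD1 i) //= (bigD1 j) //= (bigD1 l) //= d [f \in _]inE fO p.
  rewrite exchange_big natr_sum mulr_suml; apply: ler_sum => i _ /=.
  rewrite exchange_big natr_sum mulr_suml; apply: ler_sum => j _ /=.
  rewrite exchange_big natr_sum mulr_suml; apply: ler_sum => l _ /=.
  rewrite ler_wpM2r ?exprn_ge0 ?(ltW g0) // -natrM ler_nat.
  case: (D i j l) => /=; last by rewrite big1.
  rewrite mul1n -sum1_card [leqRHS]big_mkcond [leqLHS]big_mkcond; apply: leq_sum => f _ /=.
  by case: (f \in bad i j l); case: (f \in Om).
have S3 : \sum_(i in S) \sum_(j in S) \sum_(l in S) k * #|Om|%:R
   = m%:R ^+ 3 * k * #|Om|%:R.
  rewrite !sumr_const -/m -[LHS]mulr_natl -[X in _ * X]mulr_natl -[X in _ * (_ * X)]mulr_natl.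
  ring.
rewrite S3 mulrC ler_pM2r // leNgt => /negP; apply.
exact: kg.
Qed.

End TransversalChoice.

Section Types.
Local Open Scope ring_scope.
Variables (R : realFieldType) (V K : finType) (c : V -> K) (S : {set K}).
Variables (G : {set {set V}}) (t : nat).
Local Notation N := (extension_order t).
Local Notation fatp := (fat G N).
Local Notation Gf := (fat_edges G t).
Local Notation m := (3 * t - 1)%N.
Local Notation n := #|V|.
(* In units of [n] (of [n^3] for [kappa], of [n^2] for [eps]): [kappa] bounds the
   missing rainbow triples, [h] and [p] the part sizes, [g1] the non-fat
   neighbours of a typical vertex in a part, [g2] is the size from which on a fat
   neighbourhood counts as rich, [g0] the number of candidates needed per part to
   find a copy of H, and [eps] the defect of the link of a vertex. *)
Variables (kappa g0 g1 g2 h p eps : R).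
Hypothesis t2 : (2 <= t)%N.
Hypothesis uG : uniform 3 G.
Hypothesis Gfree : ~~ contains (extension 3 (3 * t) (matching 3 t)) G.
Hypothesis cS : #|S| = m.
Hypothesis n_gt0 : (0 < n)%N.
Hypothesis miss : \sum_x \sum_y \sum_z (rainbow c S x y z && ([set x; y; z] \notin Gf))%:R
  <= kappa * n%:R ^+ 3.
Hypothesis part_ge : forall k, k \in S -> h * n%:R <= #|part c k|%:R.
Hypothesis part_le : forall k, k \in S -> #|part c k|%:R <= p * n%:R.
Hypotheses (g0_gt0 : 0 < g0) (g1_gt0 : 0 < g1) (h_gt0 : 0 < h).
Hypothesis kappa_small : m%:R ^+ 3 * kappa < g0 ^+ 3.
Hypothesis g0_le_h : g0 <= h - 3 * g1.
Hypothesis g0_le_g2 : g0 <= g2 - 2 * g1.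

Let np : 0 < n%:R :> R. Proof. by rewrite ltr0n. Qed.

Definition common_nb (e : {set V}) k := [set y in part c k | [forall v in e, fatp v y]].

Definition nb x k := [set y in part c k | fatp x y].

(** A complete transversal inside the common fat neighbourhoods has m - 2 = 3(t-1) vertices, enough
    for t-1 disjoint edges cross-fat to [e]. *)
Lemma core_contradiction e (J : {set K}) : e \in G -> J \subset S -> #|J| = (m - 2)%N ->
  (forall k, k \in J -> g0 * n%:R <= #|common_nb e k|%:R) -> False.
Proof.
move=> eG /subsetP JS cJ Jbig.
(* Parts outside [J] are filled with arbitrary vertices, since [transversal_choice] selects from all
   of [S]. *)
pose A k := if k \in J then common_nb e k else part c k.
have Apart k : k \in S -> A k \subset part c k.
  by move=> _; rewrite /A; case: ifP => // _; apply/subsetP => y; rewrite inE => /andP[].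
have Abig k : k \in S -> g0 * n%:R <= #|A k|%:R.
  move=> kS; rewrite /A; case: ifP => [/Jbig //|_].
  apply: le_trans (part_ge kS); rewrite ler_pM2r //.
  by move: g0_le_h g1_gt0; lra.
have kS3 : #|S|%:R ^+ 3 * kappa < g0 ^+ 3 by rewrite cS.
have [f [fA fG]] := transversal_choice n_gt0 g0_gt0 kS3 Apart Abig miss.
have cf k : k \in J -> c (f k) = k.
  move=> kJ; have := fA k (JS k kJ); rewrite /A kJ !inE => /andP[/eqP -> _].
  by [].
have f_inj : {in J &, injective f} by move=> k l kJ lJ E; rewrite -(cf k kJ) E cf.
have ef k v : k \in J -> v \in e -> fatp v (f k).
  move=> kJ ve; have := fA k (JS k kJ); rewrite /A kJ !inE => /andP[_ /forall_inP].
  exact.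
apply: (fat_core_free t2 uG Gfree (s := [:: e]) (A := f @: J)) => //=.
- by rewrite eG.
- apply/subsetP => e'; rewrite inE => /andP[/subsetP e'J /eqP/card3_triple].
  move=> [x [y [z [eE xy xz yz]]]].
  have /imsetP[i iJ xE] : x \in f @: J by apply: e'J; rewrite eE !inE eqxx.
  have /imsetP[j jJ yE] : y \in f @: J by apply: e'J; rewrite eE !inE eqxx orbT.
  have /imsetP[l lJ zE] : z \in f @: J by apply: e'J; rewrite eE !inE eqxx orbT.
  have ij : i != j by apply: contraNneq xy => E; rewrite xE yE E.
  have il : i != l by apply: contraNneq xz => E; rewrite xE zE E.
  have jl : j != l by apply: contraNneq yz => E; rewrite yE zE E.
  rewrite eE xE yE zE; apply: (@fat_edgesW _ _ t).
  by apply: fG => //; apply: JS.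
- move=> _ _ /imsetP[i iJ ->] /imsetP[j jJ ->] fij.
  have ij : i != j by apply: contraNneq fij => ->.
  have /card_gt0P[l] : (0 < #|J :\ i :\ j|)%N.
    have := cardsD1 i J; have := cardsD1 j (J :\ i).
    by rewrite iJ !inE eq_sym ij jJ cJ; move: t2; clear; lia.
  rewrite !inE => /and3P[lj li lJ].
  have E : [set f i; f j; f l] \in Gf.
    by apply: fG; rewrite ?JS // eq_sym.
  by apply: (fat_edgeP E); rewrite // !inE eqxx ?orbT.
- rewrite andbT; apply/cross_fatP => v _ ve /imsetP[k kJ ->]; exact: ef.
- rewrite card_in_imset // cJ; move: t2; clear; lia.
- by move: t2; clear; lia.
Qed.

Definition typical a := [forall k in S, (k != c a) ==>
  (#|part c k|%:R - g1 * n%:R <= #|nb a k|%:R)].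

Lemma card_nonnb a k : #|part c k :\: nb a k|%:R = #|part c k|%:R - #|nb a k|%:R :> R.
Proof.
have := cardsID (nb a k) (part c k).
rewrite (setIidPr _); last by apply/subsetP => y; rewrite inE => /andP[].
by move=> <-; rewrite natrD addrC addKr.
Qed.

Definition exceptional := [set a | (c a \in S) ==> ~~ typical a].

(** Some part holds more than g1 n vertices not fat to [a]; each of them, with any vertex of a third
    part, gives a missing rainbow triple at [a]. *)
Lemma atypical_missing a : c a \in S -> ~~ typical a ->
  g1 * n%:R * (h * n%:R) <=
  \sum_y \sum_z (rainbow c S a y z && ([set a; y; z] \notin Gf))%:R.
Proof.
move=> aS /forall_inPn[k kS]; rewrite negb_imply -ltNge => /andP[ka ltk].
have /card_gt0P[l] : (0 < #|S :\ c a :\ k|)%N.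
  have := cardsD1 (c a) S; have := cardsD1 k (S :\ c a).
  by rewrite aS !inE ka kS cS; move: t2; clear; lia.
rewrite !inE => /and3P[lk la lS].
apply: le_trans (_ : _ <= #|part c k :\: nb a k|%:R * #|part c l|%:R) _.
  apply: ler_pM; [by rewrite mulr_ge0 // ltW|by rewrite mulr_ge0 // ltW| |exact: part_ge].
  by rewrite card_nonnb; move: ltk; lra.
rewrite -natrM -sum1_card big_distrl natr_sum /= big_mkcond; apply: ler_sum => y _ /=.
case: ifP => [|_]; last by apply: sumr_ge0.
rewrite !inE => /andP[ny /eqP yk]; rewrite mul1n -sum1_card natr_sum big_mkcond.
apply: ler_sum => z _ /=; case: ifP => //; rewrite inE => /eqP zl.
rewrite /rainbow aS yk kS zl lS ka la lk /= ler_nat.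
rewrite yk eqxx /= in ny; have -> // : [set a; y; z] \notin Gf.
have ya : a != y by apply: contraNneq ka => ->; rewrite yk.
by apply: contra ny => E; apply: (fat_edgeP E) ya; rewrite !inE eqxx ?orbT.
Qed.

Lemma exceptional_count :
  #|exceptional|%:R <= #|[set x | c x \notin S]|%:R + kappa / (g1 * h) * n%:R.
Proof.
have sub : (#|exceptional| <= #|[set x | c x \notin S]| + #|[set x in exceptional | c x \in S]|)%N.
  apply: leq_trans (leq_card_setU _ _).1; apply: subset_leq_card; apply/subsetP => x.
  by rewrite !inE; case: (c x \in S); rewrite ?andbT.
apply: le_trans (_ : _ <= (#|[set x | c x \notin S]| + #|[set x in exceptional | c x \in S]|)%:R) _.
  by rewrite ler_nat.
rewrite natrD lerD2l.
have gh : 0 < g1 * n%:R * (h * n%:R) by rewrite !mulr_gt0.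
rewrite -(ler_pM2r gh).
have -> : kappa / (g1 * h) * n%:R * (g1 * n%:R * (h * n%:R)) = kappa * n%:R ^+ 3.
  by field; rewrite !gt_eqF.
apply: le_trans miss; rewrite -sum1_card natr_sum mulr_suml big_mkcond.
apply: ler_sum => a _ /=; case: ifP => [|_].
  rewrite !inE => /andP[ex aS]; rewrite aS in ex.
  by rewrite mul1r; apply: atypical_missing.
by do 2!(apply: sumr_ge0 => ? _).
Qed.

Definition good_pairs x := [set q : V * V | [&& [set x; q.1; q.2] \in G,
  q.1 \notin exceptional, q.2 \notin exceptional, fatp x q.1 & fatp x q.2]].

Lemma good_pairs_count x :
  \sum_a \sum_b ([set x; a; b] \in G)%:R <=
  #|good_pairs x|%:R + 2 * #|exceptional|%:R * n%:R + 2 * N%:R * n%:R :> R.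
Proof.
pose e a := (a \in exceptional : nat).
pose f a b := (([set x; a; b] \in G) && ~~ fatp x a : nat).
have s1 (a : nat) : (\sum_(v : V) a = n * a)%N by rewrite sum_nat_const.
have fs : (\sum_a \sum_b f a b <= n * N)%N.
  rewrite -s1; apply: leq_sum => a _; rewrite /f.
  case: (boolP (fatp x a)) => [_|]; first by rewrite big1 // => b _; rewrite andbF.
  rewrite /fat -ltnNge => /ltnW; apply: leq_trans; rewrite -sum1_card [leqRHS]big_mkcond /=.
  by apply: leq_sum => b _; rewrite inE andbT; case: ifP.
have fs' : (\sum_a \sum_b f b a <= n * N)%N by rewrite exchange_big.
have es : (\sum_a e a = #|exceptional|)%N.
  by rewrite -sum1_card [RHS]big_mkcond; apply: eq_bigr => a _; rewrite /e; case: ifP.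
have : (\sum_a \sum_b ([set x; a; b] \in G) <= #|good_pairs x|
   + (\sum_(a : V) \sum_(b : V) (e a + e b) + (\sum_a \sum_b f a b + \sum_a \sum_b f b a)))%N.
  have -> : #|good_pairs x| = (\sum_a \sum_b ((a, b) \in good_pairs x))%N.
    rewrite -sum1_card big_mkcond pair_bigA /=; apply: eq_bigr => -[a b] _ /=.
    by case: ifP.
  rewrite -!big_split; apply: leq_sum => a _ /=; rewrite -!big_split;
    apply: leq_sum => b _ /=.
  rewrite /e /f inE /= (tripleAC x b a); case: ([set x; a; b] \in G) => //=.
  by case: (a \in _); case: (b \in _); case: (fatp x a); case: (fatp x b).
have -> : (\sum_(a : V) \sum_(b : V) (e a + e b) = 2 * #|exceptional| * n)%N.
  rewrite (eq_bigr (fun a => n * e a + #|exceptional|)%N) => [|a _]; last first.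
    by rewrite big_split /= s1 es.
  by rewrite big_split /= -big_distrr /= es s1 addnn -mul2n -mulnA (mulnC n).
move=> H; have {}H : (\sum_a \sum_b ([set x; a; b] \in G) <= #|good_pairs x|
   + (2 * #|exceptional| * n + 2 * N * n))%N.
  by apply: leq_trans H _; rewrite !leq_add2l; move: fs fs'; clear; lia.
rewrite -addrA -!natrM -!natrD.
apply: le_trans (_ : _ <= (\sum_a \sum_b ([set x; a; b] \in G))%N%:R) _.
  by rewrite natr_sum; apply: ler_sum => a _; rewrite natr_sum.
by rewrite ler_nat.
Qed.

Lemma good_pairP x a b : (a, b) \in good_pairs x ->
  [set x; a; b] \in G /\ [/\ c a \in S, typical a, c b \in S & typical b] /\
  (fatp x a /\ fatp x b).
Proof.
rewrite in_set => /and5P[xab]; rewrite !in_set !negb_imply !andbT.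
by move=> /andP[aS ta] /andP[bS tb] fa fb.
Qed.

Lemma common_nb3 x a b k : #|nb x k|%:R - (#|part c k|%:R - #|nb a k|%:R)
   - (#|part c k|%:R - #|nb b k|%:R) <= #|common_nb [set x; a; b] k|%:R :> R.
Proof.
rewrite -!card_nonnb !lerBlDr -!natrD ler_nat.
apply: leq_trans (_ : _ <= #|common_nb [set x; a; b] k :|: (part c k :\: nb b k)
   :|: (part c k :\: nb a k)|)%N _; last first.
  apply: leq_trans (leq_card_setU _ _).1 _; rewrite leq_add2r.
  exact: (leq_card_setU _ _).1.
apply: subset_leq_card; apply/subsetP => y; rewrite !inE => /andP[-> fxy].
rewrite !andbT /=.
have [fa|] := boolP (fatp a y); last by rewrite orbT.
have [fb|] := boolP (fatp b y); last by rewrite orbT.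
rewrite !orbF; apply/forall_inP => v; rewrite !inE -orbA.
by case/or3P => /eqP ->.
Qed.

Lemma typical_nb a k : typical a -> k \in S -> k != c a ->
  #|part c k|%:R - #|nb a k|%:R <= g1 * n%:R.
Proof. by move=> /forall_inP/(_ k)H kS ka; move: (H kS); rewrite ka /=; lra. Qed.

Definition rich x := [set k in S | g2 * n%:R <= #|nb x k|%:R].

(** In a rich part of a colour other than those of [a] and [b], the vertex [x] has g2 n fat
    neighbours, of which the typical [a] and [b] exclude at most g1 n each. With m - 2 such parts
    [core_contradiction] applies to {x, a, b}. *)
Lemma good_pair_colours x a b : (a, b) \in good_pairs x ->
  (#|rich x :\ c a :\ c b| <= m - 3)%N.
Proof.
case/good_pairP => xab [[aS ta bS tb] [fa fb]].
rewrite leqNgt; apply/negP => big.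
have [|J Jsub cJ] := @subset_of_card K (rich x :\ c a :\ c b) (m - 2).
  by move: big t2; clear; lia.
apply: (core_contradiction xab _ cJ).
  by apply/subsetP => k /(subsetP Jsub); rewrite !inE => /and3P[_ _ /andP[]].
move=> k /(subsetP Jsub); rewrite !inE => /and3P[kb ka /andP[kS rk]].
apply: le_trans (common_nb3 x a b k).
have := typical_nb ta kS ka; have := typical_nb tb kS kb.
have : g0 * n%:R <= (g2 - 2 * g1) * n%:R by rewrite ler_pM2r.
move: rk; lra.
Qed.

Hypothesis good_many : forall x,
  (turan_density R m - eps) * n%:R ^+ 2 <= #|good_pairs x|%:R.
Hypothesis few_rich : ((m%:R - 2) * p + m%:R * g2) ^+ 2 < turan_density R m - eps.
Hypothesis poor_nb : (m%:R - 1) * (m%:R - 2) * p ^+ 2 - 2 * (m%:R - 2) * p * g1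
   < turan_density R m - eps.
Hypothesis g2_ge0 : 0 <= g2.
Hypothesis p_ge0 : 0 <= p.

Lemma nb_le x k : k \in S -> #|nb x k|%:R <= p * n%:R.
Proof.
move=> kS; apply: le_trans (part_le kS); rewrite ler_nat; apply: subset_leq_card.
by apply/subsetP => y; rewrite inE => /andP[].
Qed.

Lemma good_pairs_square x :
  (#|good_pairs x| <= (\sum_(k in S) #|nb x k|) ^ 2)%N.
Proof.
pose U := [set a | (c a \in S) && fatp x a].
have -> : (\sum_(k in S) #|nb x k| = #|U|)%N.
  rewrite -[RHS]sum1_card (partition_big c (mem S)) => [|a]; last by rewrite inE => /andP[].
  apply: eq_bigr => k kS; rewrite -sum1_card; apply: eq_bigl => y; rewrite !inE.
  by case: eqP => [->|]; rewrite ?andbF ?andbT // [k \in S]kS.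
rewrite -mulnn -cardsX; apply: subset_leq_card; apply/subsetP => -[a b] /good_pairP.
by move=> [_ [[aS _ bS _] [fa fb]]]; rewrite !inE aS bS fa fb.
Qed.

(** With at most m - 2 rich parts the fat neighbourhood of [x] is so small that its square is below
    the number of good pairs; [few_rich] is this inequality. *)
Lemma rich_ge x : (m - 1 <= #|rich x|)%N.
Proof.
rewrite leqNgt; apply/negP => few.
have m2 : (2 <= m)%N by move: t2; clear; lia.
have sum_nb : \sum_(k in S) #|nb x k|%:R <= ((m%:R - 2) * p + m%:R * g2) * n%:R.
  apply: le_trans (_ : _ <= \sum_(k in rich x) p * n%:R + \sum_(k in S) g2 * n%:R) _.
    rewrite [X in _ <= X + _]big_mkcond [X in _ <= _ + X]big_mkcond -big_split big_mkcond.
    apply: ler_sum => k _ /=; rewrite inE; case: ifP => //= kS.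
      case: ifP => [_|/negbT]; last by rewrite add0r -ltNge => /ltW.
      by rewrite (le_trans (nb_le x kS)) // lerDl mulr_ge0.
    by rewrite addr0.
  rewrite !sumr_const cS -(mulr_natl (p * _)) -(mulr_natl (g2 * _)) mulrDl -!mulrA lerD2r.
  rewrite ler_wpM2r ?mulr_ge0 // lerBrDr -natrD ler_nat.
  by move: few; clear; lia.
have s0 : 0 <= \sum_(k in S) #|nb x k|%:R :> R by apply: sumr_ge0.
have := good_pairs_square x; rewrite -(ler_nat R) natrX natr_sum => sq.
have : (\sum_(k in S) #|nb x k|%:R) ^+ 2 <= ((m%:R - 2) * p + m%:R * g2) ^+ 2 * n%:R ^+ 2.
  by rewrite -exprMn; apply: lerXn2r => //; rewrite nnegrE // (le_trans s0).
have n2 : 0 < n%:R ^+ 2 :> R by rewrite exprn_gt0.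
have : ((m%:R - 2) * p + m%:R * g2) ^+ 2 * n%:R ^+ 2 < (turan_density R m - eps) * n%:R ^+ 2.
  by rewrite ltr_pM2r.
by have := good_many x; move: sq; lra.
Qed.

(** [E2] is monotone in nonnegative weights, and the right side is its value at weight p - d on [j]
    and p elsewhere. *)
Lemma E2_le_shift (J : {set K}) (q : K -> R) (j : K) (d : R) (M : nat) :
  #|J| = M -> j \in J -> (forall k, k \in J -> 0 <= q k <= p) -> q j <= p - d ->
  E2 J q <= M%:R * (M%:R - 1) * p ^+ 2 - 2 * (M%:R - 1) * p * d.
Proof.
move=> cJ jJ qp qj; pose q' k := if k == j then p - d else p.
have q'E (f : R -> R) : \sum_(k in J) f (q' k) = f (p - d) + (M%:R - 1) * f p.
  rewrite (bigD1 j) //= /q' eqxx (eq_bigr (fun=> f p)); last first.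
    by move=> k /andP[_ /negPf ->].
  rewrite sum_neq // sumr_const cJ -[X in _ + (X - _)]mulr_natl; ring.
have -> : M%:R * (M%:R - 1) * p ^+ 2 - 2 * (M%:R - 1) * p * d = E2 J q'.
  rewrite E2_power_sums (q'E id) (q'E (fun x => x ^+ 2)) /=; ring.
have qq' k : k \in J -> 0 <= q k <= q' k.
  move=> kJ; have /andP[q0 qle] := qp k kJ; rewrite q0 /q'.
  by case: eqP => [->|].
apply: ler_sum => a aJ; apply: ler_sum => b /andP[bJ _].
have /andP[a0 aa] := qq' a aJ; have /andP[b0 bb] := qq' b bJ.
exact: ler_pM.
Qed.

(** A single good pair already limits the rich parts to m - 1, so exactly one part [i] is not rich,
    and every good pair uses two distinct rich colours. A deficit above g1 n in another part would
    push [E2] of the m - 1 neighbourhood sizes below the number of good pairs; this is [poor_nb]. *)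
Lemma type_exists x : exists2 i, i \in S &
  {in S, forall k, k != i -> #|part c k|%:R - g1 * n%:R <= #|nb x k|%:R}.
Proof.
have m5 : (5 <= m)%N by move: t2; clear; lia.
have [q0 q0g] : exists q, q \in good_pairs x.
  apply/card_gt0P; rewrite -(ltr0n R); apply: lt_le_trans (good_many x).
  rewrite mulr_gt0 ?exprn_gt0 //; apply: le_lt_trans few_rich; exact: sqr_ge0.
have rS : rich x \subset S by apply/subsetP => k; rewrite inE => /andP[].
have cdrop (k l : K) (J : {set K}) : (#|J| <= #|J :\ k :\ l| + 2)%N.
  have := cardsD1 k J; have := cardsD1 l (J :\ k).
  by case: (k \in J); case: (l \in J :\ k); clear; lia.
have cr : #|rich x| = (m - 1)%N.
  apply/eqP; rewrite eqn_leq rich_ge andbT; case: q0 q0g => a b /good_pair_colours.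
  by move: (cdrop (c a) (c b) (rich x)) m5; clear; lia.
have /card_gt0P[i] : (0 < #|S :\: rich x|)%N.
  by have := cardsID (rich x) S; rewrite (setIidPr rS) cr cS; move: m5; clear; lia.
rewrite inE => /andP[ir iS]; exists i => // j jS ji.
have richE k : k \in S -> k != i -> k \in rich x.
  move=> kS ki; have : S :\ i = rich x.
    apply/eqP; rewrite eq_sym eqEcard; apply/andP; split.
      by apply/subsetP => l lr; rewrite !in_setD1 (subsetP rS) // andbT;
        apply: contraNneq ir => <-.
    by have := cardsD1 i S; rewrite iS cS cr; clear; lia.
  by move=> <-; rewrite in_setD1 ki.
have good_col a b : (a, b) \in good_pairs x ->
    [/\ c a \in rich x, c b \in rich x & c b != c a].
  move=> ab; have := good_pair_colours ab; case/good_pairP: ab => _ [[aS _ bS _] _].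
  have nr l : (m - 2 <= #|rich x :\ l|)%N.
    by have := cardsD1 l (rich x); rewrite cr; case: (l \in _); clear; lia.
  have notin (l : K) (J : {set K}) : l \notin J -> J :\ l = J.
    by move=> lJ; apply/setP => y; rewrite !inE; case: eqP => // ->; rewrite (negPf lJ).
  move=> le3; split.
  - apply: contraT => /notin E; move: le3; rewrite E.
    by move: (nr (c b)) m5; clear; lia.
  - apply: contraT => bn; move: le3; rewrite notin; last first.
      by rewrite in_setD1 (negPf bn) andbF.
    by move: (nr (c a)) m5; clear; lia.
  - apply: contraT; rewrite negbK => /eqP E; move: le3; rewrite E notin ?in_setD1 ?eqxx //.
    by move: (nr (c a)) m5; clear; lia.
have gE2 : #|good_pairs x|%:R <= E2 (rich x) (fun k => #|nb x k|%:R : R).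
  rewrite /E2.
  have -> : \sum_(k in rich x) \sum_(l in rich x | l != k) #|nb x k|%:R * #|nb x l|%:R
     = (\sum_(k in rich x) \sum_(l in rich x | l != k) #|nb x k| * #|nb x l|)%N%:R :> R.
    rewrite natr_sum; apply: eq_bigr => k _; rewrite natr_sum; apply: eq_bigr => l _.
    by rewrite natrM.
  rewrite ler_nat -sum1_card (partition_big (fun q => c q.1) (mem (rich x))); last first.
    by move=> [a b] /good_col[].
  apply: leq_sum => k kr.
  rewrite (partition_big (fun q => c q.2) (fun l => (l \in rich x) && (l != k)));
    last first.
    by move=> [a b] /andP[/good_col[_ /= -> ba] /eqP <-].
  apply: leq_sum => l lr; rewrite sum1_card -cardsX; apply: subset_leq_card.
  apply/subsetP => -[a b]; rewrite unfold_in /= =>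
    /andP[/andP[/good_pairP ab /eqP ak] /eqP bl].
  by case: ab => _ [_ [fa fb]]; rewrite !inE /= ak bl !eqxx fa fb.
rewrite leNgt; apply/negP => lt_j.
have jr := richE j jS ji.
have qp k : k \in rich x -> 0 <= (#|nb x k|%:R : R) / n%:R <= p.
  move=> /(subsetP rS) kS; rewrite divr_ge0 //= ler_pdivrMr //; exact: nb_le.
have qj : #|nb x j|%:R / n%:R <= p - g1.
  rewrite ler_pdivrMr // mulrBl; have := part_le jS; move: lt_j; lra.
have := E2_le_shift cr jr qp qj; rewrite /=.
have -> : E2 (rich x) (fun k => #|nb x k|%:R / n%:R) = E2 (rich x) (fun k =>
  #|nb x k|%:R) / n%:R ^+ 2 :> R.
  rewrite /E2 mulr_suml; apply: eq_bigr => a _; rewrite mulr_suml; apply: eq_bigr => b _.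
  by rewrite -exprVn expr2 mulrACA.
have n2 : 0 < n%:R ^+ 2 :> R by rewrite exprn_gt0.
rewrite ler_pdivrMr // => H.
have : (turan_density R m - eps) * n%:R ^+ 2 <= 
  ((m - 1)%N%:R * ((m - 1)%N%:R - 1) * p ^+ 2 - 2 * ((m - 1)%N%:R - 1) * p * g1) * n%:R ^+ 2.
  by apply: le_trans (good_many x) (le_trans gE2 H).
rewrite ler_pM2r // leNgt => /negP; apply.
have -> : (m - 1)%N%:R = m%:R - 1 :> R by rewrite natrB //; move: m5; clear; lia.
by rewrite (_ : m%:R - 1 - 1 = m%:R - 2) //; ring.
Qed.

(** If two vertices of an edge share a type, the three vertices have at most two types, so in m - 2
    parts each of them misses at most g1 n fat neighbours. This contradicts [core_contradiction]. *)
Theorem rainbow_coloring : exists d : V -> K, (forall x, d x \in S) /\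
  (forall e x y, e \in G -> x \in e -> y \in e -> x != y -> d x != d y).
Proof.
have m5 : (5 <= m)%N by move: t2; clear; lia.
pose Ty x i := (i \in S) && [forall k in S,
  (k != i) ==> (#|part c k|%:R - g1 * n%:R <= #|nb x k|%:R)].
have TyP x : exists i, Ty x i.
  have [i iS H] := type_exists x; exists i; rewrite /Ty iS; apply/forall_inP => k kS.
  by apply/implyP => ki; apply: H.
exists (fun x => xchoose (TyP x)); have dP x := xchooseP (TyP x).
split=> [x|e x y eG xe ye xy]; first by have /andP[] := dP x.
have /card_gt0P[z] : (0 < #|e :\ x :\ y|)%N.
  have := cardsD1 x e; have := cardsD1 y (e :\ x); move/forall_inP: uG => /(_ e eG)/eqP ->.
  by rewrite xe !inE eq_sym xy ye; clear; lia.
rewrite !inE => /and3P[zy zx ze].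
have eE : e = [set x; y; z].
  apply/esym/eqP; rewrite triple_eq; last by move/forall_inP: uG => /(_ e eG)/eqP.
  by rewrite !inE xe ye ze zx zy eq_sym xy.
apply/eqP => dxy; have [|J Jsub cJ] := @subset_of_card K (S :\ xchoose (TyP x) :\ xchoose (TyP z)) (m - 2).
  have := cardsD1 (xchoose (TyP x)) S.
  have := cardsD1 (xchoose (TyP z)) (S :\ xchoose (TyP x)).
  by rewrite cS; case: (_ \in _); case: (_ \in _); clear; lia.
apply: (core_contradiction eG _ cJ).
  by apply/subsetP => k /(subsetP Jsub); rewrite !inE => /and3P[].
move=> k /(subsetP Jsub); rewrite !inE => /and3P[kz kx kS].
have nbk v : k != xchoose (TyP v) -> #|part c k|%:R - g1 * n%:R <= #|nb v k|%:R.
  by move=> kv; have /andP[_ /forall_inP/(_ k kS)/implyP] := dP v; apply.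
rewrite eE; apply: le_trans (common_nb3 x y z k).
have ky : k != xchoose (TyP y) by rewrite -dxy.
have := nbk x kx; have := nbk y ky; have := nbk z kz; have := part_ge kS.
have : g0 * n%:R <= (h - 3 * g1) * n%:R by rewrite ler_pM2r.
lra.
Qed.

End Types.

(** * Numerical inequalities in i = 1/m *)

Section Constants.
Local Open Scope ring_scope.
Variable R : realFieldType.

(** To first order the base is 1 - 15i/8, so its square is about 1 - 15i/4, against 1 - 3i on the
    right. *)
Lemma few_rich_num (M i : R) : M * i = 1 -> 0 < i -> i <= 5^-1 ->
  ((M - 2) * (i + i ^+ 4 / 200) + M * (i ^+ 2 / 8)) ^+ 2
  < (1 - i) * (1 - 2 * i) - i ^+ 2 / 100.
Proof.
move=> Mi i0 i5; set L := (X in X ^+ 2 < _).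
have LE : L = (1 - 2 * i) * (1 + i ^+ 3 / 200) + i / 8.
  have -> : L = (M * i) * (1 + i ^+ 3 / 200) - 2 * i * (1 + i ^+ 3 / 200) + (M * i) * (i / 8).
    by rewrite /L; field.
  by rewrite Mi; ring.
have i3 : 0 <= i ^+ 3 by rewrite exprn_ge0 ?ltW.
have i2 : i ^+ 2 <= 25^-1 by nra.
have {}i2 : i ^+ 3 <= 25^-1 * i by rewrite exprSr; apply: ler_wpM2r => //; apply: ltW.
have L0 : 0 <= L by rewrite LE addr_ge0 ?mulr_ge0 //; lra.
have L1 : L <= 1 - 187 / 100 * i.
  have : (1 - 2 * i) * (1 + i ^+ 3 / 200) <= 1 * (1 - 2 * i) + i ^+ 3 / 200 by nra.
  rewrite LE; lra.
have : L ^+ 2 <= (1 - 187 / 100 * i) ^+ 2.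
  by apply: lerXn2r => //; rewrite nnegrE (le_trans L0).
nra.
Qed.

(** The leading terms agree, so the comparison is of order i^2: the subtracted term is at least
    3i^2/80, more than i^2/100 plus the 3i^2/1000 caused by the excess in the part sizes. *)
Lemma poor_nb_num (M i : R) : M * i = 1 -> 0 < i -> i <= 5^-1 ->
  (M - 1) * (M - 2) * (i + i ^+ 4 / 200) ^+ 2
   - 2 * (M - 2) * (i + i ^+ 4 / 200) * (i ^+ 2 / 32)
  < (1 - i) * (1 - 2 * i) - i ^+ 2 / 100.
Proof.
move=> Mi i0 i5.
have -> : (M - 1) * (M - 2) * (i + i ^+ 4 / 200) ^+ 2
   - 2 * (M - 2) * (i + i ^+ 4 / 200) * (i ^+ 2 / 32)
  = (M * i - i) * (M * i - 2 * i) * (1 + i ^+ 3 / 200) ^+ 2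
   - 2 * (M * i - 2 * i) * (1 + i ^+ 3 / 200) * (i ^+ 2 / 32) by field.
rewrite Mi.
have [e [eE e0 e1]] : exists e, [/\ i ^+ 3 / 200 = e, 0 <= e & e <= i ^+ 2 / 1000].
  exists (i ^+ 3 / 200); split => //; first by rewrite divr_ge0 ?exprn_ge0 ?ltW.
  have : i ^+ 3 <= 5^-1 * i ^+ 2 by rewrite exprS; apply: ler_wpM2r => //; apply: sqr_ge0.
  lra.
rewrite eE.
have i2 : 0 < i ^+ 2 by rewrite exprn_gt0.
have i2' : i ^+ 2 <= 1 by rewrite expr2; nra.
have h1 : (1 - i) * (1 - 2 * i) * (1 + e) ^+ 2 <= (1 - i) * (1 - 2 * i) + 3 * e.
  have : (1 + e) ^+ 2 - 1 <= 3 * e by nra.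
  have : 0 <= (1 + e) ^+ 2 - 1 by nra.
  have : 0 <= (1 - i) * (1 - 2 * i) <= 1 by nra.
  move: ((1 - i) * (1 - 2 * i)) ((1 + e) ^+ 2) => P Q; nra.
have h2 : i ^+ 2 / 32 * (6 / 5) <= 2 * (1 - 2 * i) * (1 + e) * (i ^+ 2 / 32).
  rewrite mulrC; apply: ler_wpM2r; [lra|nra].
lra.
Qed.

End Constants.

Section LargeDegree.
Local Open Scope ring_scope.
Variable R : realFieldType.

Lemma turan_densityE (m : nat) (i : R) : m%:R * i = 1 ->
  turan_density R m = (1 - i) * (1 - 2 * i).
Proof.
move=> mi; have m0 : m%:R != 0 :> R.
  by apply/eqP => m0; rewrite m0 mul0r in mi; move/eqP: mi; rewrite eq_sym oner_eq0.
have -> : i = m%:R^-1 by rewrite -[LHS](mulKf m0) mi mulr1.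
by rewrite /turan_density; field.
Qed.

(* Here [i] stands for [1/m]; the exponents only have to be large enough. *)
Definition loc_eta (i : R) : R := i ^+ 9 / (1200 * 1000).
(** With this radius the term 5 m^4 x of [localisation] is half of [loc_eta]. *)
Definition loc_radius (i : R) : R := loc_eta i * i ^+ 4 / 10.
(** The two summands serve the two lower bounds on A in [localisation]. *)
Definition loc_weight m : R :=
  2 / gap R m + 10 / loc_radius m%:R^-1 ^+ 2.
(** From this order on, (A + 1)(C + 3N)/n is at most half of i^2 [loc_eta], the other half of what
    [localisation] may lose. *)
Definition degree_threshold t (C : R) : R :=
  let m := (3 * t - 1)%N in let i := m%:R^-1 in
  2 * (loc_weight m + 1) * (C + 3 * (extension_order t)%:R) / (i ^+ 2 * loc_eta i).

(** The left side collects, in units of n^2, what a link loses on the way to its good pairs: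
    exceptional vertices in either place, the degree defect and the non-fat pairs. *)
Lemma exceptional_num (i e : R) : 0 < i -> i <= 5^-1 -> e = loc_eta i ->
  6 * e / (i ^+ 2 / 32 * (i - i ^+ 4 / 200)) * 2 + 3 * e <= i ^+ 2 / 100.
Proof.
move=> i0 i5 eE.
have iw := ltW i0; have iw1 : i <= 1 by lra.
have i3 : i ^+ 3 <= 1 by rewrite exprn_ile1.
have i4 : i ^+ 4 <= i by rewrite exprS ler_piMr.
have h0 : i / 2 <= i - i ^+ 4 / 200 by lra.
have i20 : 0 < i ^+ 2 / 32 by rewrite divr_gt0 ?exprn_gt0.
have e0 : 0 < e by rewrite eE divr_gt0 ?exprn_gt0 ?mulr_gt0.
have den : i ^+ 2 / 32 * (i / 2) <= i ^+ 2 / 32 * (i - i ^+ 4 / 200).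
  by rewrite ler_pM2l.
have p : 0 < i ^+ 2 / 32 * (i / 2) by rewrite mulr_gt0 // divr_gt0.
have : 6 * e / (i ^+ 2 / 32 * (i - i ^+ 4 / 200)) <= 6 * e / (i ^+ 2 / 32 * (i / 2)).
  apply: ler_wpM2l; first by rewrite mulr_ge0 // ltW.
  by rewrite lef_pV2 ?posrE //; apply: lt_le_trans den.
have -> : 6 * e / (i ^+ 2 / 32 * (i / 2)) = 384 / (1200 * 1000) * i ^+ 6.
  by rewrite eE /loc_eta; field; apply: lt0r_neq0.
have i6 : i ^+ 6 <= i ^+ 2.
  rewrite (_ : i ^+ 6 = i ^+ 2 * i ^+ 4); last by ring.
  by rewrite ler_piMr ?sqr_ge0 // exprn_ile1.
have i9 : i ^+ 9 <= i ^+ 2.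
  rewrite (_ : i ^+ 9 = i ^+ 2 * i ^+ 7); last by ring.
  by rewrite ler_piMr ?sqr_ge0 // exprn_ile1.
rewrite eE /loc_eta; have := sqr_ge0 i; lra.
Qed.

Lemma rainbow_of_degree (V : finType) (G : {set {set V}}) t (C : R)
  (n := #|V|) (m := (3 * t - 1)%N) : (2 <= t)%N -> uniform 3 G ->
  ~~ contains (extension 3 (3 * t) (matching 3 t)) G -> (m <= n)%N -> 0 <= C ->
  degree_threshold t C <= n%:R ->
  (turan_density R m - C / n%:R) * n%:R ^+ 3 <= triple_count R G ->
  (forall x, (turan_density R m - C / n%:R) * n%:R ^+ 2 <=
     \sum_a \sum_b ([set x; a; b] \in G)%:R) ->
  exists d : V -> 'I_m, forall e x y, e \in G -> x \in e -> y \in e -> x != y -> d x != d y.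
Proof.
move=> t2 uG Gfree mn C0 nbig dens deg.
have m5 : (5 <= m)%N by rewrite /m; clear -t2; lia.
have m0 : 0 < m%:R :> R by rewrite ltr0n (leq_trans _ m5).
pose i : R := m%:R^-1.
have i0 : 0 < i by rewrite invr_gt0.
have mi : m%:R * i = 1 by rewrite mulfV ?gt_eqF.
have i5 : i <= 5^-1 by rewrite lef_pV2 ?posrE // ler_nat.
have n0 : (0 < n)%N by apply: leq_trans mn; apply: leq_trans m5.
have np : 0 < n%:R :> R by rewrite ltr0n.
have uGf := fat_edges_uniform t uG.
pose N := extension_order t.
pose eta := loc_eta i; pose x := loc_radius i; pose A := loc_weight m.
have eta0 : 0 < eta by rewrite divr_gt0 ?exprn_gt0 ?mulr_gt0.
have iw := ltW i0; have iw1 : i <= 1 by move: i5; clear; lra.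
have i91 : i ^+ 9 <= 1 by rewrite exprn_ile1.
have i41 : i ^+ 4 <= 1 by rewrite exprn_ile1.
have i21 : i ^+ 2 <= 1 by rewrite exprn_ile1.
have eta1 : eta <= 1 by rewrite /eta /loc_eta; move: i91; clear; lra.
have x0 : 0 < x by rewrite divr_gt0 // mulr_gt0 // exprn_gt0.
have x1 : x <= 1.
  have : eta * i ^+ 4 <= 1 by rewrite mulr_ile1 ?exprn_ge0 // ltW.
  rewrite /x /loc_radius -/eta; clear; lra.
have g0 : 0 < gap R m := gap_gt0 R m5.
have A0 : 0 < A by rewrite addr_gt0 // divr_gt0 // exprn_gt0.
have Ag : 2 <= A * gap R m.
  rewrite mulrDl divfK ?gt_eqF // lerDl mulr_ge0 ?ltW // divr_gt0 // exprn_gt0 //.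
have Ax : 10 <= A * x ^+ 2.
  rewrite mulrDl -/i -/x divfK; last by rewrite gt_eqF // exprn_gt0.
  by rewrite lerDr mulr_ge0 ?sqr_ge0 // divr_ge0 // ltW.
pose eps := (C + 3 * N%:R) / n%:R.
have eps0 : 0 <= eps by rewrite divr_ge0 ?addr_ge0 ?mulr_ge0 ?ler0n.
have Aeps : (A + 1) * eps <= i ^+ 2 * eta / 2.
  have ie0 : 0 < i ^+ 2 * eta by rewrite mulr_gt0 ?exprn_gt0.
  rewrite mulrA ler_pdivrMr //; move: nbig.
  rewrite /degree_threshold -/m -/i -/A -/N -/eta ler_pdivrMr //.
  by clear; lra.
have eps_eta : eps <= eta / 2.
  apply: le_trans (_ : _ <= (A + 1) * eps) _.
    by rewrite mulrDl mul1r lerDr mulr_ge0 // ltW.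
  apply: le_trans Aeps _; rewrite ler_pM2r ?invr_gt0 //.
  by rewrite mulrC ler_piMr // ltW.
have densGf : (turan_density R m - eps) * n%:R ^+ 3 <= triple_count R (fat_edges G t).
  have := fat_edges_count R t2 uG Gfree; rewrite -/n -/N => H.
  have -> : (turan_density R m - eps) * n%:R ^+ 3 =
      (turan_density R m - C / n%:R) * n%:R ^+ 3 - 3 * N%:R * n%:R ^+ 2.
    by rewrite /eps; field; rewrite gt_eqF.
  by move: dens H; clear; lra.
have [S [cS SG unat]] : exists S : {set V}, [/\ #|S| = m, clique S \subset fat_edges G t &
    #|unattached G t S|%:R <= eta * n%:R].
  have densw : turan_density R m - eps <= lagrangian (fat_edges G t) (fun=> n%:R^-1).
    by rewrite lagrangian_const exprVn mulrC ler_pdivlMr // exprn_gt0.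
  have x01 : 0 <= x <= 1 by rewrite ltW.
  have Aeps1 : (A + 1) * eps <= 1.
    apply: le_trans Aeps _.
    have : i ^+ 2 * eta <= 1 by rewrite mulr_ile1 ?exprn_ge0 // ltW.
    clear; lra.
  have [S [cS SG un]] := localisation t2 uG Gfree mn densw A0 Ag Ax x01 eps0 Aeps1.
  exists S; split => //; apply: le_trans un _; rewrite ler_pM2r //.
  have -> : m%:R ^+ 2 * (5 * m%:R ^+ 2 * x + (A + 1) * eps)
     = (m%:R * i) ^+ 4 * eta / 2 + m%:R ^+ 2 * ((A + 1) * eps).
    by rewrite /x /loc_radius -/eta; field.
  rewrite mi expr1n mul1r.
  have : m%:R ^+ 2 * ((A + 1) * eps) <= m%:R ^+ 2 * (i ^+ 2 * eta / 2).
    by rewrite ler_pM2l // exprn_gt0.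
  have -> : m%:R ^+ 2 * (i ^+ 2 * eta / 2) = (m%:R * i) ^+ 2 * eta / 2 by field.
  rewrite mi expr1n mul1r; clear; lra.
(* A vertex is coloured by a clique vertex to which it is attached; [None] is the colour of the
   unattached ones and lies outside [S']. *)
pose c z : option V := [pick s in S | attached G t S s z].
pose S' : {set option V} := Some @: S.
have cS' : #|S'| = m by rewrite card_imset // => ? ? [].
have cP z : c z \in S' -> exists s, [/\ s \in S, c z = Some s & attached G t S s z].
  rewrite /c; case: pickP => [s /andP[sS sz] _|_ /imsetP[] //].
  by exists s.
have cfat y z : c y = c z -> c y \in S' -> ~~ fat G N y z.
  move=> yz yS; have := yS; rewrite yz => /cP[s [sS zE zs]].
  have [s' [s'S yE ys]] := cP y yS; have ss : s' = s by move: yz; rewrite yE zE => -[].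
  rewrite ss in ys; exact: (attached_not_fat t2 uG Gfree cS SG sS ys zs).
have unc : #|[set z | c z \notin S']|%:R <= eta * n%:R :> R.
  apply: le_trans unat; rewrite ler_nat; apply: subset_leq_card; apply/subsetP => z.
  rewrite !in_set => zS; apply/forall_inP => s sS; apply: contra zS => sz.
  rewrite /c; case: pickP => [s' /andP[s'S _]|/(_ s)]; first exact: imset_f.
  by rewrite sS sz.
pose kappa : R := 6 * eta; pose xi : R := i ^+ 4 / 200.
have [] := @coloured_density R V _ c S' (fat_edges G t) m kappa xi cS' m5 n0 uGf.
- move=> e y z eF ye ze yz cyz; apply/negP => yS.
  by have := cfat y z cyz yS; rewrite (fat_edgeP eF).
- have : #|[set z | c z \notin S']|%:R * n%:R ^+ 2 <= eta * n%:R * n%:R ^+ 2 :> R.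
    by rewrite ler_pM2r // exprn_gt0.
  have : eps * n%:R ^+ 3 <= eta * n%:R ^+ 3.
    rewrite ler_pM2r ?exprn_gt0 //; move: eps_eta eta0; clear; lra.
  rewrite -mulrA -exprS mulrBl /kappa; move: densGf; rewrite mulrBl.
  have : 0 <= eta * n%:R ^+ 3 by rewrite mulr_ge0 ?(ltW eta0) ?exprn_ge0 ?ler0n.
  clear; rewrite -!(mulrA 6); lra.
- by rewrite divr_ge0 ?exprn_ge0.
(* Here 5 kappa = 30 eta = i^9/40000, and xi^2 = i^8/40000; this fixes the denominator of
   [loc_eta]. *)
- rewrite /kappa /xi /eta /loc_eta.
  have : i ^+ 9 <= (i ^+ 4) ^+ 2 by rewrite -exprM exprSr ler_piMr ?exprn_ge0.
  rewrite [(_ / 200) ^+ 2]exprMn exprVn; clear; lra.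
move=> parts miss.
have xii : xi <= i / 1000.
  rewrite /xi exprSr; have : i ^+ 3 <= 5^-1.
    by apply: le_trans i5; rewrite exprSr ler_piMl // exprn_ile1.
  move: i0; clear; nra.
have part_ge k : k \in S' -> (i - xi) * n%:R <= #|part c k|%:R.
  move=> kS; have := parts k kS; rewrite ler_norml -/i => /andP[H _].
  by rewrite -ler_pdivlMr //; move: H; clear; lra.
have part_le k : k \in S' -> #|part c k|%:R <= (i + xi) * n%:R.
  move=> kS; have := parts k kS; rewrite ler_norml -/i => /andP[_ H].
  by rewrite -ler_pdivrMr //; move: H; clear; lra.
pose g0' : R := i ^+ 2 / 16; pose g1 : R := i ^+ 2 / 32; pose g2 : R := i ^+ 2 / 8.
have i2 : 0 < i ^+ 2 by rewrite exprn_gt0.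
have i2i : i ^+ 2 <= i / 5 by rewrite expr2 ler_pM2l.
have g0p : 0 < g0' by rewrite divr_gt0.
have g1p : 0 < g1 by rewrite divr_gt0.
have g2p : 0 <= g2 by rewrite divr_ge0 ?ltW.
have hp : 0 < i - xi by move: i0 xii; clear; lra.
have pp : 0 <= i + xi by rewrite addr_ge0 ?divr_ge0 ?exprn_ge0 ?ltW.
have kap : m%:R ^+ 3 * kappa < g0' ^+ 3.
  have -> : m%:R ^+ 3 * kappa = (m%:R * i) ^+ 3 * i ^+ 6 / (200 * 1000).
    by rewrite /kappa /eta /loc_eta; field.
  have -> : g0' ^+ 3 = i ^+ 6 / (16 * 16 * 16) by rewrite /g0'; field.
  rewrite mi expr1n mul1r.
  have : 0 < i ^+ 6 by rewrite exprn_gt0.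
  clear; lra.
have g0h : g0' <= (i - xi) - 3 * g1.
  rewrite /g0' /g1; move: xii i2i i0; clear; lra.
have g0g : g0' <= g2 - 2 * g1 by rewrite /g0' /g1 /g2; clear; lra.
have Lam := turan_densityE mi.
have gm y : (turan_density R m - i ^+ 2 / 100) * n%:R ^+ 2
     <= #|good_pairs c S' G t g1 y|%:R.
  have H := good_pairs_count c S' G t g1 y; rewrite -/n -/N in H.
  have E := exceptional_count t2 cS' n0 miss part_ge g1p hp.
  rewrite -/n in E.
  have num := exceptional_num i0 i5 (erefl eta).
  rewrite -/eta -/g1 -/xi in num.
  have Q0 : 0 <= kappa / (g1 * (i - xi)).
    by rewrite divr_ge0 // mulr_ge0 ?ltW.
  have E' : #|exceptional c S' G t g1|%:R * n%:R <= (eta + kappa / (g1 * (i - xi))) * n%:R ^+ 2.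
    rewrite expr2 mulrA ler_pM2r // mulrDl; apply: le_trans E _.
    by rewrite lerD2r.
  have eps2 : (C / n%:R) * n%:R ^+ 2 + 2 * N%:R * n%:R <= eta * n%:R ^+ 2.
    apply: le_trans (_ : _ <= eps * n%:R ^+ 2) _; last first.
      by rewrite ler_pM2r ?exprn_gt0 //; move: eps_eta eta0; clear; lra.
    have -> : eps * n%:R ^+ 2 = C / n%:R * n%:R ^+ 2 + 3 * N%:R * n%:R.
      by rewrite /eps; field; rewrite gt_eqF.
    rewrite lerD2l; apply: ler_wpM2r; first exact: ltW.
    by apply: ler_wpM2r; [exact: ler0n|rewrite ler_nat].
  have num2 : (6 * eta / (g1 * (i - xi)) * 2 + 3 * eta) * n%:R ^+ 2 <= i ^+ 2 / 100 * n%:R ^+ 2.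
    by rewrite ler_pM2r ?exprn_gt0.
  have D := deg y.
  move: H E' eps2 num2 D; rewrite /kappa.
  move: (6 * eta / _) => Z; clear; lra.
have fr : ((m%:R - 2) * (i + xi) + m%:R * g2) ^+ 2 < turan_density R m - i ^+ 2 / 100.
  by rewrite Lam; apply: few_rich_num.
have pn : (m%:R - 1) * (m%:R - 2) * (i + xi) ^+ 2 - 2 * (m%:R - 2) * (i + xi) * g1
   < turan_density R m - i ^+ 2 / 100.
  by rewrite Lam; apply: poor_nb_num.
have [d [dS dP]] := rainbow_coloring t2 uG Gfree cS' n0 miss part_ge part_le g0p g1p
  kap g0h g0g gm fr pn g2p pp.
have lt_d y : (index (d y) (enum S') < m)%N by rewrite -cS' cardE index_mem mem_enum.
exists (fun y => Ordinal (lt_d y)) => e y z eG ye ze yz.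
apply: contra (dP e y z eG ye ze yz) => /eqP/(congr1 val)/= E.
by rewrite -(@nth_index _ (d y) (d y) (enum S')) ?mem_enum // E nth_index ?mem_enum.
Qed.

End LargeDegree.

(** * Turan graphs *)

Lemma card_parts (V K : finType) (c : V -> K) : \sum_k #|part c k| = #|V|.
Proof.
rewrite -[RHS]sum1_card (partition_big c predT) //; apply: eq_bigr => k _.
by rewrite -sum1_card; apply: eq_bigl => x; rewrite inE.
Qed.

(** The j-th element of each class goes to the j-th element of the class of the same colour. *)
Lemma fiber_bijection (A B K : finType) (c1 : A -> K) (c2 : B -> K) :
  (forall k, #|part c1 k| = #|part c2 k|) ->
  exists2 f : A -> B, bijective f & forall x, c2 (f x) = c1 x.
Proof.
move=> eq_part.
have ex x : exists y, (c2 y == c1 x) &&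
    (index y (enum (part c2 (c1 x))) == index x (enum (part c1 (c1 x)))).
  have lt_i : index x (enum (part c1 (c1 x))) < size (enum (part c2 (c1 x))).
    by rewrite -cardE -eq_part cardE index_mem mem_enum inE.
  have [y0 _] : exists y, y \in part c2 (c1 x).
    by apply/card_gt0P; rewrite cardE; apply: leq_ltn_trans lt_i.
  exists (nth y0 (enum (part c2 (c1 x))) (index x (enum (part c1 (c1 x))))).
  rewrite index_uniq ?enum_uniq // eqxx andbT.
  by have := mem_nth y0 lt_i; rewrite mem_enum inE.
pose f x := xchoose (ex x).
have fP x : (c2 (f x) == c1 x) && (index (f x) (enum (part c2 (c1 x)))
    == index x (enum (part c1 (c1 x)))) := xchooseP (ex x).
have fc x : c2 (f x) = c1 x by have /andP[/eqP] := fP x.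
exists f => //.
have f_inj : injective f.
  move=> x y fxy; have cxy : c1 x = c1 y by rewrite -!fc fxy.
  have /andP[_ /eqP ix] := fP x; have /andP[_ /eqP iy] := fP y.
  have : index x (enum (part c1 (c1 x))) = index y (enum (part c1 (c1 x))).
    by rewrite -ix fxy cxy iy.
  move=> E; have xi : x \in enum (part c1 (c1 x)) by rewrite mem_enum inE.
  have yi : y \in enum (part c1 (c1 x)) by rewrite mem_enum inE cxy.
  by rewrite -(nth_index x xi) E nth_index.
apply: inj_card_bij => //; rewrite -(card_parts c1) -(card_parts c2).
by apply: leq_sum => k _; rewrite eq_part.
Qed.

Section RainbowGraph.
Variables (V K : finType) (d : V -> K).

Definition rainbow_graph : {set {set V}} :=
  [set e : {set V} | (#|e| == 3) && [forall k, #|e :&: part d k| <= 1]].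

Lemma rainbow_graph_uniform : uniform 3 rainbow_graph.
Proof. by apply/forall_inP => e; rewrite inE => /andP[]. Qed.

Lemma rainbow_graphP (e : {set V}) : reflect (#|e| = 3 /\ {in e &,
  injective d}) (e \in rainbow_graph).
Proof.
rewrite inE; apply: (iffP andP) => [[/eqP e3 /forallP le1]|[e3 dinj]]; split => //.
- move=> x y xe ye dxy; apply/eqP; have := le1 (d x); apply: contraTT => xy.
  rewrite -ltnNge; apply: leq_trans (_ : #|[set x; y]| <= _); first by rewrite cards2 xy.
  apply: subset_leq_card; rewrite subUset !sub1set !inE xe ye eqxx.
  by rewrite dxy eqxx.
- exact/eqP.
apply/forallP => k; rewrite leqNgt; apply/negP => /card_gt1P[x [y []]].
rewrite !inE => /andP[xe /eqP xk] /andP[ye /eqP yk] /eqP; apply.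
by apply: dinj; rewrite // xk yk.
Qed.

Lemma mem_rainbow_graph x y z :
  ([set x; y; z] \in rainbow_graph) = [&& d x != d y, d x != d z & d y != d z].
Proof.
apply/rainbow_graphP/and3P => [[/eqP]|[xy xz yz]].
  rewrite triple_card3 => /and3P[xy xz yz] dinj.
  by split; [move: xy|move: xz|move: yz]; apply: contraNneq => E; apply/eqP/dinj;
    rewrite // !inE eqxx ?orbT.
have nx a b : d a != d b -> a != b by apply: contraNneq => ->.
split; first by apply/eqP; rewrite triple_card3 !nx.
move=> a b; rewrite !inE -!orbA => /or3P[] /eqP -> /or3P[] /eqP -> // /eqP;
  by rewrite ?(negPf xy) ?(negPf xz) ?(negPf yz) // eq_sym ?(negPf xy) ?(negPf xz) ?(negPf yz).
Qed.

Lemma sub_rainbow_graph (G : {set {set V}}) : uniform 3 G ->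
  (forall e x y, e \in G -> x \in e -> y \in e -> x != y -> d x != d y) ->
  G \subset rainbow_graph.
Proof.
move=> /forall_inP uG H; apply/subsetP => e eG; apply/rainbow_graphP.
split; first exact/eqP/uG.
by move=> x y xe ye dxy; apply/eqP; apply: contraT => /(H e x y eG xe ye); rewrite dxy eqxx.
Qed.

Section Count.
Local Open Scope ring_scope.
Variable R : realFieldType.

Lemma rainbow_graph_count :
  6 * #|rainbow_graph|%:R = E3 [set: K] (fun k => #|part d k|%:R : R).
Proof.
rewrite -rainbow_count -triple_count_edges; last exact: rainbow_graph_uniform.
apply: eq_bigr => x _; apply: eq_bigr => y _; apply: eq_bigr => z _.
rewrite !mulr1 mem_rainbow_graph /rainbow !in_setT /=.
by rewrite (eq_sym (d y) (d x)) (eq_sym (d z) (d x)) (eq_sym (d z) (d y)).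
Qed.

Lemma rainbow_degree (x : V) (M : R) (n := #|V|) :
  (forall k, #|part d k|%:R <= M) -> 2 * M <= n%:R ->
  (n%:R - M) * (n%:R - 2 * M) <= \sum_a \sum_b ([set x; a; b] \in rainbow_graph)%:R.
Proof.
move=> leM M2.
have M0 : 0 <= M by apply: le_trans (leM (d x)); apply: ler0n.
have out (k : K) : \sum_(b : V) (d b == k)%:R = #|part d k|%:R :> R.
  rewrite -sum1_card natr_sum [RHS]big_mkcond; apply: eq_bigr => b _.
  by rewrite inE; case: ifP.
have sum1 : \sum_(b : V) 1 = n%:R :> R by rewrite sumr_const.
apply: le_trans (_ : _ <= \sum_a (1 - (d a == d x)%:R) * (n%:R - 2 * M)) _.
  rewrite -mulr_suml; apply: ler_wpM2r; first by move: M2; lra.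
  by rewrite sumrB sum1 out; have := leM (d x); lra.
apply: ler_sum => a _.
have [ax|ax] := eqVneq (d a) (d x).
  by rewrite subrr mul0r; apply: sumr_ge0.
rewrite subr0 mul1r.
apply: le_trans (_ : _ <= \sum_b (1 - (d b == d x)%:R - (d b == d a)%:R)) _.
  by rewrite !sumrB sum1 !out; have := leM (d x); have := leM (d a); lra.
apply: ler_sum => b _; rewrite mem_rainbow_graph (eq_sym (d x) (d a)) ax.
rewrite (eq_sym (d x)) (eq_sym (d a)).
by case: (d b == d x); case: (d b == d a) => /=; lra.
Qed.

End Count.

End RainbowGraph.

(** Any two of the 3t core vertices lie in a common edge of H, so they would need pairwise different
    colours. *)
Lemma rainbow_graph_free (V : finType) t (d : V -> 'I_(3 * t - 1)) : 0 < t ->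
  ~~ contains (extension 3 (3 * t) (matching 3 t)) (rainbow_graph d).
Proof.
move=> t0; apply/negP => /existsP[f /andP[/injectiveP f_inj /forall_inP fG]].
pose C := core ('I_t * 'I_3)%type (3 * t).
have C3 : #|C| = 3 * t by rewrite card_core // card_prod !card_ord mulnC.
suff inj : injective (fun c : C => d (f (inl c))).
  by have := leq_card _ inj; rewrite C3 card_ord; lia.
move=> x y dxy; apply/eqP; apply: contraT => xy.
have edge e : e \in extension 3 (3 * t) (matching 3 t) -> inl x \in e -> inl y \in e ->
  False.
  move=> eE xe ye; have /rainbow_graphP[_ dinj] := fG e eE.
  have := dinj _ _ (imset_f f xe) (imset_f f ye) dxy.
  by move=> /f_inj[] E; rewrite E eqxx in xy.
have [/exists_inP[e eM]|ncov] := boolP (covered (core_edges (3 * t) (matching 3 t)) [set x; y]).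
  rewrite subUset !sub1set => /andP[xe ye]; exfalso.
  by apply: (edge (inl @: e)); rewrite ?imset_f // inE imset_f.
have uP : uncovered_pair (matching 3 t) [set x; y] by rewrite /uncovered_pair cards2 xy.
exfalso; apply: (edge (pair_edge 3 (exist _ [set x; y] uP))).
- by rewrite inE; apply/orP; right; apply: imset_f.
- by rewrite inE imset_f // !inE eqxx.
- by rewrite inE imset_f // !inE eqxx orbT.
Qed.

Section Balanced.
Variable m : nat.

Definition balanced (V : finType) (d : V -> 'I_m) :=
  forall k l, #|part d k| <= #|part d l| + 1.

Lemma balanced_sizes (V : finType) (d : V -> 'I_m) : balanced d ->
  (forall k, #|part d k| = #|V| %/ m \/ #|part d k| = (#|V| %/ m).+1) /\
  #|[set k | #|part d k| == (#|V| %/ m).+1]| = #|V| %% m.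
Proof.
move=> bal; have [m0|m0] := posnP m.
  split=> [k|]; first by have := ltn_ord k; rewrite [X in _ < X]m0.
  have V0 : #|V| = 0.
    apply: eq_card0 => x; have := ltn_ord (d x); by rewrite [X in _ < X]m0.
  rewrite V0 mod0n; apply/eqP; rewrite -leqn0; apply: leq_trans (max_card _) _.
  by rewrite card_ord m0.
pose k0 := [arg min_(k < Ordinal m0) #|part d k|].
have kmin k : #|part d k0| <= #|part d k| by rewrite /k0; case: arg_minnP => // i _; apply.
set s := #|part d k0| in kmin.
have sz k : #|part d k| = s + (#|part d k| == s.+1).
  by have := kmin k; have := bal k k0; rewrite -/s; case: eqP; lia.
have sumV : #|V| = m * s + #|[set k | #|part d k| == s.+1]|.
  rewrite -(card_parts d) (eq_bigr _ (fun k _ => sz k)) big_split /= sum_nat_const card_ord.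
  congr (_ + _); rewrite -sum1_card [RHS]big_mkcond; apply: eq_bigr => k _.
  by rewrite inE; case: eqP.
have lt_m : #|[set k | #|part d k| == s.+1]| < m.
  rewrite -[X in _ < X]card_ord -cardsT; apply: proper_card; apply/properP; split.
    exact: subsetT.
  by exists k0; rewrite ?inE // -/s; lia.
have -> : #|V| %/ m = s by rewrite sumV mulnC divnMDl // divn_small // addn0.
split.
  by move=> k; have := sz k; case: eqP => _; [right|left]; lia.
by rewrite sumV mulnC modnMDl modn_small.
Qed.

Lemma balanced_levels (V W : finType) (d : V -> 'I_m) (e : W -> 'I_m) v :
  balanced d -> balanced e -> #|V| = #|W| ->
  #|[set k | #|part d k| == v]| = #|[set k | #|part e k| == v]|.
Proof.
move=> /balanced_sizes[ds dn] /balanced_sizes[es en] VW.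
have [->|v1] := eqVneq v (#|V| %/ m).+1; first by rewrite dn VW en.
have [->|v0] := eqVneq v (#|V| %/ m).
  have compl (U : finType) (h : U -> 'I_m) :
      (forall k, #|part h k| = #|U| %/ m \/ #|part h k| = (#|U| %/ m).+1) ->
      [set k | #|part h k| == #|U| %/ m] = ~: [set k | #|part h k| == (#|U| %/ m).+1].
    by move=> hs; apply/setP => k; rewrite !inE; case: (hs k) => ->; rewrite eqxx;
      case: eqP => //; lia.
  rewrite compl // [in RHS]VW compl //.
  have := cardsC [set k | #|part d k| == (#|V| %/ m).+1].
  have := cardsC [set k | #|part e k| == (#|W| %/ m).+1].
  by rewrite dn en VW; lia.
have z (U : finType) (h : U -> 'I_m) : #|U| = #|V| ->
    (forall k, #|part h k| = #|U| %/ m \/ #|part h k| = (#|U| %/ m).+1) ->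
    #|[set k | #|part h k| == v]| = 0.
  move=> UV hs; apply: eq_card0 => k; rewrite inE; apply/negbTE.
  by case: (hs k) => ->; rewrite UV eq_sym.
by rewrite !z.
Qed.

(** Two uses of [fiber_bijection]: on the colours, classified by the size of their part, which gives
    a size-preserving permutation of colours; then on the vertices. *)
Lemma balanced_isomorphic (V W : finType) (d : V -> 'I_m) (e : W -> 'I_m) :
  balanced d -> balanced e -> #|V| = #|W| ->
  isomorphic (rainbow_graph d) (rainbow_graph e).
Proof.
move=> bd be VW.
pose sd k : 'I_(#|V|.+1) := inord #|part d k|.
pose se k : 'I_(#|V|.+1) := inord #|part e k|.
have lev v : #|part sd v| = #|part se v|.
  have lvl (U : finType) (h : U -> 'I_m) : #|U| = #|V| ->
      part (fun k => inord #|part h k| : 'I_(#|V|.+1)) v = [set k | #|part h k| == v].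
    move=> UV; apply/setP => k; rewrite !inE -(inj_eq val_inj) /= inordK //.
    by rewrite ltnS -UV max_card.
  by rewrite /sd /se !lvl // (balanced_levels v bd be VW).
have [p p_bij pE] := fiber_bijection lev.
have psize k : #|part e (p k)| = #|part d k|.
  have := congr1 val (pE k); rewrite /= !inordK // ltnS ?max_card //.
  by rewrite VW max_card.
have [q pK qK] := p_bij.
have [f f_bij fE] : exists2 f : V -> W, bijective f & forall x, e (f x) = p (d x).
  apply: fiber_bijection => k; rewrite -[k in RHS]qK psize.
  by apply: eq_card => x; rewrite !inE -[RHS](inj_eq (bij_inj p_bij)) qK.
have f_inj := bij_inj f_bij; have [g fK gK] := f_bij.
exists f => //; apply/setP => b; apply/rainbow_graphP/imsetP => [[b3 binj]|[a]].
  exists (f @^-1: b).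
    apply/rainbow_graphP; rewrite on_card_preimset; last by exists g => x _;
      rewrite ?fK ?gK.
    split => // x y; rewrite !inE => xb yb dxy; apply: f_inj; apply: binj => //.
    by rewrite !fE dxy.
  by apply/setP => y; apply/idP/imsetP => [yb|[x]];
    [exists (g y); rewrite ?inE gK | rewrite inE => xb ->].
move=> /rainbow_graphP[a3 ainj] ->; split; first by rewrite card_imset.
move=> _ _ /imsetP[x xa ->] /imsetP[y ya ->]; rewrite !fE => /(bij_inj p_bij) dxy.
by rewrite (ainj x y xa ya dxy).
Qed.

Lemma isomorphic_card (V W : finType) (F : {set {set V}}) (G : {set {set W}}) :
  isomorphic F G -> #|F| = #|G|.
Proof.
move=> [f f_bij ->]; rewrite card_imset //; apply: imset_inj; exact: bij_inj.
Qed.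

End Balanced.

Section Recolour.
Variables (V K : finType) (d : V -> K).

(** Moving one vertex between parts of sizes A and B gains (A - B - 1)(n - A - B) edges. The last
    factor is positive because an existing edge uses a third colour. *)
Lemma recolour_increases i j : #|part d j| + 2 <= #|part d i| -> 0 < #|rainbow_graph d| ->
  exists d' : V -> K, #|rainbow_graph d| < #|rainbow_graph d'|.
Proof.
move=> ji pos.
have ij : i != j by apply/eqP => E; move: ji; rewrite E; lia.
have /card_gt0P[x] : 0 < #|part d i| by lia.
rewrite inE => /eqP xi.
pose d' y := if y == x then j else d y; exists d'.
have di : #|part d i| = #|part d' i|.+1.
  rewrite (cardsD1 x) inE xi eqxx; congr _.+1; apply: eq_card => y; rewrite !inE /d'.
  by case: (y =P x) => [->|_] //=; rewrite eq_sym (negPf ij).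
have dj : #|part d' j| = #|part d j|.+1.
  rewrite (cardsD1 x) inE /d' !eqxx; congr _.+1; apply: eq_card => y; rewrite !inE.
  by case: (y =P x) => [->|_] //=; rewrite xi (negPf ij).
have dk k : k != i -> k != j -> #|part d' k| = #|part d k|.
  move=> ki kj; apply: eq_card => y; rewrite !inE /d'.
  by case: (y =P x) => [->|_] //; rewrite xi !(eq_sym _ k) (negPf ki) (negPf kj).
have more : #|part d i| + #|part d j| < #|V|.
  have /card_gt0P[e /rainbow_graphP[e3 einj]] := pos.
  have /card_gt0P[k] : 0 < #|d @: e :\: [set i; j]|.
    have := cardsID [set i; j] (d @: e); have :=
      subset_leq_card (subsetIr (d @: e) [set i; j]).
    by rewrite card_in_imset // e3 cards2; case: (i != j); clear; lia.
  rewrite !inE negb_or => /andP[/andP[ki kj] /imsetP[v _ kE]]; rewrite kE in ki kj.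
  rewrite -cardsT (cardsD1 v [set: V]) inE add1n ltnS -cardsUI.
  rewrite (_ : part d i :&: part d j = set0) ?cards0 ?addn0.
    apply: subset_leq_card; apply/subsetP => y; rewrite !inE andbT.
    by apply: contraTneq => ->; rewrite negb_or ki.
  by apply/setP => y; rewrite !inE; case: eqP => // ->; rewrite (negPf ij).
rewrite -(ltr_nat rat) -(ltr_pM2l (_ : 0 < 6)%R) // !rainbow_graph_count !E3_power_sums.
pose n : rat := #|V|%:R%R.
have S1 (h : V -> K) : (\sum_(k in [set: K]) #|part h k|%:R = n)%R.
  rewrite /n -(card_parts h) natr_sum; apply: eq_bigl => k; exact: in_setT.
have Sf (f : rat -> rat) : (\sum_(k in [set: K]) f #|part d' k|%:R
    = \sum_(k in [set: K]) f #|part d k|%:R - f #|part d i|%:R - f #|part d j|%:R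
      + f (#|part d i|%:R - 1) + f (#|part d j|%:R + 1))%R.
  have iT : i \in [set: K] by rewrite inE.
  have jT : (j \in [set: K]) && (j != i) by rewrite inE eq_sym.
  rewrite (bigD1 i iT) (bigD1 j jT) /= [in RHS](bigD1 i iT) [in RHS](bigD1 j jT) /=.
  rewrite (eq_bigr (fun k => f #|part d k|%:R%R)); last first.
    by move=> k /andP[/andP[_ ki] kj]; rewrite dk.
  by rewrite dj di -!natr1 addrK; ring.
rewrite !S1 (Sf (fun x => x ^+ 2)%R) (Sf (fun x => x ^+ 3)%R) -subr_gt0.
set A : rat := #|part d i|%:R%R; set B : rat := #|part d j|%:R%R.
set s2 := (\sum_(k in _) _)%R; set s3 := (\sum_(k in _) _)%R.
rewrite [ltRHS](_ : _ = 6 * ((A - B - 1) * (n - A - B)))%R; last by ring.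
rewrite mulr_gt0 // mulr_gt0 //.
  have : (B + 2 <= A)%R by rewrite -natrD ler_nat.
  lra.
have : (A + B < n)%R by rewrite -natrD ltr_nat.
lra.
Qed.

End Recolour.

Lemma rainbow_max_balanced (V : finType) m (d : V -> 'I_m) :
  (forall d' : V -> 'I_m, #|rainbow_graph d'| <= #|rainbow_graph d|) ->
  0 < #|rainbow_graph d| -> balanced d.
Proof.
move=> dmax pos k l; rewrite leqNgt; apply/negP => lt.
have [|d' lt_d'] := @recolour_increases _ _ d k l _ pos; first by lia.
by have := dmax d'; rewrite leqNgt lt_d'.
Qed.

Section TuranGraph.
Variables (m n : nat).
Hypothesis m0 : 0 < m.

Definition turan_color (x : 'I_n) : 'I_m := Ordinal (ltn_pmod x m0).

Lemma turan_partE (k : 'I_m) : part turan_color k = turan_part m n k.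
Proof. by apply/setP => x; rewrite !inE -(inj_eq val_inj). Qed.

Lemma turanE : turan 3 m n = rainbow_graph turan_color.
Proof.
by apply/setP => e; rewrite !inE; congr (_ && _).
Qed.

Lemma turan_color_balanced : balanced turan_color.
Proof. by move=> k l; rewrite !turan_partE turan_part_balanced. Qed.

Lemma rainbow_graph_le (V : finType) (d : V -> 'I_m) : #|V| = n ->
  #|rainbow_graph d| <= turan_number 3 m n.
Proof.
move=> Vn; pose N (f : {ffun V -> 'I_m}) := #|rainbow_graph f|.
have rbE (f : V -> 'I_m) : rainbow_graph (finfun f) = rainbow_graph f.
  by apply/setP => e; apply/rainbow_graphP/rainbow_graphP => -[e3 einj];
    split => // x y xe ye;
    have := einj x y xe ye; rewrite !ffunE.
pose dm := [arg max_(f > finfun d) N f].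
have dmax (f : V -> 'I_m) : #|rainbow_graph f| <= #|rainbow_graph dm|.
  by rewrite /dm; case: arg_maxnP => // g _ /(_ (finfun f) isT); rewrite /N rbE.
(* An edgeless maximum is trivially bounded; otherwise the maximal colouring is balanced and gives
   the Turan graph. *)
apply: leq_trans (dmax d) _; have [-> //|pos] := posnP #|rainbow_graph dm|.
rewrite /turan_number turanE; apply: eq_leq; apply: isomorphic_card.
apply: balanced_isomorphic turan_color_balanced _; last by rewrite card_ord.
exact: rainbow_max_balanced.
Qed.

Lemma rainbow_graph_extremal (V : finType) (d : V -> 'I_m) : #|V| = n ->
  0 < turan_number 3 m n -> #|rainbow_graph d| = turan_number 3 m n ->
  isomorphic (rainbow_graph d) (turan 3 m n).
Proof.
move=> Vn pos dE; rewrite turanE.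
apply: balanced_isomorphic turan_color_balanced _; last by rewrite card_ord.
by apply: rainbow_max_balanced; rewrite dE // => d'; apply: rainbow_graph_le.
Qed.

End TuranGraph.

Lemma pair_degree (V : finType) (F : {set {set V}}) (x : V) : uniform 3 F ->
  \sum_a \sum_b ([set x; a; b] \in F) = 2 * #|[set e in F | x \in e]|.
Proof.
move=> /forall_inP uF.
have edge2 e : e \in F -> \sum_a \sum_b ([set x; a; b] == e) = 2 * (x \in e).
  move=> eF; have e3 := eqP (uF e eF); case xe: (x \in e); last first.
    by rewrite big1 // => a _; rewrite big1 // => b _; rewrite triple_eq // xe.
  transitivity (\sum_(a in e :\ x) \sum_(b in e :\ x :\ a) 1).
    rewrite [RHS]big_mkcond; apply: eq_bigr => a _.
    case: ifP => ae; last by rewrite big1 // => b _; rewrite triple_eq // ae andbF.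
    rewrite [RHS]big_mkcond; apply: eq_bigr => b _.
    by rewrite triple_eq // ae xe; case: (b \in _).
  have e2 : #|e :\ x| = 2 by move: e3; rewrite (cardsD1 x) xe => -[].
  rewrite (eq_bigr (fun=> 1)) ?sum_nat_const ?e2 // => a ae.
  by rewrite sum1_card; move: e2; rewrite (cardsD1 a) ae => -[].
transitivity (\sum_(e in F) \sum_a \sum_b ([set x; a; b] == e)).
  rewrite [RHS]exchange_big; apply: eq_bigr => a _ /=.
  rewrite [RHS]exchange_big; apply: eq_bigr => b _ /=.
  have [eF|eF] := boolP (_ \in F).
    rewrite (bigD1 _ eF) /= eqxx big1 // => e /andP[_ ne].
    by rewrite eq_sym (negPf ne).
  rewrite big1 // => e eF'; case: eqP => // E; by rewrite E eF' in eF.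
rewrite (eq_bigr _ edge2) -big_distrr /= -sum1_card; congr (_ * _).
rewrite big_mkcond [RHS]big_mkcond; apply: eq_bigr => e _.
by rewrite inE; case: (e \in F); case: (x \in e).
Qed.

Section TuranNumbers.
Variable m : nat.
Hypothesis m5 : 5 <= m.
Let m0 : 0 < m := ltn_trans (isT : 0 < 4) m5.

(** Colouring by residues does not depend on n, so the smaller Turan graph consists of edges of the
    larger one avoiding the last vertex. *)
Lemma turan_step n :
  turan_number 3 m n + #|[set e in turan 3 m n.+1 | ord_max \in e]|
  <= turan_number 3 m n.+1.
Proof.
pose f : 'I_n -> 'I_n.+1 := widen_ord (leqnSn n).
have f_inj : injective f by move=> x y /(congr1 val) xy; apply: val_inj.
have fin_inj : injective (fun e : {set 'I_n} => f @: e) by apply: imset_inj.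
pose A : {set {set 'I_n.+1}} := (fun e : {set 'I_n} => f @: e) @: turan 3 m n.
rewrite /turan_number -(card_imset _ fin_inj) -/A; set B := [set e in _ | _].
have AB : [disjoint A & B].
  rewrite disjoint_subset; apply/subsetP => _ /imsetP[e _ ->]; rewrite !inE negb_and.
  apply/orP; right; apply/imsetP => -[x _ /(congr1 val) /= E].
  by have := ltn_ord x; rewrite -E ltnn.
have -> : #|A| + #|B| = #|A :|: B|.
  by rewrite cardsU (_ : A :&: B = set0) ?cards0 ?subn0 //; apply/eqP; rewrite setI_eq0.
apply: subset_leq_card; rewrite subUset; apply/andP; split; last first.
  by apply/subsetP => e; rewrite inE => /andP[].
apply/subsetP => _ /imsetP[e eT ->]; move: eT.
rewrite !(turanE _ m0) => /rainbow_graphP[e3 einj]; apply/rainbow_graphP.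
rewrite card_imset //; split => // _ _ /imsetP[x xe ->] /imsetP[y ye ->] E.
by congr f; apply: einj => //; apply: val_inj; exact: (congr1 val E).
Qed.

Section Bounds.
Local Open Scope ring_scope.
Variable R : realFieldType.

(** Parts have at most M = n/m + 1 vertices; expanding (n - M)(n - 2M) loses at most 3n against the
    density. *)
Lemma turan_degree n (x : 'I_n) : (4 <= n)%N ->
  (turan_density R m - 3 / n%:R) * n%:R ^+ 2 <=
     \sum_a \sum_b ([set x; a; b] \in turan 3 m n)%:R.
Proof.
move=> n4; pose i : R := m%:R^-1.
have mp : 0 < m%:R :> R by rewrite ltr0n.
have np : 4 <= n%:R :> R by rewrite ler_nat.
have i0 : 0 < i by rewrite invr_gt0.
have i5 : i <= 5^-1 by rewrite lef_pV2 ?posrE // ler_nat.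
have mi : m%:R * i = 1 by rewrite mulfV ?gt_eqF.
pose M : R := n%:R * i + 1.
have leM k : #|part (@turan_color m n m0) k|%:R <= M.
  rewrite turan_partE card_turan_part //.
  apply: le_trans (_ : _ <= (n %/ m + 1)%:R) _.
    by rewrite ler_nat leq_add2l; case: (_ < _)%N.
  rewrite natrD lerD2r ler_pdivlMr // -natrM ler_nat; exact: leq_trunc_div.
have M2 : 2 * M <= n%:R.
  have : n%:R * i <= n%:R * 5^-1 by rewrite ler_pM2l //; lra.
  rewrite /M; lra.
have := @rainbow_degree _ _ (@turan_color m n m0) R x M leM.
rewrite card_ord -turanE => /(_ M2); apply: le_trans.
have -> : (turan_density R m - 3 / n%:R) * n%:R ^+ 2 = turan_density R m * n%:R ^+ 2 - 3 * n%:R.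
  by field; apply: lt0r_neq0; lra.
rewrite (turan_densityE mi) /M.
have : 0 <= n%:R * i by apply: mulr_ge0; [apply: ler0n|apply: ltW].
lra.
Qed.

Lemma turan_triples n : (4 <= n)%N ->
  (turan_density R m - 3 / n%:R) * n%:R ^+ 3 <= 6 * (turan_number 3 m n)%:R.
Proof.
move=> n4; rewrite -(triple_count_edges R (turan_uniform 3 m n)).
apply: le_trans (_ : \sum_(x : 'I_n) (turan_density R m - 3 / n%:R) * n%:R ^+ 2 <= _).
  by rewrite sumr_const card_ord -[leRHS]mulr_natr -mulrA -exprSr.
apply: ler_sum => x _; apply: le_trans (turan_degree x n4) _.
by apply: ler_sum => a _; apply: ler_sum => b _; rewrite !mulr1.
Qed.

(** It turns a degree condition stated through consecutive Turan numbers into one stated through the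
    density. *)
Lemma turan_increment n : (4 <= n.+1)%N ->
  (turan_density R m - 3 / n.+1%:R) * n.+1%:R ^+ 2 + 2 * (turan_number 3 m n)%:R
  <= 2 * (turan_number 3 m n.+1)%:R.
Proof.
move=> n4; have := turan_step n; rewrite -(ler_nat R) natrD.
have := turan_degree ord_max n4.
have -> : \sum_a \sum_b ([set ord_max; a; b] \in turan 3 m n.+1)%:R
   = 2 * #|[set e in turan 3 m n.+1 | ord_max \in e]|%:R :> R.
  rewrite -natrM -pair_degree ?turan_uniform // natr_sum.
  by apply: eq_bigr => a _; rewrite natr_sum.
move=> le_deg le_step; apply: le_trans (lerD le_deg (lexx _)) _.
by rewrite -mulrDr ler_pM2l // addrC.
Qed.

End Bounds.
End TuranNumbers.

(** * Deletion of vertices of small degree *)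

Section Deletion.
Variables (V : finType) (x : V) (G : {set {set V}}).

Definition deleted : {set {set {y : V | y != x}}} :=
  [set e : {set {y : V | y != x}} | val @: e \in G].

Lemma deleted_uniform : uniform 3 G -> uniform 3 deleted.
Proof.
move=> /forall_inP uG; apply/forall_inP => e; rewrite inE => /uG.
by rewrite card_imset //; apply: val_inj.
Qed.

Lemma deleted_free (U : finType) (F : {set {set U}}) :
  ~~ contains F G -> ~~ contains F deleted.
Proof.
apply: contra => /existsP[f /andP[/injectiveP f_inj /forall_inP fG]].
apply/existsP; exists [ffun u => val (f u)]; apply/andP; split.
  by apply/injectiveP => u v; rewrite !ffunE => /val_inj/f_inj.
apply/forall_inP => e /fG; rewrite inE -imset_comp.
by rewrite [X in _ -> X \in _](eq_imset (g := val \o f)) // => u; rewrite ffunE.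
Qed.

Lemma card_deleted : #|G| <= #|deleted| + #|[set e in G | x \in e]|.
Proof.
rewrite -(cardsID [set e : {set V} | x \in e] G) addnC; apply: leq_add; last first.
  by apply: subset_leq_card; apply/subsetP => e; rewrite !inE.
pose f (e : {set V}) : {set {y : V | y != x}} := val @^-1: e.
have fK (e : {set V}) : x \notin e -> val @: f e = e.
  move=> xe; apply/setP => y; apply/imsetP/idP => [[z + ->]|ye]; first by rewrite inE.
  have yx : y != x by apply: contraNneq xe => <-.
  by exists (exist _ y yx); rewrite ?inE.
rewrite -(card_in_imset (f := f)).
  apply: subset_leq_card; apply/subsetP => _ /imsetP[e + ->].
  by rewrite !inE => /andP[xe eG]; rewrite fK.
by move=> e e'; rewrite !inE => /andP[xe _] /andP[xe' _] E; rewrite -(fK e) // E fK.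
Qed.

End Deletion.

Lemma card_uniform3 (V : finType) (G : {set {set V}}) : uniform 3 G -> #|G| <= #|V| ^ 3.
Proof.
move=> uG; rewrite -(ler_nat rat).
have : (6 * #|G|%:R <= #|V|%:R ^+ 3 :> rat)%R.
  rewrite -triple_count_edges // -natrX.
  apply: (@le_trans _ _ (\sum_(a : V) \sum_(b : V) \sum_(c : V) 1)%R).
    by do 3!(apply: ler_sum => ? _); rewrite !mulr1; case: (_ \in G).
  by rewrite !sumr_const -!mulrnA ler_nat !expnS expn0 muln1 mulnA.
have := ler0n rat #|G|; rewrite natrX; lra.
Qed.

(* Deleting a vertex of too small degree raises the surplus over the Turan
   number by at least one, which cannot go on for n1^3 steps. *)
Lemma degree_reduction t n1 (m := 3 * t - 1) :
  (forall (V : finType) (G : {set {set V}}), n1 <= #|V| -> uniform 3 G ->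
     ~~ contains (extension 3 (3 * t) (matching 3 t)) G ->
     turan_number 3 m #|V| <= #|G| ->
     (forall x, turan_number 3 m #|V| <=
        turan_number 3 m #|V|.-1 + #|[set e in G | x \in e]|) ->
     exists d : V -> 'I_m, G \subset rainbow_graph d) ->
  0 < m -> 0 < n1 ->
  forall (V : finType) (G : {set {set V}}) s, n1 <= #|V| -> uniform 3 G ->
     ~~ contains (extension 3 (3 * t) (matching 3 t)) G ->
     turan_number 3 m #|V| + s <= #|G| -> n1 ^ 3 < s + (#|V| - n1) ->
     s = 0 /\ exists d : V -> 'I_m, G \subset rainbow_graph d.
Proof.
move=> key m0 n10 V; have [k le_k] := ubnP #|V|.
elim: k V le_k => // k IHk V le_k G s n1V uG Gfree dens big.
have [/forallP deg|] := boolP [forall x, turan_number 3 m #|V| <=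
        turan_number 3 m #|V|.-1 + #|[set e in G | x \in e]|].
  have [|d dG] := key V G n1V uG Gfree _ deg; first by apply: leq_trans dens;
    apply: leq_addr.
  split; last by exists d.
  have := rainbow_graph_le m0 d erefl; have := subset_leq_card dG; lia.
case/forallPn => x; rewrite -ltnNge => lt_x.
pose V' : finType := {y : V | y != x}.
have cV' : #|V'| = #|V|.-1 by rewrite card_sig -(cardC1 x); apply: eq_card => y;
  rewrite !inE.
(* At n1 vertices the surplus would exceed n1^3, more than all possible edges. *)
have [eq_n1|lt_n1] := eqVneq #|V| n1.
  have := card_uniform3 uG; rewrite eq_n1; move: big dens; rewrite eq_n1 subnn; lia.
have V0 : 0 < #|V| by lia.
(* One vertex less and one more in the surplus keep s + (#|V| - n1) constant; the induction
   hypothesis then yields s + 1 = 0, which is absurd, so no vertex of small degree exists. *)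
have [||||||] := IHk V' _ (deleted x G) s.+1.
- by rewrite cV'; lia.
- by rewrite cV'; lia.
- exact: deleted_uniform.
- exact: deleted_free.
- have := leq_trans dens (card_deleted x G); rewrite cV'; move: lt_x.
  move: #|[set e in G | x \in e]| #|deleted x G| (turan_number 3 m #|V|) => g D T.
  by move: (turan_number 3 m #|V|.-1) => T'; clear; lia.
- by rewrite cV'; lia.
- by [].
Qed.

(** Both the size and the degrees of Turan graphs fall short of the density by 3/n, hence C = 3. The
    rationals are archimedean, so a natural number lies above the threshold. *)
Lemma high_degree_rainbow t : 2 <= t -> exists2 n1, 3 * t - 1 < n1 &
  forall (V : finType) (G : {set {set V}}), n1 <= #|V| -> uniform 3 G ->
     ~~ contains (extension 3 (3 * t) (matching 3 t)) G ->
     turan_number 3 (3 * t - 1) #|V| <= #|G| ->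
     (forall x, turan_number 3 (3 * t - 1) #|V| <=
        turan_number 3 (3 * t - 1) #|V|.-1 + #|[set e in G | x \in e]|) ->
     exists d : V -> 'I_(3 * t - 1), G \subset rainbow_graph d.
Proof.
move=> t2; pose b := Num.bound `|degree_threshold t (3 : rat)|%R.
have m5 : 5 <= 3 * t - 1 by lia.
exists (maxn b (3 * t)); first by lia.
move=> V G; rewrite geq_max => /andP[bV tV] uG Gfree dens deg.
have V4 : 4 <= #|V| by lia.
have [|||||d dG] := @rainbow_of_degree rat V G t 3%R t2 uG Gfree.
- lia.
- by [].
- apply: le_trans (_ : _ <= b%:R)%R _; last by rewrite ler_nat.
  exact: le_trans (ler_norm _) (ltW (archi_boundP (normr_ge0 _))).
- apply: le_trans (turan_triples m5 rat V4) _.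
  by rewrite triple_count_edges // ler_pM2l // ler_nat.
- move=> x; have := @turan_increment _ m5 rat #|V|.-1; rewrite prednK; last by lia.
  move=> /(_ V4) H.
  have -> : (\sum_a \sum_b ([set x; a; b] \in G)%:R = 2 * #|[set e in G | x \in e]|%:R :> rat)%R.
    rewrite -natrM -pair_degree // natr_sum.
    by apply: eq_bigr => a _; rewrite natr_sum.
  have : ((turan_number 3 (3 * t - 1) #|V|)%:R <= (turan_number 3 (3 * t - 1) #|V|.-1)%:R
       + #|[set e in G | x \in e]|%:R :> rat)%R by rewrite -natrD ler_nat.
  move: H; lra.
- by exists d; apply: sub_rainbow_graph.
Qed.
(** For m >= 5 the density is at least 12/25, and 3/7 is below it. *)
Lemma turan_number_gt0 m n : 5 <= m -> 7 <= n -> 0 < turan_number 3 m n.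
Proof.
move=> m5 n7; have := @turan_triples _ m5 rat n (ltn_trans (isT : 3 < 6) n7).
rewrite -(ltr0n rat) -(pmulr_rgt0 _ (_ : 0 < 6)%R) //; apply: lt_le_trans.
have mp : (5 <= m%:R :> rat)%R by rewrite ler_nat.
have np : (7 <= n%:R :> rat)%R by rewrite ler_nat.
have mi : (m%:R * m%:R^-1 = 1 :> rat)%R by rewrite mulfV // pnatr_eq0; lia.
rewrite mulr_gt0 ?exprn_gt0 ?ltr0n ?(ltn_trans _ n7) // (turan_densityE mi).
have i5 : (m%:R^-1 <= 5^-1 :> rat)%R by rewrite lef_pV2 ?posrE //; lra.
have n5 : (3 / n%:R <= 3 / 7 :> rat)%R by rewrite ler_pM2l // lef_pV2 ?posrE //; lra.
have i0 : (0 <= m%:R^-1 :> rat)%R by rewrite invr_ge0.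
nra.
Qed.

Theorem theorem3p5 (t : nat) (ht : 2 <= t) :
  (exists n0 : nat, forall n : nat, n0 <= n ->
     ex_number 3 n (extension 3 (3 * t) (matching 3 t))
     = turan_number 3 (3 * t - 1) n) /\
  (exists n0 : nat, forall n : nat, n0 <= n ->
     forall G : {set {set 'I_n}},
       uniform 3 G ->
       ~~ contains (extension 3 (3 * t) (matching 3 t)) G ->
       #|G| = turan_number 3 (3 * t - 1) n ->
       isomorphic G (turan 3 (3 * t - 1) n)).
Proof.
have [n1 mn1 key] := high_degree_rainbow ht.
have m0 : 0 < 3 * t - 1 by lia.
have n10 : 0 < n1 by lia.
(* For such n the surplus condition holds for every [s]: the excess over the Turan number gives the
   upper bound, s = 0 the uniqueness. *)
have large n (G : {set {set 'I_n}}) s : n1 + n1 ^ 3 < n -> uniform 3 G ->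
    ~~ contains (extension 3 (3 * t) (matching 3 t)) G ->
    turan_number 3 (3 * t - 1) n + s <= #|G| ->
    s = 0 /\ exists d : 'I_n -> 'I_(3 * t - 1), G \subset rainbow_graph d.
  move=> n_big uG Gfree dens.
  by apply: (degree_reduction key m0 n10); rewrite ?card_ord //; lia.
split; exists (n1 + n1 ^ 3).+1 => n n_big.
  apply/eqP; rewrite eqn_leq; apply/andP; split.
    apply/bigmax_leqP => G /andP[uG Gfree]; rewrite leqNgt; apply/negP => lt_G.
    have [|] := large n G (#|G| - turan_number 3 (3 * t - 1) n) n_big uG Gfree; lia.
  rewrite /turan_number; apply: (leq_bigmax_cond (F := fun G : {set {set 'I_n}} => #|G|)).
  by rewrite turan_uniform (turanE _ m0) rainbow_graph_free //; lia.
move=> G uG Gfree cG.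
have [|_ [d dG]] := large n G 0 n_big uG Gfree; first by rewrite cG addn0.
have GE : G = rainbow_graph d.
  by apply/eqP; rewrite eqEcard dG cG rainbow_graph_le ?card_ord.
rewrite GE; apply: rainbow_graph_extremal; rewrite ?card_ord -?GE //.
by apply: turan_number_gt0; lia.
Qed.
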